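(* Let $\mathcal{R}=\mathcal{R}_0\oplus\mathcal{R}_1$ be a complex non-nilpotent maximal solvable extension of a nilpotent Lie superalgebra $\mathcal{N}=\mathcal{N}_0\oplus\mathcal{N}_1$, with $[\mathcal{R},\mathcal{R}]\subseteq\mathcal{N}$ and $[\mathcal{R}_1,\mathcal{R}_1]\subseteq[\mathcal{R}_0,\mathcal{R}_0]$. Let $\mathcal{T}_{max}$ be a maximal torus of $\mathcal{N}$, let $\{y_1,\dots,y_m\}$ be a basis of $\mathcal{N}_1$ consisting of root vectors for $\mathcal{T}_{max}$ such that $y_1,\dots,y_s$ are the odd generator basis elements of $\mathcal{N}$, and let $\beta_j$ be the root of $y_j$. Assume: i) $\mathcal{R}_0$ is a solvable Lie algebra of maximal rank; ii) $\beta_i\neq\beta_j$ for all $i\in\{1,\dots,s\}$ and $j\in\{1,\dots,m\}$ with $j\neq i$. Then $\mathcal{R}\cong\mathcal{R}_{\mathcal{T}_{max}}$.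
   Context: All spaces are finite-dimensional over $\mathbb{C}$. A Lie superalgebra $\mathcal{L}=\mathcal{L}_0\oplus\mathcal{L}_1$ is a $\mathbb{Z}_2$-graded vector space with an even bilinear bracket satisfying super skew-symmetry and the super Jacobi identity. The nilradical is the maximal nilpotent ideal. An even superderivation of $\mathcal{L}$ is a parity-preserving linear map $d$ with $d([x,y])=[d(x),y]+[x,d(y)]$. A torus of $\mathcal{L}$ is a commuting Lie algebra of diagonalizable even superderivations of $\mathcal{L}$; a maximal torus is one not strictly contained in another torus. The root of a common eigenvector $y$ of $\mathcal{T}_{max}$ is the linear form $\beta$ on $\mathcal{T}_{max}$ with $d(y)=\beta(d)y$ for all $d\in\mathcal{T}_{max}$. Odd generator basis elements of $\mathcal{N}$ are odd basis elements whose images form a basis of $\mathcal{N}_1/[\mathcal{N}_1,\mathcal{N}_0]$ (the remaining $y_{s+1},\dots,y_m$ lying in $[\mathcal{N}_1,\mathcal{N}_0]$). $\mathcal{R}_{\mathcal{T}_{max}}=\mathcal{N}\dot{+}\mathcal{T}_{max}$ is the solvable Lie superalgebra (with $\mathcal{T}_{max}$ even) extending the bracket of $\mathcal{N}$ by $[x,d]=d(x)$, $[d,d']=0$ for $x\in\mathcal{N}$, $d,d'\in\mathcal{T}_{max}$. A solvable Lie algebra is of maximal rank if it is isomorphic to the analogous semidirect sum $\mathfrak{n}\dot{+}\mathfrak{t}$, where $\mathfrak{n}$ is its nilradical, $\mathfrak{t}$ is a maximal torus of derivations of $\mathfrak{n}$ and $\dim\mathfrak{t}=\dim(\mathfrak{n}/[\mathfrak{n},\mathfrak{n}])$.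 A maximal solvable extension of $\mathcal{N}$ is a solvable Lie superalgebra $\mathcal{R}$ with nilradical $\mathcal{N}$ such that $\dim(\mathcal{R}/\mathcal{N})$ is maximal among solvable Lie superalgebras $\mathcal{R}'=\mathcal{R}'_0\oplus\mathcal{R}'_1$ with nilradical $\mathcal{N}$ satisfying $[\mathcal{R}',\mathcal{R}']\subseteq\mathcal{N}$ and $[\mathcal{R}'_1,\mathcal{R}'_1]\subseteq[\mathcal{R}'_0,\mathcal{R}'_0]$. *)

(* Defs.v *)
From HB Require Import structures.
From mathcomp Require Import all_boot all_order all_algebra.
From mathcomp Require Import ring.

Set Implicit Arguments.
Unset Strict Implicit.
Unset Printing Implicit Defensive.

Import GRing.Theory VectorInternalTheory.
Local Open Scope ring_scope.

(* [hpart false] is the even part and [hpart true] the odd part; the Jacobi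
   identity is stated in its "left derivation" form. *)
Record lieSuper (K : fieldType) := LieSuper {
  carrier :> vectType K;
  hpart : bool -> {vspace carrier};
  br : carrier -> carrier -> carrier;
  hpart_cap : (hpart false :&: hpart true)%VS = 0%VS;
  hpart_add : (hpart false + hpart true)%VS = fullv;
  br_linear_r : forall x, linear (br x);
  br_linear_l : forall y, linear (br^~ y);
  br_hpart : forall (i j : bool) x y, x \in hpart i -> y \in hpart j ->
    br x y \in hpart (i (+) j);
  br_skew : forall (i j : bool) x y, x \in hpart i -> y \in hpart j ->
    br x y = - ((-1) ^+ (i && j) *: br y x);
  br_jacobi : forall (i j k : bool) x y z,
    x \in hpart i -> y \in hpart j -> z \in hpart k ->
    br x (br y z) = br (br x y) z + (-1) ^+ (i && j) *: br y (br x z)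
}.

Notation even_part L := (hpart L false).
Notation odd_part L := (hpart L true).

Section Basics.
Variables (K : fieldType) (L : lieSuper K).
Implicit Types (x y z : L) (U V W I J : {vspace L}).

Lemma brDl x y z : br (x + y) z = br x z + br y z.
Proof. by have := br_linear_l z 1 x y; rewrite !scale1r. Qed.

Lemma brDr x y z : br z (x + y) = br z x + br z y.
Proof. by have := br_linear_r z 1 x y; rewrite !scale1r. Qed.

Lemma br0l z : br 0 z = 0.
Proof. by apply: (addIr (br 0 z)); rewrite -brDl !add0r. Qed.

Lemma br0r z : br z 0 = 0.
Proof. by apply: (addIr (br z 0)); rewrite -brDr !add0r. Qed.

Lemma brZl a x z : br (a *: x) z = a *: br x z.
Proof. by have := br_linear_l z a x 0; rewrite !addr0 br0l addr0. Qed.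

Lemma brZr a x z : br z (a *: x) = a *: br z x.
Proof. by have := br_linear_r z a x 0; rewrite !addr0 br0r addr0. Qed.

Lemma brNl x z : br (- x) z = - br x z.
Proof. by rewrite -scaleN1r brZl scaleN1r. Qed.

Lemma brNr x z : br z (- x) = - br z x.
Proof. by rewrite -scaleN1r brZr scaleN1r. Qed.

(* The subspace [U, V]: by bilinearity it suffices to bracket two bases
   (compare [prodv] in falgebra), see [bracket_spaceP]. *)
Definition bracket_space U V : {vspace L} :=
  <<[seq br x y | x <- vbasis U, y <- vbasis V]>>%VS.

Lemma mem_bracket_space U V x y :
  x \in U -> y \in V -> br x y \in bracket_space U V.
Proof.
move=> /coord_vbasis -> /coord_vbasis ->.
elim/big_ind: _ => [|u v Hu Hv|i _]; first by rewrite br0l mem0v.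
  by rewrite brDl memvD.
rewrite brZl memvZ //.
elim/big_ind: _ => [|u v Hu Hv|j _]; first by rewrite br0r mem0v.
  by rewrite brDr memvD.
rewrite brZr memvZ //; apply/memv_span/allpairs_f; apply: mem_nth;
  by rewrite size_tuple.
Qed.

Lemma bracket_spaceP U V W :
  reflect (forall x y, x \in U -> y \in V -> br x y \in W)
          (bracket_space U V <= W)%VS.
Proof.
apply: (iffP idP) => [sUVW x y xU yV | brW].
  exact: subvP sUVW _ (mem_bracket_space xU yV).
by apply/span_subvP=> _ /allpairsP[[x y] [/vbasis_mem xU /vbasis_mem yV ->]];
  apply: brW.
Qed.

Definition lower_central I (k : nat) : {vspace L} :=
  iter k (fun J => bracket_space J I) I.

Definition derived_series I (k : nat) : {vspace L} :=
  iter k (fun J => bracket_space J J) I.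

Definition nilpotent_space I := exists k, lower_central I k = 0%VS.

Definition is_nilpotent := nilpotent_space fullv.

Definition is_solvable := exists k, derived_series fullv k = 0%VS.

Definition graded I := (I :&: even_part L + I :&: odd_part L)%VS = I.

(* For a graded subspace the left condition also gives the right one. *)
Definition is_ideal I := graded I /\ (bracket_space I fullv <= I)%VS.

Definition is_nilradical I :=
  [/\ is_ideal I, nilpotent_space I
    & forall J, is_ideal J -> nilpotent_space J -> (J <= I)%VS].

Definition is_even_superderivation (d : 'End(L)) :=
  (forall i, (d @: hpart L i <= hpart L i)%VS) /\
  (forall x y, d (br x y) = br (d x) y + br x (d y)).

Definition is_diagonalizable (d : 'End(L)) :=
  exists2 b : seq L, basis_of fullv b &
    forall v, v \in b -> exists a : K, d v = a *: v.

Definition is_torus (T : {vspace 'End(L)}) :=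
  (forall d, d \in T -> is_even_superderivation d /\ is_diagonalizable d) /\
  (forall d e, d \in T -> e \in T -> (d \o e)%VF = (e \o d)%VF).

Definition is_maximal_torus (T : {vspace 'End(L)}) :=
  is_torus T /\ forall T', is_torus T' -> (T <= T')%VS -> T' = T.

Lemma maximal_torusW T : is_maximal_torus T -> is_torus T.
Proof. by case. Qed.

Definition has_root (T : {vspace 'End(L)}) (beta : 'Hom(subvs_of T, K^o)) x :=
  x != 0 /\ forall d : subvs_of T, vsval d x = (beta d : K) *: x.

(* The classes of the family [b] modulo [W] form a basis of U / W. *)
Definition basis_of_quotient U W (b : seq L) :=
  (W <= U)%VS /\ (<<b>> + W)%VS = U /\
  forall c : 'I_(size b) -> K,
    \sum_i c i *: b`_i \in W -> forall i, c i = 0.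

(* [y] is a basis of the odd part whose first [s] members are the odd
   generator basis elements. *)
Definition odd_basis_with_generators (s : nat) (y : seq L) :=
  let W := bracket_space (odd_part L) (even_part L) in
  [/\ basis_of (odd_part L) y, (s <= size y)%N,
      basis_of_quotient (odd_part L) W (take s y)
    & forall x, x \in drop s y -> x \in W].

End Basics.

Arguments is_nilpotent {K} L.
Arguments is_solvable {K} L.

Section Morphisms.
Variables (K : fieldType).
Implicit Types L M N R : lieSuper K.

Definition is_morphism L M (f : 'Hom(L, M)) :=
  (forall i, (f @: hpart L i <= hpart M i)%VS) /\
  (forall x y, f (br x y) = br (f x) (f y)).

Definition isomorphic L M :=
  exists f : 'Hom(L, M), is_morphism f /\ bijective f.

(* [iota] identifies [N] with the nilradical of [R]. *)
Definition is_nilradical_embedding N R (iota : 'Hom(N, R)) :=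
  [/\ is_morphism iota, injective iota & is_nilradical (limg iota)].

Definition is_solvable_extension N R (iota : 'Hom(N, R)) :=
  is_solvable R /\ is_nilradical_embedding iota.

Definition is_admissible N R (iota : 'Hom(N, R)) :=
  (bracket_space (fullv : {vspace R}) fullv <= limg iota)%VS /\
  (bracket_space (odd_part R) (odd_part R)
     <= bracket_space (even_part R) (even_part R))%VS.

(* dim (R / N) *)
Definition extension_codim N R (iota : 'Hom(N, R)) : nat :=
  \dim {:R} - \dim (limg iota).

Definition is_maximal_solvable_extension N R (iota : 'Hom(N, R)) :=
  is_solvable_extension iota /\
  forall R' (iota' : 'Hom(N, R')),
    is_solvable_extension iota' -> is_admissible iota' ->
    (extension_codim iota' <= extension_codim iota)%N.

End Morphisms.

(* The Lie algebra L_0, as a Lie superalgebra with zero odd part. *)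
Section EvenAlgebra.
Variables (K : fieldType) (L : lieSuper K).
Let E : vectType K := subvs_of (even_part L).

Definition even_hpart (i : bool) : {vspace E} := if i then 0%VS else fullv.

Definition even_br (x y : E) : E := vsproj _ (br (vsval x) (vsval y)).

Lemma even_brE x y : vsval (even_br x y) = br (vsval x) (vsval y).
Proof.
by rewrite /even_br vsprojK //; have := br_hpart (subvsP x) (subvsP y).
Qed.

Lemma even_hpart_cap : (even_hpart false :&: even_hpart true)%VS = 0%VS.
Proof. by rewrite capv0. Qed.

Lemma even_hpart_add : (even_hpart false + even_hpart true)%VS = fullv.
Proof. by rewrite addv0. Qed.

Lemma even_br_linear_r x : linear (even_br x).
Proof. by move=> a y z; rewrite /even_br linearP brDr brZr linearP. Qed.

Lemma even_br_linear_l y : linear (even_br^~ y).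
Proof. by move=> a x z; rewrite /even_br linearP brDl brZl linearP. Qed.

Lemma even_br_hpart (i j : bool) x y :
  x \in even_hpart i -> y \in even_hpart j ->
  even_br x y \in even_hpart (i (+) j).
Proof.
case: i j => [] [] /=; rewrite ?memvf ?memv0 //.
- by move=> /eqP-> _; rewrite /even_br linear0 br0l linear0.
- by move=> _ /eqP->; rewrite /even_br linear0 br0r linear0.
Qed.

Lemma even_val_inj : injective (vsval : E -> L).
Proof. exact: val_inj. Qed.

Lemma even_br_skew (i j : bool) x y :
  x \in even_hpart i -> y \in even_hpart j ->
  even_br x y = - ((-1) ^+ (i && j) *: even_br y x).
Proof.
case: i => [|_].
  rewrite memv0 => /eqP-> _.
  by rewrite /even_br linear0 br0l br0r !linear0 ?scaler0 ?oppr0.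
move=> _; rewrite /= scale1r; apply: even_val_inj; rewrite linearN /= !even_brE.
by rewrite (br_skew (subvsP x) (subvsP y)) scale1r.
Qed.

Lemma even_br_jacobi (i j k : bool) x y z :
  x \in even_hpart i -> y \in even_hpart j -> z \in even_hpart k ->
  even_br x (even_br y z) =
    even_br (even_br x y) z + (-1) ^+ (i && j) *: even_br y (even_br x z).
Proof.
case: i => [|_ _ _].
  rewrite memv0 => /eqP-> _ _.
  by rewrite /even_br !(linear0, br0l, br0r) ?scaler0 ?addr0.
rewrite /= scale1r; apply: even_val_inj; rewrite linearD /= !even_brE.
by rewrite (br_jacobi (subvsP x) (subvsP y) (subvsP z)) scale1r.
Qed.

Definition even_algebra : lieSuper K :=
  LieSuper even_hpart_cap even_hpart_add even_br_linear_r even_br_linear_l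
    even_br_hpart even_br_skew even_br_jacobi.

End EvenAlgebra.

(* The semidirect sum of N and a torus T: the torus is even and
   [x, d] = d x, hence [d, x] = - d x, and [d, d'] = 0. *)
Section Semidirect.
Variables (K : fieldType) (N : lieSuper K) (T : {vspace 'End(N)}).
Hypothesis torT : is_torus T.
Let S : vectType K := (N * subvs_of T)%type.

Definition semi_hpart (i : bool) : {vspace S} :=
  ((linfun (fst : S -> N) @^-1: hpart N i)
     :&: (if i then lker (linfun (snd : S -> subvs_of T)) else fullv))%VS.

Definition semi_br (u v : S) : S :=
  (br u.1 v.1 + vsval v.2 u.1 - vsval u.2 v.1, 0).

Lemma mem_semi_hpart i (u : S) :
  (u \in semi_hpart i) = (u.1 \in hpart N i) && (i ==> (u.2 == 0)).
Proof.
rewrite /semi_hpart memv_cap -memv_preim lfunE /=.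
by case: i => /=; rewrite ?memvf // memv_ker lfunE.
Qed.

Lemma semi_hpart_cap : (semi_hpart false :&: semi_hpart true)%VS = 0%VS.
Proof.
apply/eqP; rewrite -subv0; apply/subvP=> -[x d].
rewrite memv_cap !mem_semi_hpart /= andbT memv0 => /and3P[x0 x1 /eqP->].
suff /eqP->: x == 0 by [].
by rewrite -memv0 -(hpart_cap N) memv_cap x0.
Qed.

Lemma semi_hpart_add : (semi_hpart false + semi_hpart true)%VS = fullv.
Proof.
apply/eqP; rewrite eqEsubv subvf; apply/subvP=> -[x d] _.
have := memvf x; rewrite -(hpart_add N) => /memv_addP[x0 x0P [x1 x1P ->]].
apply/memv_addP; exists (x0, d); first by rewrite mem_semi_hpart x0P.
exists (x1, 0); first by rewrite mem_semi_hpart x1P /= eqxx.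
by congr pair; rewrite /= ?addr0.
Qed.

Lemma semi_br_linear_r u : linear (semi_br u).
Proof.
move=> a v w; congr pair; last by rewrite /= scaler0 addr0.
rewrite /= brDr brZr !linearP add_lfunE scale_lfunE.
by apply: (can_inj v2rK); apply/rowP=> i; rewrite !(linearD, linearN, linearZ) /= !mxE; ring.
Qed.

Lemma semi_br_linear_l v : linear (semi_br^~ v).
Proof.
move=> a u w; congr pair; last by rewrite /= scaler0 addr0.
rewrite /= brDl brZl !linearP add_lfunE scale_lfunE.
by apply: (can_inj v2rK); apply/rowP=> i; rewrite !(linearD, linearN, linearZ) /= !mxE; ring.
Qed.

Lemma torus_hpart (d : subvs_of T) i x :
  x \in hpart N i -> vsval d x \in hpart N i.
Proof.
move=> xi; have [[[dN _] _] _] := (torT.1 _ (subvsP d), tt).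
by apply: (subvP (dN i)); apply: memv_img.
Qed.

Lemma torus_br (d : subvs_of T) x y :
  vsval d (br x y) = br (vsval d x) y + br x (vsval d y).
Proof. by have [[_ ->] _] := torT.1 _ (subvsP d). Qed.

Lemma torus_comm (d e : subvs_of T) x :
  vsval d (vsval e x) = vsval e (vsval d x).
Proof.
by have /lfunP/(_ x) := torT.2 _ _ (subvsP d) (subvsP e); rewrite !lfunE.
Qed.

Lemma semi_br_hpart (i j : bool) u v :
  u \in semi_hpart i -> v \in semi_hpart j -> semi_br u v \in semi_hpart (i (+) j).
Proof.
rewrite !mem_semi_hpart => /andP[ui u2] /andP[vj v2].
rewrite /= eqxx implybT andbT !memvD ?memvN ?br_hpart //.
- case: j vj v2 => [_ /eqP->|_ _]; first by rewrite linear0 zero_lfunE mem0v.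
  by rewrite addbF torus_hpart.
- case: i ui u2 => [_ /eqP->|_ _]; first by rewrite linear0 zero_lfunE mem0v.
  by rewrite addFb torus_hpart.
Qed.

Lemma semi_br_skew (i j : bool) u v :
  u \in semi_hpart i -> v \in semi_hpart j ->
  semi_br u v = - ((-1) ^+ (i && j) *: semi_br v u).
Proof.
rewrite !mem_semi_hpart => /andP[ui u2] /andP[vj v2].
congr pair; last by rewrite /= scaler0 oppr0.
rewrite /= (br_skew ui vj).
case: i j {ui vj} u2 v2 => [] [] /= => [/eqP-> /eqP->|/eqP-> _|_ /eqP->|_ _];
  rewrite ?linear0 ?zero_lfunE /=;
by apply: (can_inj v2rK); apply/rowP=> k; rewrite !(linearD, linearN, linearZ) /= !mxE; ring.
Qed.

Lemma semi_br_jacobi (i j k : bool) u v w :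
  u \in semi_hpart i -> v \in semi_hpart j -> w \in semi_hpart k ->
  semi_br u (semi_br v w) =
    semi_br (semi_br u v) w + (-1) ^+ (i && j) *: semi_br v (semi_br u w).
Proof.
case: u v w => [x a] [y b] [z c].
rewrite !mem_semi_hpart /= => /andP[xi ai] /andP[yj bj] /andP[zk ck].
congr pair; last by rewrite /= scaler0 addr0.
rewrite /= !zero_lfunE !(subr0, addr0) !(linearB, linearD) /= !torus_br.
rewrite !(brDl, brDr, brNl, brNr) (br_jacobi xi yj zk).
rewrite (br_skew yj (torus_hpart c xi)).
rewrite (torus_comm c a y) (torus_comm c b x) (torus_comm b a z) andbC.
case: i j {xi yj zk ck} ai bj => [] [] /= => [/eqP-> /eqP->|/eqP-> _|_ /eqP->|_ _];
  rewrite ?(linear0, zero_lfunE, br0l, br0r, expr1, expr0);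
by apply: (can_inj v2rK); apply/rowP=> l;
  rewrite !(linearD, linearN, linearZ) /= ?linear0 !mxE; ring.
Qed.

Definition semidirect : lieSuper K :=
  LieSuper semi_hpart_cap semi_hpart_add semi_br_linear_r semi_br_linear_l
    semi_br_hpart semi_br_skew semi_br_jacobi.

End Semidirect.

(* Lie algebras are the Lie superalgebras with zero odd part. *)
Definition solvable_of_maximal_rank (K : fieldType) (L : lieSuper K) :=
  [/\ odd_part L = 0%VS, is_solvable L
    & exists (n : lieSuper K) (iota : 'Hom(n, L)) (t : {vspace 'End(n)})
        (tmax : is_maximal_torus t),
      [/\ is_nilradical_embedding iota,
          \dim t =
            (\dim {:n} - \dim (bracket_space (fullv : {vspace n}) fullv))%N
        & isomorphic L (semidirect (maximal_torusW tmax))]].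

(* Main.v *)
Require Import Defs.
From HB Require Import structures.
From mathcomp Require Import all_boot all_order all_algebra.
From mathcomp Require Import reals complex.
From mathcomp Require Import ring zify.
From mathcomp Require Import boolp.

(** Write N_0, N_1 for the parts of N and C = [N_0, N_0].  For odd x in R the
    square of ad x is ad [x, x] / 2 with [x, x] in N, so N + <x> is a nilpotent
    ideal and R_1 lies in N.  Since R_0 has maximal rank, N_0 is its nilradical,
    and R = N + <sigma_1, ..., sigma_r> with commuting even sigma_i acting on N by
    derivations D_i, and root vectors x_1, ..., x_r of N_0 spanning a complement of
    C with D_i x_j = delta_ij x_j.  The semisimple parts p_i of the D_i span a torus
    T_1.  For every torus T' containing T_1, the algebra N + T' is again an
    admissible extension, so maximality of R gives dim T' <= r: T_1 is a maximal
    torus.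

    T_max is conjugate to T_1.  Let d in T_max be generic.  The derivations of N
    induce on N_0 / C an algebra containing all diagonal matrices, hence spanned by
    matrix units, and one exponential of a derivation for each index j makes x_j an
    eigenvector of d modulo C.  Then d lies in T_1 + k, where k consists of the
    derivations mapping N_0 to C.  By maximality of T_1 the homogeneous elements of
    k are nilpotent, so k acts nilpotently by Jacobson's theorem on weakly closed
    sets, and successive conjugations by exp u, u in k, move d into T_1.

    After this conjugation D_i - p_i is a nilpotent derivation vanishing on N_0 and
    commuting with T_max; by (ii) it kills the odd generators, so D_i = p_i and R
    is the semidirect sum. *)

Set Implicit Arguments.
Unset Strict Implicit.
Unset Printing Implicit Defensive.

Import Order.TTheory GRing.Theory Num.Theory.
Local Open Scope ring_scope.

(** * Semisimple operators *)

(** The two tori play unequal roles, and this shapes the proof. Hypothesis (ii) speaks of [T_max],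
    known to be maximal only for inclusion, whereas R supplies derivations attached to T_1. The
    maximality of R is not directly available for N + T_max: for S = N + T' the condition [S_1, S_1]
    <= [S_0, S_0] comes from x_i = p_i x_i = [x_i, p_i], which asks T' to contain the p_i. So it
    only bounds tori above T_1, and a conjugacy theorem must carry (ii) over. It is enough to
    conjugate one generic element, whose centralizer is that of all of T_max, and finite
    exponentials of nilpotent derivations suffice. Jacobson's theorem is used instead of Engel's
    because nilpotency is checked only on homogeneous elements of k, a set closed under brackets but
    not under sums. The p_i are needed because the D_i are diagonal on generators of N_0 but may a
    priori fail to be semisimple on N_1. Condition (ii) makes the root space of an odd generator
    one-dimensional within N_1; a nilpotent operator commuting with the torus acts there by a
    scalar, hence by 0. *)

Section Coordinates.
Import VectorInternalTheory.
Variables (K : fieldType) (V : vectType K).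
Implicit Types x y : V.

Definition vcoord x i := VectorInternalTheory.v2r x 0 i.

Lemma vcoordP x y : vcoord x =1 vcoord y -> x = y.
Proof. by move=> e; apply: (can_inj VectorInternalTheory.v2rK); apply/rowP. Qed.

Lemma vcoordD x y i : vcoord (x + y) i = vcoord x i + vcoord y i.
Proof. by rewrite /vcoord linearD mxE. Qed.

Lemma vcoordN x i : vcoord (- x) i = - vcoord x i.
Proof. by rewrite /vcoord linearN mxE. Qed.

Lemma vcoordZ a x i : vcoord (a *: x) i = a * vcoord x i.
Proof. by rewrite /vcoord linearZ mxE. Qed.

Lemma vcoord0 i : vcoord 0 i = 0.
Proof. by rewrite /vcoord linear0 mxE. Qed.

Definition vcoordE := (vcoordD, vcoordN, vcoordZ, vcoord0).
End Coordinates.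

(** Identities between linear combinations are checked in coordinates by [ring]. A term such as
    [f x] is an atom there, so linearity has to be expanded beforehand. *)
Ltac lincomb := apply: vcoordP => ?; rewrite ?vcoordE; ring.

Lemma linear_lfunE (K : fieldType) (U V : vectType K) (f : U -> V) :
  linear f -> linfun f =1 f.
Proof.
move=> l; pose L : {linear U -> V} := HB.pack f (GRing.isLinear.Build K U V _ f l).
exact: (lfunE L).
Qed.

Section Semisimple.
Variables (K : fieldType) (V : vectType K).
Implicit Types (f g h : 'End(V)) (U : V -> Prop) (x y : V).

(** A subspace as a predicate: eigenspaces, kernels of iterates, derivations and flags can then be
    used without being turned into a [vspace]. *)
Definition submod U := U 0 /\ forall a x y, U x -> U y -> U (a *: x + y).

Lemma submodD U x y : submod U -> U x -> U y -> U (x + y).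
Proof. by move=> [_ UD] Ux Uy; rewrite -[x]scale1r; apply: UD. Qed.

Lemma submodZ U a x : submod U -> U x -> U (a *: x).
Proof. by move=> [U0 UD] Ux; rewrite -[_ *: _]addr0; apply: UD. Qed.

Lemma submodN U x : submod U -> U x -> U (- x).
Proof. by move=> sU Ux; rewrite -scaleN1r; apply: submodZ. Qed.

Lemma submodB U x y : submod U -> U x -> U y -> U (x - y).
Proof. by move=> sU Ux Uy; apply: submodD => //; apply: submodN. Qed.

Lemma submod_sum U (I : Type) (r : seq I) (P : pred I) (F : I -> V) :
  submod U -> (forall i, P i -> U (F i)) -> U (\sum_(i <- r | P i) F i).
Proof.
move=> sU UF; elim/big_rec: _ => [|i x Pi Ux]; first by case: sU.
by apply: submodD => //; apply: UF.
Qed.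

Lemma submod_mem (W : {vspace V}) : submod (fun x => x \in W).
Proof. by split=> [|a x y Wx Wy]; rewrite ?mem0v ?memvD ?memvZ. Qed.

(** Finite sums of eigenvectors. Diagonalizability becomes a property of each vector, which passes
    to stable subspaces without choosing a basis. *)
Inductive eigsum f : V -> Prop :=
| Eigsum0 : eigsum f 0
| EigsumD c x y : f x = c *: x -> eigsum f y -> eigsum f (x + y).

Definition semisimple f := forall x, eigsum f x.

Lemma eigsum1 f c x : f x = c *: x -> eigsum f x.
Proof. by move=> fx; rewrite -[x]addr0; apply: EigsumD fx _; constructor. Qed.

Lemma eigsum_add f x y : eigsum f x -> eigsum f y -> eigsum f (x + y).
Proof.
move=> + fy; elim=> [|c {}x z fx _ IH]; first by rewrite add0r.
by rewrite -addrA; apply: EigsumD fx _.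
Qed.

Lemma eigsum_scale f a x : eigsum f x -> eigsum f (a *: x).
Proof.
elim=> [|c {}x z fx _ IH]; first by rewrite scaler0; constructor.
rewrite scalerDr; apply: (@EigsumD _ c) => //.
by rewrite linearZ /= fx !scalerA mulrC.
Qed.

Lemma eigsum_sum f (I : Type) (r : seq I) (P : pred I) (F : I -> V) :
  (forall i, P i -> eigsum f (F i)) -> eigsum f (\sum_(i <- r | P i) F i).
Proof.
move=> fF; elim/big_rec: _ => [|i x Pi fx]; first by constructor.
by apply: eigsum_add => //; apply: fF.
Qed.

Lemma eigsum_group f x : eigsum f x -> exists (s : seq K) (v : K -> V),
  [/\ uniq s, x = \sum_(c <- s) v c & forall c, f (v c) = c *: v c].
Proof.
elim=> [|c {}x y fx _ [s [v [us -> fv]]]].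
  by exists [::], (fun=> 0); split=> // [|c]; rewrite ?big_nil // linear0 scaler0.
case: (boolP (c \in s)) => cs; last first.
  exists (c :: s), (fun a => if a == c then x else v a).
  split=> [|| a]; first by rewrite /= cs.
    rewrite big_cons eqxx; congr (_ + _); rewrite !big_seq.
    by apply: eq_bigr => a as_; case: eqP => // ac; rewrite -ac as_ in cs.
  by case: eqP => [->|].
exists s, (fun a => if a == c then x + v a else v a); split=> // [| a].
  rewrite (bigD1_seq c) //= [RHS](bigD1_seq c) //= eqxx addrA; congr (_ + _).
  by apply: eq_bigr => a /negPf->.
by case: eqP => [->|_ //]; rewrite linearD /= fx fv scalerDr.
Qed.

(** The operator f - c kills the component [v c] and multiplies each other [v a] by the nonzero
    scalar a - c, so the list of eigenvalues shrinks by one. *)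
Lemma stable_components f U (s : seq K) (v : K -> V) :
  submod U -> (forall x, U x -> U (f x)) -> uniq s ->
  (forall c, f (v c) = c *: v c) -> U (\sum_(c <- s) v c) ->
  forall c, c \in s -> U (v c).
Proof.
move=> sU Uf; elim: s v => // c s IH v /= /andP[cs us] fv.
rewrite big_cons => Ux.
have H a : a \in s -> U (v a).
  move=> as_; have ac : a - c != 0.
    by rewrite subr_eq0; apply: contraNneq cs => <-.
  rewrite -[v a]scale1r -(mulVf ac) -scalerA; apply: submodZ => //.
  apply: (IH (fun a => (a - c) *: v a)) => // [b|].
    by rewrite linearZ /= fv !scalerA mulrC.
  set y := v c + _ in Ux; have := submodB sU (Uf _ Ux) (submodZ c sU Ux).
  congr U; rewrite /y linearD /= fv scalerDr opprD addrACA subrr.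
  rewrite add0r linear_sum scaler_sumr -sumrB.
  by apply: eq_bigr => b _; rewrite /= fv scalerBl.
move=> a; rewrite inE => /orP[/eqP->|]; last exact: H.
rewrite -[v c](addrK (\sum_(a <- s) v a)); apply: submodB => //.
by rewrite big_seq; apply: submod_sum.
Qed.

(** The restriction of a semisimple operator to a stable subspace is semisimple. The components are
    set to 0 outside [s], so that the conclusion holds for every [c]. *)
Lemma semisimple_stable f U x :
  semisimple f -> submod U -> (forall y, U y -> U (f y)) -> U x ->
  exists (s : seq K) (v : K -> V),
  [/\ uniq s, x = \sum_(c <- s) v c & forall c, U (v c) /\ f (v c) = c *: v c].
Proof.
move=> /(_ x)/eigsum_group[s [v [us -> fv]]] sU Uf Ux.
have Uv := stable_components sU Uf us fv Ux.
exists s, (fun c => if c \in s then v c else 0); split=> // [|c].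
  by rewrite big_seq [RHS]big_seq; apply: eq_bigr => c ->.
by case: ifP => [/Uv|_]; rewrite ?linear0 ?scaler0 //; split=> //; case: sU.
Qed.

Lemma iter_eig f c x k : f x = c *: x -> iter k f x = c ^+ k *: x.
Proof.
move=> fx; elim: k => [|k IH]; first by rewrite scale1r.
by rewrite iterS IH linearZ /= fx scalerA exprSr.
Qed.

Lemma iter_lfun_linear f k : linear (iter k f).
Proof. by elim: k => // k IH a x y; rewrite !iterS IH linearP. Qed.
HB.instance Definition _ f k :=
  GRing.isLinear.Build K V V _ (iter k f) (iter_lfun_linear f k).

Lemma semisimple_nil f x k : semisimple f -> iter k f x = 0 -> f x = 0.
Proof.
move=> ssf fx0.
have [||s [v [_ -> vP]]] :=
  semisimple_stable (U := fun y => iter k f y = 0) ssf _ _ fx0.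
- by split=> [|a y z y0 z0]; rewrite ?linearP ?linear0 //= y0 z0 scaler0 addr0.
- by move=> y y0; rewrite -iterSr iterS y0 linear0.
rewrite linear_sum big1 // => c _; have [v0 fv] := vP c.
move: v0; rewrite (iter_eig _ fv) /= fv => /eqP.
rewrite scaler_eq0 expf_eq0 => /orP[/andP[_ /eqP->]|/eqP->]; first by rewrite scale0r.
by rewrite scaler0.
Qed.

Definition commute_op f g := forall x, f (g x) = g (f x).

(** Simultaneous diagonalization: [g] preserves each eigenspace of [f] and is semisimple on it. *)
Lemma semisimple_lincomb f g a b : semisimple f -> semisimple g ->
  commute_op f g -> semisimple (a *: f + b *: g).
Proof.
move=> ssf ssg fg x; have /eigsum_group[s [v [_ -> fv]]] := ssf x.
apply: eigsum_sum => c _.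
have [||t [w [_ -> wP]]] :=
  semisimple_stable (U := fun y => f y = c *: y) ssg _ _ (fv c).
- split=> [|d y z y0 z0]; first by rewrite linear0 scaler0.
  by rewrite linearP /= y0 z0 scalerDr !scalerA mulrC.
- by move=> y y0; rewrite fg y0 linearZ.
apply: eigsum_sum => d _; have [fw gw] := wP d.
apply: (@eigsum1 _ (a * c + b * d)).
by rewrite add_lfunE !scale_lfunE fw gw !scalerA scalerDl.
Qed.

Lemma semisimple_scale f a : semisimple f -> semisimple (a *: f).
Proof.
move=> ssf x; have /eigsum_group[s [v [_ -> fv]]] := ssf x.
apply: eigsum_sum => c _; apply: (@eigsum1 _ (a * c)).
by rewrite scale_lfunE fv scalerA.
Qed.

Lemma semisimpleD f g : semisimple f -> semisimple g ->
  commute_op f g -> semisimple (f + g).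
Proof.
by move=> *; rewrite -[f]scale1r -[g]scale1r; apply: semisimple_lincomb.
Qed.

Lemma semisimple0 : semisimple (0 : 'End(V)).
Proof. by move=> x; apply: (@eigsum1 _ 0); rewrite zero_lfunE scale0r. Qed.

Lemma iter_comm f g k x : commute_op f g -> iter k f (g x) = g (iter k f x).
Proof. by move=> fg; elim: k => //= k ->. Qed.

Lemma semisimple_unique f g k : semisimple f -> semisimple g ->
  commute_op f g -> (forall x, iter k (f - g) x = 0) -> f = g.
Proof.
move=> ssf ssg fg nil; apply/lfunP=> x.
have ss : semisimple (f - g).
  apply: semisimpleD => //; first by rewrite -scaleN1r; apply: semisimple_scale.
  by move=> y; rewrite !opp_lfunE linearN /= fg.
have := semisimple_nil ss (nil x).
by rewrite add_lfunE opp_lfunE => /eqP; rewrite subr_eq0 => /eqP.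
Qed.

(** The dimension formula encodes that [X'] is free and that its span meets [U] trivially. *)
Lemma extract_complement (X : seq V) (U : {vspace V}) : exists X' : seq V,
  [/\ {subset X' <= X}, (<<X'>> + U = <<X>> + U)%VS
    & \dim (<<X>> + U) = (size X' + \dim U)%N].
Proof.
elim: X => [|v X [X' [sX eX dX]]].
  by exists [::]; split=> //; rewrite span_nil add0v.
case: (boolP (v \in <<X>> + U)%VS) => vX.
  have e : (<<v :: X>> + U)%VS = (<<X>> + U)%VS.
    by rewrite span_cons -addvA; apply/addv_idPr; rewrite -memvE.
  exists X'; rewrite e; split=> // x xX'; by rewrite inE sX ?orbT.
exists (v :: X'); rewrite !span_cons -!addvA eX; split=> // [x|].
  by rewrite !inE => /orP[->//|/sX->]; rewrite orbT.
rewrite dimv_disjoint_sum.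
  rewrite dX dim_vline; have -> : v != 0 by apply: contraNneq vX => ->; rewrite mem0v.
  by rewrite addnA.
apply/eqP; rewrite -subv0; apply/subvP=> x; rewrite memv_cap memv0.
case/andP=> /vlineP[k ->]; case: (eqVneq k 0) => [->|k0]; first by rewrite scale0r.
move=> /(memvZ k^-1); rewrite scalerA mulVf // scale1r => vX'.
by rewrite vX' in vX.
Qed.

(** Together with [semisimple_basis], this identifies [semisimple] with the basis form of
    diagonalizability that occurs in [is_torus]. *)
Lemma eigen_basis f : semisimple f ->
  exists2 b : seq V, basis_of fullv b & forall v, v \in b -> exists a : K, f v = a *: v.
Proof.
move=> ssf.
have [X [sX fX]] : exists X : seq V, (fullv <= <<X>>)%VS /\
    forall v, v \in X -> exists a : K, f v = a *: v.
  have: exists X : seq V, (<<vbasis (fullv : {vspace V})>> <= <<X>>)%VS /\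
     forall v, v \in X -> exists a : K, f v = a *: v.
    elim: (tval (vbasis _)) => [|x s [X [sX fX]]].
      by exists [::]; rewrite span_nil subvv.
    have [Y [xY fY]] : exists Y : seq V, x \in <<Y>>%VS /\
        forall v, v \in Y -> exists a : K, f v = a *: v.
      elim: (ssf x) => [|c {}x y fx _ [Y [yY fY]]].
        by exists [::]; rewrite mem0v.
      exists (x :: Y); split.
        by rewrite span_cons memv_add // memv_line.
      by move=> v; rewrite inE => /orP[/eqP->|/fY//]; exists c.
    exists (Y ++ X); split.
      by rewrite span_cons span_cat addvS // -memvE.
    by move=> v; rewrite mem_cat => /orP[/fY|/fX].
  by rewrite (span_basis (vbasisP _)).
have [X' [sX' eX dX]] := extract_complement X 0%VS.
exists X'; last by move=> v /sX'/fX.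
move: eX dX; rewrite !addv0 dimv0 addn0 => eX dX.
by rewrite basisEdim eX sX -dX dimvS // subvf.
Qed.

Lemma semisimple_basis f (b : seq V) : basis_of fullv b ->
  (forall v, v \in b -> exists a : K, f v = a *: v) -> semisimple f.
Proof.
move=> bb fb x; have := memvf x; rewrite -(span_basis bb) => /(coord_span (X := in_tuple b)) ->.
apply: eigsum_sum => i _; apply: eigsum_scale.
have [|a fa] := fb (in_tuple b)`_i; first by rewrite mem_nth.
exact: eigsum1 fa.
Qed.

Lemma spectrum f : semisimple f ->
  exists s : seq K, forall c x, f x = c *: x -> x != 0 -> c \in s.
Proof.
move=> /eigen_basis[b bb fb].
have /choice[a fa] : forall v, exists a : K, v \in b -> f v = a *: v.
  move=> v; case: (boolP (v \in b)) => [/fb[a]|_]; last by exists 0.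
  by exists a.
exists (map a b) => c x fx x0; apply/negPn/negP => cb.
case/negP: x0; apply/eqP.
pose t := in_tuple b; have tE y : y = \sum_i coord t i y *: t`_i.
  exact: (coord_basis (X := t) bb (memvf y)).
have fT : free t by apply: basis_free bb.
have fxE : f x = \sum_(i < size b) (a t`_i * coord t i x) *: t`_i.
  rewrite {1}(tE x) linear_sum; apply: eq_bigr => i _.
  by rewrite linearZ /= fa ?scalerA 1?mulrC // mem_nth.
rewrite (tE x) big1 // => i _.
have := coord_sum_free (fun j => a t`_j * coord t j x) i fT.
rewrite -fxE fx linearZ /= => /eqP; rewrite -subr_eq0 -mulrBl mulf_eq0 subr_eq0.
case/orP=> /eqP; last by move->; rewrite scale0r.
by move=> ca; case/negP: cb; rewrite ca map_f // mem_nth.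
Qed.

End Semisimple.

(** * The Jordan decomposition *)

Section PolyOp.
Variables (K : fieldType) (V : vectType K) (f : 'End(V)).
Implicit Types (p q : {poly K}) (x y : V).

(** The operator p(f), evaluated pointwise through iterates, so that no ring structure on ['End(V)]
    is involved. *)
Definition poly_op p x := \sum_(i < size p) p`_i *: iter i f x.

Lemma poly_op_widen n p x : (size p <= n)%N ->
  poly_op p x = \sum_(i < n) p`_i *: iter i f x.
Proof.
move=> pn; rewrite /poly_op (big_ord_widen n (fun i => p`_i *: iter i f x)) //.
rewrite big_mkcond /=; apply: eq_bigr => i _; case: ltnP => // pi.
by rewrite nth_default // scale0r.
Qed.

Lemma poly_op_linear p : linear (poly_op p).
Proof.
move=> a x y; rewrite /poly_op scaler_sumr -big_split /=; apply: eq_bigr => i _.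
by rewrite linearP /= scalerDr !scalerA mulrC.
Qed.
HB.instance Definition _ p :=
  GRing.isLinear.Build K V V _ (poly_op p) (poly_op_linear p).

Lemma poly_opD p q x : poly_op (p + q) x = poly_op p x + poly_op q x.
Proof.
pose n := maxn (size p) (size q).
rewrite !(@poly_op_widen n) ?size_polyD ?leq_maxl ?leq_maxr //.
rewrite -big_split; apply: eq_bigr => i _; by rewrite coefD scalerDl.
Qed.

Lemma poly_opC c x : poly_op c%:P x = c *: x.
Proof. by rewrite (@poly_op_widen 1) ?size_polyC_leq1 // big_ord1 coefC. Qed.

Lemma poly_opMX p x : poly_op (p * 'X) x = f (poly_op p x).
Proof.
have s : (size (p * 'X)%R <= (size p).+1)%N.
  by rewrite (leq_trans (size_polyMleq _ _)) // size_polyX addn2.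
rewrite (poly_op_widen _ s) big_ord_recl coefMX scale0r add0r /poly_op linear_sum.
by apply: eq_bigr => i _; rewrite coefMX linearZ.
Qed.

Lemma poly_opZ c p x : poly_op (c *: p) x = c *: poly_op p x.
Proof.
rewrite (@poly_op_widen (size p)) ?size_scale_leq // /poly_op scaler_sumr.
by apply: eq_bigr => i _; rewrite coefZ scalerA.
Qed.

Lemma poly_opM p q x : poly_op (p * q) x = poly_op p (poly_op q x).
Proof.
elim/poly_ind: p => [|p c IH].
  by rewrite mul0r /poly_op size_poly0 !big_ord0.
rewrite mulrDl !poly_opD mul_polyC poly_opZ poly_opC.
by rewrite mulrAC !poly_opMX IH.
Qed.

Lemma poly_opX x : poly_op 'X x = f x.
Proof. by rewrite -['X]mul1r poly_opMX poly_opC scale1r. Qed.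

Lemma poly_op_comm (g : 'End(V)) p x : commute_op g f -> poly_op p (g x) = g (poly_op p x).
Proof.
move=> gf; rewrite /poly_op linear_sum; apply: eq_bigr => i _.
by rewrite linearZ iter_comm // => y; rewrite gf.
Qed.

Lemma poly_op_submod p (U : V -> Prop) x : submod U ->
  (forall y, U y -> U (f y)) -> U x -> U (poly_op p x).
Proof.
move=> sU Uf Ux; apply: submod_sum => // i _; apply: submodZ => //.
by elim: (i : nat) => //= k; apply: Uf.
Qed.

End PolyOp.

Definition shift (K : fieldType) (V : vectType K) (f : 'End(V)) (c : K) : 'End(V) :=
  f - c *: \1%VF.

Section Jordan.
Variables (K : closedFieldType) (V : vectType K).
Implicit Types (f g : 'End(V)) (p q : {poly K}).

Lemma shiftE f c x : shift f c x = f x - c *: x.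
Proof. by rewrite /shift add_lfunE opp_lfunE scale_lfunE id_lfunE. Qed.

Lemma poly_op_shift f c n x : poly_op f (('X - c%:P) ^+ n) x = iter n (shift f c) x.
Proof.
elim: n => [|n IH]; first by rewrite expr0 poly_opC scale1r.
by rewrite exprS poly_opM IH -polyCN poly_opD poly_opX poly_opC scaleNr -shiftE.
Qed.

(** The operators 1, f, ..., f^n with n = dim End(V) are one too many to be independent; a relation
    between them gives the coefficients. *)
Lemma annihilating_poly f : exists2 p, p != 0 & forall x, poly_op f p x = 0.
Proof.
pose n := \dim {: 'End(V)}.
pose X := [tuple (linfun (iter i f) : 'End(V)) | i < n.+1].
have nfX : ~~ free X.
  apply/negP => /eqP dX; have := dimvS (subvf <<X>>).
  by rewrite dX size_tuple ltnn.
have [k /not_implyP[sk /existsNP[i /eqP ki]]] :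
    exists k : 'I_n.+1 -> K, ~ (\sum_i k i *: X`_i = 0 -> forall i, k i = 0).
  by apply/existsNP => fX; case/negP: nfX; apply/freeP.
exists (\poly_(j < n.+1) k (inord j)).
  apply: contraNneq ki => /polyP/(_ i).
  by rewrite coef_poly coef0 ltn_ord inord_val => /eqP.
move=> x; rewrite (poly_op_widen _ _ (size_poly _ _)).
have /lfunP/(_ x) := sk; rewrite zero_lfunE sum_lfunE => {2}<-.
apply: eq_bigr => j _; rewrite coef_poly ltn_ord inord_val scale_lfunE.
by rewrite -tnth_nth tnth_mktuple lfunE.
Qed.

(** One exponent, the degree of an annihilating polynomial, serves for all roots at once, so
    multiplicities need not be tracked. *)
Lemma split_annihilator f : exists (s : seq K) n,
  uniq s /\ forall x, poly_op f (\prod_(c <- s) ('X - c%:P) ^+ n) x = 0.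
Proof.
have [p p0 fp] := annihilating_poly f.
have [r pE] := closed_field_poly_normal p.
exists (undup r), (size r); split=> [|x]; first exact: undup_uniq.
suff /dvdpP[q ->] : p %| \prod_(c <- undup r) ('X - c%:P) ^+ size r.
  by rewrite poly_opM fp linear0.
rewrite pE dvdpZl ?lead_coef_eq0 //.
suff: forall t, {subset t <= undup r} ->
    \prod_(z <- t) ('X - z%:P) %| \prod_(c <- undup r) ('X - c%:P) ^+ size t.
  by apply=> c; rewrite mem_undup.
elim=> [|c t IH] ct; first by rewrite big_nil dvd1p.
under [X in _ %| X]eq_bigr do rewrite /= exprS.
rewrite big_split big_cons dvdp_mul //; last first.
  by apply: IH => a at_; apply: ct; rewrite inE at_ orbT.
by rewrite (big_rem c) ?dvdp_mulIl // ct // inE eqxx.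
Qed.

Lemma bezout_coprime p q : coprimep p q -> exists u v, u * p + v * q = 1.
Proof.
case/Bezout_eq1_coprimepP=> -[u v] /= e; exists u, v; exact: e.
Qed.

Lemma coprimep_XsubC_exp (a b : K) m n : a != b ->
  coprimep (('X - a%:P) ^+ m) (('X - b%:P) ^+ n).
Proof.
move=> ab; apply/coprimep_expl/coprimep_expr.
by rewrite coprimep_XsubC root_XsubC eq_sym.
Qed.

Lemma coprimep_XsubC_prod (c : K) (s : seq K) n : c \notin s ->
  coprimep (('X - c%:P) ^+ n) (\prod_(a <- s) ('X - a%:P) ^+ n).
Proof.
elim: s => [|a s IH]; first by rewrite big_nil coprimep1.
rewrite inE negb_or big_cons => /andP[ca cs].
by rewrite coprimepMr coprimep_XsubC_exp ?IH.
Qed.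

(** Chinese remainder theorem for the moduli (X - c)^n and the constant residues c. *)
Lemma interpolation n (s : seq K) : uniq s ->
  exists q, forall c, c \in s -> ('X - c%:P) ^+ n %| q - c%:P.
Proof.
elim: s => [|c s IH] /=; first by exists 0.
case/andP=> cs /IH[q qP].
have [u [v uv]] := bezout_coprime (coprimep_XsubC_prod n cs).
set B := _ ^+ n in uv; set A := \prod_(_ <- _) _ in uv.
(* From u B + v A = 1, the factor v A is 1 modulo B and 0 modulo A: the correction changes the
   residue at [c] only. *)
exists (q + v * A * (c%:P - q)) => a; rewrite inE => /orP[/eqP->|as_].
  have -> : q + v * A * (c%:P - q) - c%:P = (q - c%:P) * u * B.
    have -> : v * A = 1 - u * B by rewrite -uv addrC addKr.
    by ring.
  by rewrite dvdp_mulIr.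
rewrite addrAC dvdp_add ?qP //.
apply/dvdp_mulr/dvdp_mull.
by rewrite /A (big_rem a) //= dvdp_mulIl.
Qed.

(** Primary decomposition as an induction principle. With u B + v A = 1, the vector u B x is killed
    by A, the product over the remaining roots, and v A x is killed by B. *)
Lemma generalized_eigen_decomposition f n (s : seq K) (P : V -> Prop) : uniq s ->
  P 0 -> (forall x y, P x -> P y -> P (x + y)) ->
  (forall c x, c \in s -> iter n (shift f c) x = 0 -> P x) ->
  forall x, poly_op f (\prod_(c <- s) ('X - c%:P) ^+ n) x = 0 -> P x.
Proof.
move=> + P0 PD; elim: s => [_ _|c s IH /= /andP[cs us] Pg] x.
  by rewrite big_nil poly_opC scale1r => ->.
rewrite big_cons.
have [u [v uv]] := bezout_coprime (coprimep_XsubC_prod n cs).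
set B := _ ^+ n in uv *; set A := \prod_(_ <- _) _ in uv * => BAx.
rewrite -[x]scale1r -(poly_opC f) -[1%:P]uv poly_opD; apply: PD.
  apply: IH => // [a y as_|]; first by apply: Pg; rewrite inE as_ orbT.
  by rewrite -poly_opM mulrCA [A * B]mulrC poly_opM BAx linear0.
apply: (Pg c); first by rewrite inE eqxx.
by rewrite -poly_op_shift -/B -poly_opM mulrCA poly_opM BAx linear0.
Qed.

Lemma shift_comm f g c : commute_op f g -> commute_op (shift f c) g.
Proof. by move=> fg x; rewrite !shiftE fg linearB; congr (_ - _); rewrite linearZ. Qed.

Lemma generalized_eigen_unique f a b m n x : a != b ->
  iter m (shift f a) x = 0 -> iter n (shift f b) x = 0 -> x = 0.
Proof.
move=> ab; rewrite -!poly_op_shift => xa xb.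
have [u [v uv]] := bezout_coprime (coprimep_XsubC_exp m n ab).
by rewrite -[x]scale1r -(poly_opC f) -[1%:P]uv poly_opD !poly_opM xa xb !linear0 addr0.
Qed.

(** [g] is a polynomial in [f] congruent to c modulo (X - c)^n at each root c; commutation and
    stability follow at once. The last clause, for arbitrary [c] and [n], is what later makes the
    semisimple part of a derivation a derivation. *)
Lemma jordan_decomposition f : exists g : 'End(V),
  [/\ semisimple g, exists n, forall x, iter n (f - g) x = 0,
      forall h, commute_op h f -> commute_op h g,
      forall U, submod U -> (forall x, U x -> U (f x)) -> forall x, U x -> U (g x)
    & forall x c n, iter n (shift f c) x = 0 -> g x = c *: x].
Proof.
have [s [n [us sP]]] := split_annihilator f.
have [q qP] := interpolation n us.
pose g : 'End(V) := linfun (poly_op f q).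
have gE x : g x = poly_op f q x by rewrite lfunE.
have gs c x : c \in s -> iter n (shift f c) x = 0 -> g x = c *: x.
  move=> /qP/dvdpP[w wP] xc; rewrite gE -[q](subrK c%:P) wP.
  by rewrite poly_opD poly_opM poly_op_shift xc linear0 add0r poly_opC.
have gcomm h : commute_op h f -> commute_op h g.
  by move=> hf x; rewrite !gE poly_op_comm.
have fg : commute_op f g by apply: gcomm.
have ssg : semisimple g.
  move=> x; apply: (generalized_eigen_decomposition us _ _ _ (sP x)) => [|y z|c y cs].
  - by constructor.
  - exact: eigsum_add.
  - by move/(gs _ _ cs); apply: eigsum1.
have nil x : iter n (f - g) x = 0.
  apply: (generalized_eigen_decomposition (P := fun y => iter n (f - g) y = 0)
    us _ _ _ (sP x)) => [|y z|c y cs yc].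
  - exact: linear0.
  - by rewrite linearD /= => -> ->; rewrite addr0.
  - suff -> k : iter k (f - g) y = iter k (shift f c) y by [].
    elim: k => // k IH; rewrite !iterS IH shiftE add_lfunE opp_lfunE.
    rewrite (gs c) // -iterD addnC iterD yc; exact: linear0.
exists g; split=> //; first by exists n.
  by move=> U sU Uf x Ux; rewrite gE; apply: poly_op_submod.
move=> x c m xc.
(* An eigenvector of [g] for [a] is a generalized eigenvector of [f] for [a], so inside the kernel
   of (f - c)^m only the component with a = c survives. *)
have [||t [v [_ xE vP]]] :=
  semisimple_stable (U := fun y => iter m (shift f c) y = 0) ssg _ _ xc.
- by split=> [|a y z y0 z0]; rewrite ?linear0 // linearP /= y0 z0 scaler0 addr0.
- by move=> y y0; rewrite (iter_comm _ _ (shift_comm _ fg)) y0 linear0.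
rewrite xE linear_sum scaler_sumr; apply: eq_bigr => a _.
have [v0 gv] := vP a; rewrite /= gv; case: (eqVneq a c) => [-> //|ac].
suff -> : v a = 0 by rewrite !scaler0.
apply: generalized_eigen_unique ac _ v0.
suff <- k : iter k (f - g) (v a) = iter k (shift f a) (v a) by apply: nil.
have gk i : g (iter i (f - g) (v a)) = a *: iter i (f - g) (v a).
  rewrite -iter_comm ?gv ?linearZ // => y.
  by rewrite !add_lfunE !opp_lfunE linearB /= fg.
by elim: k => // k IH; rewrite !iterS -IH shiftE add_lfunE opp_lfunE gk.
Qed.

End Jordan.

(** * Centralizers *)

Section Centralizers.
Variables (K : numFieldType) (V : vectType K).
Implicit Types (f g h : 'End(V)) (x y v : V).

Lemma fresh_scalar (s : seq K) : exists c, c \notin s.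
Proof.
exists (1 + \sum_(x <- s) `|x|); apply/negP => cs.
have le : `|1 + \sum_(x <- s) `|x| : K| <= \sum_(x <- s) `|x|.
  by rewrite [leRHS](big_rem _ cs) /= lerDl sumr_ge0.
have ge : 0 <= \sum_(x <- s) `|x| by apply: sumr_ge0.
by move: le; rewrite ger0_norm ?addr_ge0 // gerDr ler10.
Qed.

Lemma semisimple_joint_ind f g (P : V -> Prop) :
  semisimple f -> semisimple g -> commute_op f g ->
  P 0 -> (forall x y, P x -> P y -> P (x + y)) ->
  (forall a b v, f v = a *: v -> g v = b *: v -> P v) -> forall x, P x.
Proof.
move=> ssf ssg fg P0 PD Pv x; have /eigsum_group[s [v [_ -> fv]]] := ssf x.
elim/big_ind: _ => // c _.
have [||t [w [_ -> wP]]] :=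
  semisimple_stable (U := fun y => f y = c *: y) ssg _ _ (fv c).
- split=> [|d y z y0 z0]; first by rewrite linear0 scaler0.
  by rewrite linearP /= y0 z0 scalerDr !scalerA mulrC.
- by move=> y y0; rewrite fg y0 linearZ.
by elim/big_ind: _ => // d _; have [fw gw] := wP d; apply: Pv fw gw.
Qed.

(** If [c] is nonzero and avoids the finitely many quotients (a' - a) / (b - b'), distinct pairs of
    joint eigenvalues give distinct values a + c b. The eigenspaces of f + c g are then the joint
    eigenspaces of f and g. *)
Lemma centralizer_pencil f g : semisimple f -> semisimple g -> commute_op f g ->
  exists c, forall h, commute_op h (f + c *: g) -> commute_op h f /\ commute_op h g.
Proof.
move=> ssf ssg fg; have [sf sfP] := spectrum ssf; have [sg sgP] := spectrum ssg.
have [c] := fresh_scalar (0 :: [seq p.1 / p.2 | p <-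
   [seq (c1, c2) | c1 <- [seq a' - a | a <- sf, a' <- sf],
                  c2 <- [seq b - b' | b <- sg, b' <- sg]]]).
rewrite inE negb_or => /andP[c0 cP]; exists c => h hp.
suff H a b v : f v = a *: v -> g v = b *: v ->
    f (h v) = a *: h v /\ g (h v) = b *: h v.
  suff H' x : h (f x) = f (h x) /\ h (g x) = g (h x) by split=> x; case: (H' x).
  apply: (semisimple_joint_ind (P := fun x => h (f x) = f (h x) /\ h (g x) = g (h x))
    ssf ssg fg) => {x} [|x y [e1 e2] [e3 e4]|a b v fv gv].
  - by rewrite !linear0.
  - by rewrite !linearD /= e1 e2 e3 e4.
  - by have [-> ->] := H _ _ _ fv gv; rewrite fv gv !linearZ.
move=> fv gv; case: (eqVneq v 0) => [->|v0]; first by rewrite !linear0 ?scaler0.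
have pE y : (f + c *: g) y = f y + c *: g y by rewrite add_lfunE scale_lfunE.
have hv : f (h v) + c *: g (h v) = (a + c * b) *: h v.
  by rewrite -pE -hp pE fv gv scalerA -scalerDl linearZ.
have fhv : f (h v) = a *: h v.
  have [||t [w [_ -> wP]]] :=
    semisimple_stable (U := fun y => f y + c *: g y = (a + c * b) *: y) ssf _ _ hv.
  - split=> [|d y z y0 z0]; first by rewrite !linear0 ?scaler0 ?addr0.
    rewrite [f _]linearP [g _]linearP /=.
    transitivity (d *: (f y + c *: g y) + (f z + c *: g z)); first by lincomb.
    by rewrite y0 z0; lincomb.
  - by move=> y y0; rewrite -fg -linearZ -linearD y0 linearZ.
  rewrite linear_sum scaler_sumr; apply: eq_bigr => a' _.
  have [/= + fw] := wP a'; rewrite fw; case: (eqVneq (w a') 0) => [->|w0 pw].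
    by rewrite !scaler0.
  pose b' := (a + c * b - a') / c.
  have gw : g (w a') = b' *: w a'.
    apply: (scalerI c0); rewrite scalerA mulrC divfK // scalerBl -pw.
    by rewrite addrAC subrr add0r.
  case: (eqVneq b' b) => [bb|bb].
    have := divfK c0 (a + c * b - a'); rewrite -/b' bb => e.
    by congr (_ *: _); rewrite -[LHS](subKr (a + c * b)) -e; ring.
  have cE : c = (a' - a) / (b - b').
    have d0 : b - b' != 0 by rewrite subr_eq0 eq_sym.
    apply: (mulIf d0); rewrite divfK // mulrBr /b' [c * (_ / c)]mulrC divfK //; ring.
  case/negP: cP; rewrite cE; apply/mapP; exists (a' - a, b - b') => //.
  apply/allpairs_f/allpairs_f; try apply: allpairs_f.
  - exact: sfP fv v0.
  - exact: sfP fw w0.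
  - exact: sgP gv v0.
  - exact: sgP gw w0.
split=> //; apply: (scalerI c0); apply: (addrI (f (h v))).
by rewrite hv fhv scalerA scalerDl.
Qed.

(** The vectors of a basis of [T] are added one at a time, each with a coefficient provided by
    [centralizer_pencil]. *)
Lemma generic_element (T : {vspace 'End(V)}) :
  (forall f, f \in T -> semisimple f) ->
  (forall f g, f \in T -> g \in T -> commute_op f g) ->
  exists2 d, d \in T & forall f h, f \in T -> commute_op h d -> commute_op h f.
Proof.
move=> ssT comT.
have [d dT dP] : exists2 d, d \in T & forall f h, f \in tval (vbasis T) ->
    commute_op h d -> commute_op h f.
  have: forall f, f \in tval (vbasis T) -> f \in T by move=> f; apply: vbasis_mem.
  elim: (tval (vbasis T)) => [_|f X IH XT].
    by exists 0; rewrite ?mem0v.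
  have [|d dT dP] := IH; first by move=> g gX; apply: XT; rewrite inE gX orbT.
  have fT : f \in T by apply: XT; rewrite inE eqxx.
  have [c cP] := centralizer_pencil (ssT _ dT) (ssT _ fT) (comT _ _ dT fT).
  exists (d + c *: f); first by rewrite memvD ?memvZ.
  move=> g h; rewrite inE => /orP[/eqP->|gX] /cP[//].
  by move=> hd _; apply: dP.
exists d => // f h /coord_vbasis -> hd x.
rewrite !sum_lfunE linear_sum; apply: eq_bigr => i _.
by rewrite !scale_lfunE linearZ /= (dP _ h) // mem_nth ?size_tuple.
Qed.

(** * The adjoint action on endomorphisms *)

Definition ad_fun h g : 'End(V) := ((h \o g) - (g \o h))%VF.

Fact ad_fun_linear h : linear (ad_fun h).
Proof.
move=> a f g; apply/lfunP=> x.
rewrite !(add_lfunE, opp_lfunE, comp_lfunE, scale_lfunE) linearP /=; lincomb.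
Qed.
HB.instance Definition _ h :=
  GRing.isLinear.Build K 'End(V) 'End(V) _ (ad_fun h) (ad_fun_linear h).

Definition ad_op h : 'End('End(V)) := linfun (ad_fun h).

Lemma ad_opE h g x : ad_op h g x = h (g x) - g (h x).
Proof. by rewrite /ad_op lfunE /= /ad_fun add_lfunE opp_lfunE !comp_lfunE. Qed.

Lemma ad_op_eigen h g c : ad_op h g = c *: g <-> forall x, h (g x) = g (h x) + c *: g x.
Proof.
split=> [/lfunP e x|e]; last first.
  by apply/lfunP=> x; rewrite ad_opE scale_lfunE e addrAC subrr add0r.
by have := e x; rewrite ad_opE scale_lfunE => <-; rewrite addrC subrK.
Qed.

Lemma ad_op_commute h g : ad_op h g = 0 <-> commute_op h g.
Proof.
rewrite -[0](scale0r g) ad_op_eigen.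
by split=> e x; rewrite e scale0r addr0.
Qed.

Lemma coord_eigenbasis h (b : seq V) (i : 'I_(size b)) a x : basis_of fullv b ->
  (forall v, v \in b -> exists a : K, h v = a *: v) ->
  h b`_i = a *: b`_i -> coord (in_tuple b) i (h x) = a * coord (in_tuple b) i x.
Proof.
move=> bb hb ha; have fT : free (in_tuple b) by apply: basis_free bb.
rewrite {1}(coord_basis (X := in_tuple b) bb (memvf x)) !linear_sum (bigD1 i) //= big1.
  by rewrite !linearZ /= ha linearZ /= (coord_free i i fT) eqxx mulr1 mulrC addr0.
move=> j ji; have [|a' ha'] := hb (in_tuple b)`_j; first by rewrite mem_nth.
by rewrite !linearZ /= ha' linearZ /= (coord_free j i fT) (negPf ji) !mulr0.
Qed.

(** For an eigenbasis of [h], the rank-one operator sending x to its i-th coordinate times an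
    eigenvector of eigenvalue c is an eigenvector of ad h, of eigenvalue c - a with a the i-th
    eigenvalue. *)
Lemma ad_op_semisimple h : semisimple h -> semisimple (ad_op h).
Proof.
move=> ssh; have [b bb hb] := eigen_basis ssh; pose t := in_tuple b => g.
pose el i w : 'End(V) := linfun (fun x => coord t i x *: w).
have elE i w x : el i w x = coord t i x *: w.
  by apply: linear_lfunE => a y z; rewrite linearP scalerDl scalerA.
have -> : g = \sum_i el i (g t`_i).
  apply/lfunP=> x; rewrite sum_lfunE {1}(coord_basis (X := t) bb (memvf x)) linear_sum.
  by apply: eq_bigr => i _; rewrite elE linearZ.
apply: eigsum_sum => i _; have [|a ha] := hb t`_i; first by rewrite mem_nth.
have /eigsum_group[s [v [_ -> hv]]] := ssh (g t`_i).
have -> : el i (\sum_(c <- s) v c) = \sum_(c <- s) el i (v c).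
  by apply/lfunP=> x; rewrite sum_lfunE elE scaler_sumr; apply: eq_bigr => c _; rewrite elE.
apply: eigsum_sum => c _; apply: (@eigsum1 _ _ _ (c - a)).
apply/ad_op_eigen => x; rewrite !elE linearZ /= hv.
by rewrite (coord_eigenbasis x bb hb ha); lincomb.
Qed.

(** [g] raises eigenvalues of [h] by c. In characteristic 0 the values a, a + c, a + 2c, ... are
    distinct, so a nonzero iterate of order [size s] would produce more eigenvalues than [s]
    contains. *)
Lemma ad_eigen_nilpotent h g c : semisimple h -> c != 0 ->
  ad_op h g = c *: g -> exists n, forall x, iter n g x = 0.
Proof.
move=> ssh c0 /ad_op_eigen hg; have [s sP] := spectrum ssh.
exists (size s) => x; have /eigsum_group[t [v [_ -> hv]]] := ssh x.
rewrite linear_sum big1 // => a _ /=; apply/eqP/negPn/negP => nz.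
have hk k : h (iter k g (v a)) = (a + k%:R * c) *: iter k g (v a).
  elim: k => [|k IH]; first by rewrite mul0r addr0 hv.
  by rewrite iterS hg IH linearZ /= -scalerDl -natr1 mulrDl mul1r addrA.
pose l := [seq a + k%:R * c | k <- iota 0 (size s).+1].
have ul : uniq l.
  rewrite map_inj_uniq ?iota_uniq // => i j /addrI/(mulIf c0)/eqP.
  by rewrite eqr_nat => /eqP.
have /(uniq_leq_size ul) : {subset l <= s}.
  move=> _ /mapP[k + ->]; rewrite mem_iota add0n ltnS => /= ks.
  apply: sP (hk k) _; apply: contraNneq nz => k0.
  by rewrite -(subnK ks) iterD k0 linear0.
by rewrite size_map size_iota ltnn.
Qed.

End Centralizers.

(** * Engel's theorem for weakly closed sets *)

Section Engel.
Variables (K : fieldType) (V : vectType K).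
Implicit Types (f g h : 'End(V)) (H : 'End(V) -> Prop) (x y v : V).

(** The vectors killed by every product of n members of [H]. That some level is the whole space
    expresses that [H] acts nilpotently. *)
Fixpoint flag H n x : Prop :=
  if n is m.+1 then forall h, H h -> flag H m (h x) else x = 0.

Lemma flag_submod H n : submod (flag H n).
Proof.
elim: n => [|n [IH0 IH]] /=.
  by split=> // a x y -> ->; rewrite scaler0 addr0.
split=> [h Hh|a x y xf yf h Hh]; first by rewrite linear0.
by rewrite linearP; apply: IH; [apply: xf | apply: yf].
Qed.

Lemma flag_succ H n x : flag H n x -> flag H n.+1 x.
Proof.
elim: n x => [x /= -> h _|n IH x /= xf h Hh]; first by rewrite linear0.
by apply: IH; apply: xf.
Qed.

Lemma flag_mono H m n x : (m <= n)%N -> flag H m x -> flag H n x.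
Proof.
by move=> /subnKC <-; elim: (n - m)%N => [|k IH] mx; rewrite ?addn0 // addnS;
  apply/flag_succ/IH.
Qed.

Lemma flag_anti H H' n x : (forall h, H h -> H' h) -> flag H' n x -> flag H n x.
Proof. by move=> sH; elim: n x => //= n IH x xf h Hh; apply/IH/xf/sH. Qed.

Lemma flag_normal H (x : 'End(V)) n v : H 0 ->
  (forall h, H h -> H ((h \o x) - (x \o h))%VF) ->
  flag H n v -> flag H n (x v).
Proof.
move=> H0 Hx; elim: n v => [v /= ->|n IH v /= vf h Hh]; first by rewrite linear0.
have -> : h (x v) = x (h v) + ((h \o x) - (x \o h))%VF v.
  by rewrite add_lfunE opp_lfunE !comp_lfunE addrCA subrr addr0.
by apply: submodD; [exact: flag_submod|apply/IH/vf|apply/vf/Hx].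
Qed.

(** Inside one level of the flag of [H], the powers of [x] use up n further levels of the enlarged
    flag; members of [H] fall to the previous level, on which [x] acts as well because it normalizes
    [H]. *)
Lemma flag_extend (H : {vspace 'End(V)}) (x : 'End(V)) m n :
  (forall h, h \in H -> ((h \o x) - (x \o h))%VF \in H) ->
  (forall v, iter n x v = 0) -> (forall v, flag (fun h => h \in H) m v) ->
  exists M, forall v, flag (fun h => h \in (<[x]> + H)%VS) M v.
Proof.
move=> Hx nx fm; pose F := flag (fun h => h \in H).
pose F' := flag (fun h => h \in (<[x]> + H)%VS).
suff [M MP] : exists M, forall v, F m v -> F' M v by exists M => v; apply/MP/fm.
elim: m {fm} => [|m [M IH]]; first by exists 0%N.
exists (M + n)%N => v vF.
have xF k : F m.+1 (iter k x v).
  elim: k => //= k; apply: (flag_normal (n := m.+1)) => //; exact: mem0v.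
suff: forall k, (k <= n)%N -> F' (M + k)%N (iter (n - k) x v).
  by move/(_ n (leqnn n)); rewrite subnn.
elim=> [_|k IHk kn].
  by rewrite addn0 subn0 nx; case: (flag_submod (fun h => h \in (<[x]> + H)%VS) M).
rewrite addnS => h /memv_addP[_ /vlineP[c ->] [h' h'H ->]].
rewrite add_lfunE scale_lfunE; apply: submodD; first exact: flag_submod.
  apply: submodZ; first exact: flag_submod.
  by rewrite -iterS subnSK //; apply/IHk/ltnW.
apply: (@flag_mono _ M); first exact: leq_addr.
by apply: IH; apply: xF h'H.
Qed.

(* Jacobson's theorem on weakly closed sets of nilpotent operators, in the
   case of a set closed under commutators. *)
Lemma engel_jacobson (S : 'End(V) -> Prop) :
  (forall f g, S f -> S g -> S ((f \o g) - (g \o f))%VF) ->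
  (forall f, S f -> exists n, forall x, iter n f x = 0) ->
  exists H : {vspace 'End(V)}, (forall f, S f -> f \in H) /\
    exists m, forall x, flag (fun h => h \in H) m x.
Proof.
move=> Sbr Snil.
pose good (H : {vspace 'End(V)}) := (exists2 X : seq 'End(V), H = <<X>>%VS &
   forall h, h \in X -> S h) /\ exists m, forall x, flag (fun h => h \in H) m x.
have step (H : {vspace 'End(V)}) : good H -> (forall f, S f -> f \in H) \/
    exists H' : {vspace 'End(V)}, good H' /\ (\dim H < \dim H')%N.
  move=> [[X HE XS] [m fm]].
  have [?|/existsNP[x0 /not_implyP[Sx0 /negP x0H]]] :=
    pselect (forall f, S f -> f \in H); [by left|right].
  have [x [Sx xH xX]] : exists x : 'End(V), [/\ S x, x \notin H &
      forall h, h \in X -> ((h \o x) - (x \o h))%VF \in H].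
    apply: contrapT => /forallNP nox.
    (* [lev b x] says that x maps level a into level c whenever c >= a + m - b, written without
       truncated subtraction. Level m being everything, b = 0 is automatic. If no element normalizes
       [H], brackets with members of [X] never enter [H], and each raises b by one. At b = 2m level
       m is sent into level 0, so x = 0, which is in [H]. *)
    pose lev b (x : 'End(V)) := forall a c v,
      flag (fun h => h \in H) a v -> (a + m <= c + b)%N ->
      flag (fun h => h \in H) c (x v).
    have [x [_ /negP xH xl]] : exists x : 'End(V), [/\ S x, x \notin H & lev (m + m)%N x].
      elim: (m + m)%N => [|b [x [Sx xH xl]]].
        exists x0; split=> // a c v _ ac.
        by apply: (@flag_mono _ m); [lia | apply: fm].
      have [h /not_implyP[hX /negP hxH]] :
          exists h, ~ (h \in X -> ((h \o x) - (x \o h))%VF \in H).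
        by apply/existsNP => xX; apply: (nox x).
      exists ((h \o x) - (x \o h))%VF; split=> //.
        by apply: Sbr => //; apply: XS.
      have hH : h \in H by rewrite HE memv_span.
      move=> a c v va ac; rewrite add_lfunE opp_lfunE !comp_lfunE.
      apply: submodB; first exact: flag_submod.
        by apply: (xl a c.+1) => //; lia.
      case: a va ac => [/= ->|a va] ac.
        by rewrite !linear0; case: (flag_submod (fun h => h \in H) c).
      by apply: (xl a) => //; [apply: va | lia].
    apply: xH; suff -> : x = 0 by rewrite mem0v.
    apply/lfunP=> v; rewrite zero_lfunE.
    by apply: (xl m 0%N v); rewrite ?add0n //; apply: fm.
  have [n nx] := Snil x Sx.
  exists (<[x]> + H)%VS; split; last first.
    rewrite (ltn_leqif (dimv_leqif_sup (addvSr _ _))) subv_add subvv andbT -memvE.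
    exact: xH.
  split; first by exists (x :: X); rewrite ?span_cons ?HE // => h;
    rewrite inE => /orP[/eqP->|/XS].
  apply: (flag_extend _ nx fm) => h; rewrite HE => /(coord_span (X := in_tuple X)) ->.
  have -> : ((\sum_i coord (in_tuple X) i h *: (in_tuple X)`_i \o x) -
     (x \o \sum_i coord (in_tuple X) i h *: (in_tuple X)`_i))%VF =
     \sum_i coord (in_tuple X) i h *: (((in_tuple X)`_i \o x) - (x \o (in_tuple X)`_i))%VF.
    apply/lfunP => v; rewrite add_lfunE opp_lfunE !comp_lfunE !sum_lfunE linear_sum -sumrB.
    apply: eq_bigr => i _; rewrite !scale_lfunE add_lfunE opp_lfunE !comp_lfunE linearZ /=.
    by rewrite scalerBr.
  by apply: memv_suml => i _; apply: memvZ; rewrite -HE; apply: xX; apply: mem_nth.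
have good0 : good 0%VS.
  split; first by exists [::]; rewrite ?span_nil.
  by exists 1%N => x h; rewrite memv0 => /eqP->; rewrite zero_lfunE.
have: exists H : {vspace 'End(V)}, good H /\
    forall H' : {vspace 'End(V)}, good H' -> (\dim H' <= \dim H)%N.
  have ex : exists k, `[< exists2 H : {vspace 'End(V)}, good H & \dim H = k >].
    by exists 0%N; apply/asboolP; exists 0%VS => //; rewrite dimv0.
  have bd k : `[< exists2 H : {vspace 'End(V)}, good H & \dim H = k >] -> (k <= \dim {: 'End(V)})%N.
    by move/asboolP=> [H _ <-]; rewrite dimvS ?subvf.
  have [k /asboolP[H gH <-] kmax] := ex_maxnP ex bd.
  by exists H; split=> // H' gH'; apply: kmax; apply/asboolP; exists H'.
move=> [H [gH Hmax]]; exists H; case: (step H gH) => [SH|[H' [gH']]].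
  by split=> //; case: gH.
by rewrite ltnNge Hmax.
Qed.

End Engel.

(** * Exponentials of nilpotent derivations *)

(** The Cauchy product: antidiagonals leave the square only where [a] vanishes, and those with index
    below n + n exhaust it. *)
Lemma sum_square_triangle (V : nmodType) n (a : nat -> nat -> V) :
  (forall i j, (n <= i)%N || (n <= j)%N -> a i j = 0) ->
  \sum_(i < n) \sum_(j < n) a i j = \sum_(k < n + n) \sum_(i < k.+1) a i (k - i)%N.
Proof.
move=> a0.
have inner k : \sum_(i < k.+1) a i (k - i)%N = \sum_(i < n) \sum_(j < n | (i + j)%N == k) a i j.
  transitivity (\sum_(i < k.+1 + n) if (i <= k)%N then a i (k - i)%N else 0).
    by rewrite (big_ord_widen _ (fun i => a i (k - i)%N) (leq_addr n k.+1)) big_mkcond.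
  transitivity (\sum_(i < n) if (i <= k)%N then a i (k - i)%N else 0); last first.
    apply: eq_bigr => i _; case: ifP => ik; last first.
      by rewrite big_pred0 // => j; apply/eqP => e; rewrite -e leq_addr in ik.
    case: (ltnP (k - i)%N n) => [kin|?].
      rewrite (big_pred1 (Ordinal kin)) // => j.
      by rewrite -[RHS]/((j : nat) == k - i)%N -[RHS](eqn_add2l i) subnKC.
    rewrite a0 ?orbT 1?big1 //; first by move=> j /eqP e; have := ltn_ord j; lia.
    by apply/orP; right.
  rewrite [RHS](big_ord_widen _ (fun i => if (i <= k)%N then a i (k - i)%N else 0)
    (leq_addl k.+1 n)) [RHS]big_mkcond.
  apply: eq_bigr => i _; case: ltnP => // ni.
  by case: ifP => // _; rewrite a0 ?ni.
under [RHS]eq_bigr do rewrite inner.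
rewrite [RHS]exchange_big /=; apply: eq_bigr => i _.
rewrite [RHS](exchange_big_dep predT) //=; apply: eq_bigr => j _.
have ij : (i + j < n + n)%N by have := ltn_ord i; have := ltn_ord j; lia.
by rewrite (big_pred1 (Ordinal ij)) // => k; rewrite eq_sym.
Qed.

Section Exponential.
Variables (K : numFieldType) (V : vectType K).
Implicit Types (f g : 'End(V)) (x : V).

Definition divpow f k x := k`!%:R^-1 *: iter k f x.

Fact divpow_linear f k : linear (divpow f k).
Proof. by move=> a x y; rewrite /divpow linearP /=; lincomb. Qed.
HB.instance Definition _ f k :=
  GRing.isLinear.Build K V V _ (divpow f k) (divpow_linear f k).

Lemma divpowS f k x : f (divpow f k x) = k.+1%:R *: divpow f k.+1 x.
Proof.
rewrite /divpow linearZ scalerA /= factS natrM invfM mulrA mulfV ?mul1r //.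
by rewrite pnatr_eq0.
Qed.

Lemma divpow_comp f i j x : divpow f i (divpow f j x) = 'C(i + j, i)%:R *: divpow f (i + j) x.
Proof.
rewrite /divpow linearZ /= !scalerA iterD; congr (_ *: _).
have /(congr1 (fun k : nat => k%:R : K)) := bin_fact (leq_addr j i).
rewrite addnC addnK [(j + i)%N]addnC !natrM => <-.
have nz k : (k`!%:R : K) != 0 by rewrite pnatr_eq0 -lt0n fact_gt0.
by field; rewrite !nz /= ?andbT pnatr_eq0 -lt0n bin_gt0 leq_addr.
Qed.

(** A sum of n terms, hence the true exponential as soon as f^n = 0; the order is an argument so
    that no nilpotency proof is carried along. *)
Definition exp_op n f : 'End(V) := linfun (fun x => \sum_(k < n) divpow f k x).

Lemma exp_opE n f x : exp_op n f x = \sum_(k < n) divpow f k x.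
Proof.
apply: linear_lfunE x => a y z; rewrite scaler_sumr -big_split.
by apply: eq_bigr => k _; apply: linearP.
Qed.

Lemma divpow_vanish n f k x : (forall y, iter n f y = 0) -> (n <= k)%N -> divpow f k x = 0.
Proof. by move=> fn nk; rewrite /divpow -(subnKC nk) iterD fn scaler0. Qed.

Lemma exp_op_widen n m f x : (forall y, iter n f y = 0) -> (n <= m)%N ->
  exp_op m f x = exp_op n f x.
Proof.
move=> fn nm; rewrite !exp_opE [RHS](big_ord_widen _ (fun k => divpow f k x) nm).
rewrite [RHS]big_mkcond; apply: eq_bigr => k _; case: ltnP => // nk.
exact: divpow_vanish fn nk.
Qed.

Lemma iter_opp f k x : iter k (- f) x = (-1) ^+ k *: iter k f x.
Proof.
elim: k => [|k IH]; first by rewrite scale1r.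
by rewrite !iterS IH opp_lfunE linearZ /= exprS mulN1r scaleNr.
Qed.

(** Along the k-th antidiagonal the binomial coefficients add up to (1 - 1)^k, so only k = 0
    contributes. *)
Lemma exp_opK n f x : (forall y, iter n f y = 0) ->
  exp_op n (- f) (exp_op n f x) = x.
Proof.
case: n => [fn|n fn]; first by rewrite -[x]/(iter 0 f x) fn !linear0.
pose a i j := (-1) ^+ i *: divpow f i (divpow f j x).
have -> : exp_op n.+1 (- f) (exp_op n.+1 f x) = \sum_(i < n.+1) \sum_(j < n.+1) a i j.
  rewrite exp_opE; apply: eq_bigr => i _; rewrite exp_opE linear_sum.
  by apply: eq_bigr => j _; rewrite /= /a /divpow iter_opp scalerA mulrC -scalerA.
rewrite sum_square_triangle => [|i j]; last first.
  rewrite /a; case/orP=> [ni|nj]; first by rewrite (divpow_vanish _ fn ni) scaler0.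
  by rewrite (divpow_vanish _ fn nj) linear0 scaler0.
have E k : \sum_(i < k.+1) a i (k - i)%N = (1 - 1) ^+ k *: divpow f k x.
  rewrite exprDn scaler_suml; apply: eq_bigr => i _.
  by rewrite /a divpow_comp subnKC -1?ltnS // scalerA expr1n !mul1r mulr_natr.
have z0 : (0 < n.+1 + n.+1)%N by rewrite addSn.
rewrite (bigD1 (Ordinal z0)) //= big_ord1 /a /divpow fact0 invr1 !scale1r.
rewrite big1 ?addr0 // => k k0; rewrite E subrr expr0n.
by have /negPf-> : (k : nat) != 0%N by []; rewrite scale0r.
Qed.

End Exponential.

Lemma br_suml (K : fieldType) (N : lieSuper K) I (r : seq I) (F : I -> N) (z : N) :
  br (\sum_(i <- r) F i) z = \sum_(i <- r) br (F i) z.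
Proof. by elim/big_rec2: _ => [|i u v _ <-]; rewrite ?br0l ?brDl. Qed.

Lemma br_sumr (K : fieldType) (N : lieSuper K) I (r : seq I) (F : I -> N) (z : N) :
  br z (\sum_(i <- r) F i) = \sum_(i <- r) br z (F i).
Proof. by elim/big_rec2: _ => [|i u v _ <-]; rewrite ?br0r ?brDr. Qed.

(** Leibniz rule for divided powers: the k-th antidiagonal of the product is the k-th divided power
    applied to [br x y]. It follows by induction, on applying f and dividing by k + 1. *)
Lemma exp_op_morph (K : numFieldType) (N : lieSuper K) (f : 'End(N)) n (x y : N) :
  (forall x y, f (br x y) = br (f x) y + br x (f y)) ->
  (forall x, iter n f x = 0) ->
  exp_op n f (br x y) = br (exp_op n f x) (exp_op n f y).
Proof.
move=> fbr fn; pose a i j := br (divpow f i x) (divpow f j y).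
have -> : br (exp_op n f x) (exp_op n f y) = \sum_(i < n) \sum_(j < n) a i j.
  by rewrite !exp_opE br_suml; apply: eq_bigr => i _; rewrite br_sumr.
rewrite sum_square_triangle => [|i j]; last first.
  by rewrite /a; case/orP=> nk; rewrite (divpow_vanish _ fn nk) ?br0l ?br0r.
rewrite -(exp_op_widen _ fn (leq_addr n n)) exp_opE; apply: eq_bigr => k _.
elim: (k : nat) => {k} [|k IH].
  by rewrite big_ord1 /a /divpow fact0 invr1 !scale1r.
have k0 : (k.+1%:R : K) != 0 by rewrite pnatr_eq0.
apply: (scalerI k0); rewrite -divpowS IH linear_sum scaler_sumr.
transitivity (\sum_(i < k.+1) i.+1%:R *: a i.+1 (k - i)%N +
              \sum_(i < k.+1) (k - i).+1%:R *: a i (k - i).+1).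
  rewrite -big_split; apply: eq_bigr => i _ /=.
  by rewrite /a fbr !divpowS; congr (_ + _); [exact: brZl | exact: brZr].
transitivity (\sum_(i < k.+2) i%:R *: a i (k.+1 - i)%N +
              \sum_(i < k.+2) (k.+1 - i)%:R *: a i (k.+1 - i)%N).
  congr (_ + _); first rewrite [RHS]big_ord_recl scale0r add0r.
    by apply: eq_bigr => i _; rewrite lift0 subSS.
  rewrite [RHS]big_ord_recr /= subnn scale0r addr0; apply: eq_bigr => i _.
  by rewrite subSn // -ltnS.
rewrite -big_split; apply: eq_bigr => i _ /=.
by rewrite -scalerDl -natrD subnKC // -ltnS.
Qed.

(** * Derivations and automorphisms *)

(** A stable subspace is the sum of its image and its kernel under a semisimple operator. Applied to
    ad q, it splits a perturbation into a bracket with q and a part commuting with q. *)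
Lemma semisimple_solve_mod_ker (K : fieldType) (V : vectType K) (f : 'End(V))
    (U : V -> Prop) x :
  semisimple f -> submod U -> (forall y, U y -> U (f y)) -> U x ->
  exists2 u, U u & f (x - f u) = 0.
Proof.
move=> ssf sU Uf Ux; have [s [v [_ -> vP]]] := semisimple_stable ssf sU Uf Ux.
(* As 0^-1 = 0, the component of eigenvalue 0 is dropped here; it is exactly what remains in x - f
   u. *)
exists (\sum_(c <- s) c^-1 *: v c).
  by apply: submod_sum => // c _; apply: submodZ => //; case: (vP c).
rewrite linear_sum -sumrB linear_sum big1 // => c _ /=.
have [_ fv] := vP c; have -> : f (c^-1 *: v c) = (c^-1 * c) *: v c.
  by rewrite linearZ /= fv scalerA.
case: (eqVneq c 0) fv => [->|c0] fv; first by rewrite mulr0 scale0r subr0 fv scale0r.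
by rewrite mulVf // scale1r subrr linear0.
Qed.

Section Superalgebra.
Variables (K : fieldType) (N : lieSuper K).
Implicit Types (d e f : 'End(N)) (x y z : N).

Definition rbr y : 'End(N) := linfun (fun x => br x y).

Lemma rbrE y x : rbr y x = br x y.
Proof. exact: linear_lfunE (br_linear_l y) x. Qed.

Definition lbr x : 'End(N) := linfun (br x).

Lemma lbrE x y : lbr x y = br x y.
Proof. exact: linear_lfunE (br_linear_r x) y. Qed.

Lemma hpart_decomposition x : exists x0 x1,
  [/\ x0 \in even_part N, x1 \in odd_part N & x = x0 + x1].
Proof.
have := memvf x; rewrite -(hpart_add N) => /memv_addP[x0 x0P [x1 x1P ->]].
by exists x0, x1.
Qed.

Lemma hpart_ind (P : N -> Prop) :
  (forall x y, P x -> P y -> P (x + y)) ->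
  (forall i x, x \in hpart N i -> P x) -> forall x, P x.
Proof.
move=> PD Ph x; have [x0 [x1 [? ? ->]]] := hpart_decomposition x.
by apply: PD; [apply: (Ph false) | apply: (Ph true)].
Qed.

Lemma hpart_disjoint x : x \in even_part N -> x \in odd_part N -> x = 0.
Proof. by move=> x0 x1; apply/eqP; rewrite -memv0 -(hpart_cap N) memv_cap x0. Qed.

Definition derivation d := is_even_superderivation d.

Lemma derivation_hpart d i x : derivation d -> x \in hpart N i -> d x \in hpart N i.
Proof. by move=> [dh _] xi; apply: subvP (dh i) _ (memv_img _ xi). Qed.

Lemma derivationP d : (forall i x, x \in hpart N i -> d x \in hpart N i) ->
  (forall x y, d (br x y) = br (d x) y + br x (d y)) -> derivation d.
Proof. by move=> dh db; split=> // i; apply/subvP=> _ /memv_imgP[x xi ->]; apply: dh. Qed.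

Lemma derivation_submod : submod derivation.
Proof.
split=> [|a d e dd de]; apply: derivationP => [i x xi|x y].
- by rewrite zero_lfunE mem0v.
- by rewrite !zero_lfunE br0l br0r addr0.
- by rewrite add_lfunE scale_lfunE memvD ?memvZ ?derivation_hpart.
rewrite !add_lfunE !scale_lfunE; case: dd de => [_ ->] [_ ->].
by rewrite brDl brDr brZl brZr; lincomb.
Qed.

Lemma derivation_bracket d e : derivation d -> derivation e ->
  derivation ((d \o e) - (e \o d))%VF.
Proof.
move=> dd de; apply: derivationP => [i x xi|x y].
  by rewrite add_lfunE opp_lfunE !comp_lfunE memvB ?derivation_hpart.
rewrite !add_lfunE !opp_lfunE !comp_lfunE; case: dd de => [_ dd] [_ de].
by rewrite de dd !linearD /= !dd !de !(brDl, brDr, brNl, brNr); lincomb.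
Qed.

Lemma derivation_stable d (U W : {vspace N}) : derivation d ->
  (forall x, x \in U -> d x \in U) -> (forall x, x \in W -> d x \in W) ->
  forall x, x \in bracket_space U W -> d x \in bracket_space U W.
Proof.
move=> [_ db] dU dW x; have: (bracket_space U W <= d @^-1: bracket_space U W)%VS.
  apply/bracket_spaceP=> u w uU wW; rewrite -memv_preim db.
  by rewrite memvD // mem_bracket_space ?dU ?dW.
by move=> /subvP H /H; rewrite -memv_preim.
Qed.

(** The inverse is part of the data, so that conjugation is the plain product of [phi], d and
    [psi]. *)
Definition automorphism (phi psi : 'End(N)) :=
  [/\ cancel phi psi, cancel psi phi,
      forall x y, phi (br x y) = br (phi x) (phi y),
      forall i x, x \in hpart N i -> phi x \in hpart N i
    & forall i x, x \in hpart N i -> psi x \in hpart N i].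

Lemma automorphism_inv phi psi : automorphism phi psi -> automorphism psi phi.
Proof.
move=> [fK gK fbr fh gh]; split=> // x y.
by apply: (can_inj fK); rewrite fbr !gK.
Qed.

Lemma automorphism_id : automorphism \1%VF \1%VF.
Proof. by split=> [x|x|x y|i x|i x]; rewrite !id_lfunE. Qed.

Lemma automorphism_comp phi psi phi' psi' : automorphism phi psi ->
  automorphism phi' psi' -> automorphism (phi \o phi')%VF (psi' \o psi)%VF.
Proof.
move=> [fK gK fbr fh gh] [fK' gK' fbr' fh' gh'].
split=> [x|x|x y|i x xi|i x xi]; rewrite !comp_lfunE ?fK ?gK' //.
- by rewrite fbr' fbr.
- by apply/fh/fh'.
- by apply/gh'/gh.
Qed.

Definition conj_op (phi psi d : 'End(N)) : 'End(N) := (phi \o d \o psi)%VF.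

Lemma conj_opE phi psi d x : conj_op phi psi d x = phi (d (psi x)).
Proof. by rewrite !comp_lfunE. Qed.

Lemma conj_op_comp phi psi phi' psi' d :
  conj_op (phi \o phi')%VF (psi' \o psi)%VF d = conj_op phi psi (conj_op phi' psi' d).
Proof. by apply/lfunP=> x; rewrite !(conj_opE, comp_lfunE). Qed.

Lemma conj_opK phi psi d : automorphism phi psi -> conj_op psi phi (conj_op phi psi d) = d.
Proof. by move=> [fK _ _ _ _]; apply/lfunP=> x; rewrite !conj_opE !fK. Qed.

Lemma conj_op_linear phi psi : linear (conj_op phi psi).
Proof.
move=> a d e; apply/lfunP=> x.
by rewrite !(conj_opE, add_lfunE, scale_lfunE) linearP.
Qed.
HB.instance Definition _ phi psi :=
  GRing.isLinear.Build K 'End(N) 'End(N) _ (conj_op phi psi) (conj_op_linear phi psi).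

Lemma conj_op_derivation phi psi d : automorphism phi psi -> derivation d ->
  derivation (conj_op phi psi d).
Proof.
move=> au dd; have [fK gK fbr fh gh] := au.
have [_ _ gbr _ _] := automorphism_inv au.
apply: derivationP => [i x xi|x y]; rewrite !conj_opE.
  by apply/fh/derivation_hpart/gh.
by rewrite gbr; case: dd => _ ->; rewrite linearD /= !fbr !gK.
Qed.

Lemma conj_op_semisimple phi psi d : automorphism phi psi -> semisimple d ->
  semisimple (conj_op phi psi d).
Proof.
move=> [fK gK _ _ _] ssd x; have /eigsum_group[s [v [_ xE dv]]] := ssd (psi x).
rewrite -[x]gK xE linear_sum; apply: eigsum_sum => c _ /=.
by apply: (@eigsum1 _ _ _ c); rewrite conj_opE fK dv linearZ.
Qed.

Lemma conj_op_commute phi psi d e : automorphism phi psi -> commute_op d e ->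
  commute_op (conj_op phi psi d) (conj_op phi psi e).
Proof. by move=> [fK _ _ _ _] de x; rewrite !conj_opE !fK de. Qed.

End Superalgebra.

Section ClosedField.
Variables (K : numClosedFieldType) (N : lieSuper K).
Implicit Types (d e f : 'End(N)) (x y z : N).

(** Since d - (a + b) satisfies the Leibniz rule with d - a on the left factor and d - b on the
    right one, generalized eigenspaces multiply with their weights added. *)
Lemma shift_derivation_br d a b i j x y : derivation d ->
  iter i (shift d a) x = 0 -> iter j (shift d b) y = 0 ->
  iter (i + j) (shift d (a + b)) (br x y) = 0.
Proof.
move=> [_ dbr].
have E u v : shift d (a + b) (br u v) = br (shift d a u) v + br u (shift d b v).
  by rewrite !shiftE dbr !(brDl, brDr, brNl, brNr, brZl, brZr); lincomb.
have [n] := ubnP (i + j); elim: n => // n IH in i j x y *.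
case: i => [|i] ij xi yj; first by rewrite (xi : x = 0) br0l linear0.
case: j => [|j] in ij yj *; first by rewrite (yj : y = 0) br0r linear0.
rewrite addSn iterSr E linearD /=.
rewrite addnS; have -> : (i + j).+1 = (i + j.+1)%N by rewrite addnS.
rewrite IH ?add0r; [|lia|by rewrite -iterSr|by []].
rewrite -addSnnS IH //; [lia|by rewrite -iterSr].
Qed.

(** [g] acts by a on the generalized eigenspace of weight a, and weights add under the bracket; the
    Leibniz rule holds on such vectors and extends by bilinearity. *)
Lemma semisimple_part_derivation (d : 'End(N)) : derivation d ->
  exists g, [/\ derivation g, semisimple g, exists n, forall x, iter n (d - g) x = 0,
     forall h, commute_op h d -> commute_op h g
   & forall x c n, iter n (shift d c) x = 0 -> g x = c *: x].
Proof.
move=> dd; have [g [ssg [n nil] gcomm gstab geig]] := jordan_decomposition d.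
exists g; split=> //; last by exists n.
have gn a x : g x = a *: x -> iter n (shift d a) x = 0.
  move=> gx; suff <- : iter n (d - g) x = iter n (shift d a) x by apply: nil.
  have gk i : g (iter i (d - g) x) = a *: iter i (d - g) x.
    rewrite -iter_comm ?gx ?linearZ // => y.
    have dg : d (g y) = g (d y) by apply: gcomm.
    by rewrite !add_lfunE !opp_lfunE linearB /= dg.
  by elim: n {nil} => // k IH; rewrite !iterS -IH shiftE add_lfunE opp_lfunE gk.
apply: derivationP => [i|x y].
  apply: (gstab (fun x => x \in hpart N i)); first exact: submod_mem.
  by move=> z; apply: derivation_hpart.
have /eigsum_group[s [v [_ -> gv]]] := ssg x.
have /eigsum_group[t [w [_ -> gw]]] := ssg y.
rewrite !linear_sum !br_suml linear_sum -big_split; apply: eq_bigr => a _ /=.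
rewrite !br_sumr linear_sum -big_split; apply: eq_bigr => b _ /=.
rewrite gv gw brZl brZr -scalerDl; apply: geig.
exact: shift_derivation_br dd (gn _ _ (gv a)) (gn _ _ (gw b)).
Qed.

Lemma exp_automorphism d n : derivation d -> (forall x, iter n d x = 0) ->
  automorphism (exp_op n d) (exp_op n (- d)).
Proof.
move=> dd dn; have nn x : iter n (- d) x = 0 by rewrite iter_opp dn scaler0.
have dN : derivation (- d) by apply: submodN dd; exact: derivation_submod.
have hp e i x : derivation e -> x \in hpart N i -> exp_op n e x \in hpart N i.
  move=> de xi; rewrite exp_opE memv_suml // => k _; rewrite memvZ //.
  by elim: (k : nat) => //= j; apply: derivation_hpart.
split=> [x|x|x y|i x|i x]; try exact: hp.
- exact: exp_opK.
- by rewrite -{1}[d]opprK exp_opK.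
- by apply: exp_op_morph => //; case: dd.
Qed.

End ClosedField.

(** * Conjugacy into a maximal torus *)

Section FlagLevel.
Variables (K : fieldType) (V : vectType K) (H : 'End(V) -> Prop).
Implicit Types (u w : V -> V).

(** [u] descends i levels of the flag. Plain functions are allowed, so sums and composites need not
    be packed as linear maps. *)
Definition lowers i u := forall a v, flag H (a + i) v -> flag H a (u v).

Lemma lowersW i j u : (i <= j)%N -> lowers j u -> lowers i u.
Proof. by move=> ij uj a v va; apply: uj; apply: flag_mono va; rewrite leq_add2l. Qed.

Lemma lowers_comp i j u w : lowers i u -> lowers j w -> lowers (i + j) (u \o w).
Proof. by move=> ui wj a v va; apply: ui; apply: wj; rewrite -addnA. Qed.

Lemma lowersD i u w : lowers i u -> lowers i w -> lowers i (fun v => u v + w v).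
Proof. by move=> ui wi c v vc; apply: submodD (ui _ _ vc) (wi _ _ vc); apply: flag_submod. Qed.

Lemma lowersB i u w : lowers i u -> lowers i w -> lowers i (fun v => u v - w v).
Proof. by move=> ui wi c v vc; apply: submodB (ui _ _ vc) (wi _ _ vc); apply: flag_submod. Qed.

Lemma lowers_sum i n (u : nat -> V -> V) : (forall k, lowers i (u k)) ->
  lowers i (fun v => \sum_(k < n) u k v).
Proof. by move=> ui c v vc; apply: submod_sum => [|k _]; [exact: flag_submod|apply: ui]. Qed.

Lemma lowersZ i a u : lowers i u -> lowers i (fun v => a *: u v).
Proof. by move=> ui c v vc; apply: submodZ (ui _ _ vc); apply: flag_submod. Qed.

Lemma lowers_iter i k u : lowers i u -> lowers 0 (iter k u).
Proof.
move=> ui; elim: k => [|k IH] a v; rewrite addn0 //= => va.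
by apply: (lowersW (leq0n i) ui); rewrite addn0; apply: IH; rewrite addn0.
Qed.

Lemma lowers_mem (h : 'End(V)) : H h -> lowers 1 h.
Proof. by move=> Hh a v; rewrite addn1 => /(_ h Hh). Qed.

End FlagLevel.

Section Conjugacy.
Variables (K : numClosedFieldType) (N : lieSuper K) (r : nat).
Variables (x : 'I_r -> N) (p : 'I_r -> 'End(N)).
Let N0 := even_part N.
Let C := bracket_space N0 N0.

Hypothesis x_even : forall i, x i \in N0.
Hypothesis x_notin : forall i, x i \notin C.
Hypothesis p_der : forall i, derivation (p i).
Hypothesis p_ss : forall i, semisimple (p i).
Hypothesis p_comm : forall i j, commute_op (p i) (p j).
Hypothesis p_x : forall i j, p i (x j) = (i == j)%:R *: x j.
Hypothesis N0_gen : forall z, z \in N0 ->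
  exists a : 'I_r -> K, z - \sum_i a i *: x i \in C.
(** Maximality of the torus spanned by the [p i], as self-centralization among semisimple
    derivations; provided by [torus_maximal]. *)
Hypothesis p_max : forall d, derivation d -> semisimple d ->
  (forall i, commute_op (p i) d) -> exists a : 'I_r -> K, d = \sum_i a i *: p i.

Implicit Types (d e : 'End(N)) (z : N) (a : 'I_r -> K).

Lemma der_even d z : derivation d -> z \in N0 -> d z \in N0.
Proof. exact: derivation_hpart. Qed.

Lemma der_C d z : derivation d -> z \in C -> d z \in C.
Proof. by move=> dd; apply: derivation_stable => // u; apply: derivation_hpart. Qed.

Lemma p_gen i z a : z - \sum_j a j *: x j \in C -> p i z - a i *: x i \in C.
Proof.
move=> /(der_C (p_der i)); rewrite linearB linear_sum /=.
rewrite (bigD1 i) //= big1 => [|j ji]; last first.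
  by rewrite linearZ /= p_x eq_sym (negPf ji) scale0r scaler0.
by rewrite addr0 linearZ /= p_x eqxx scale1r.
Qed.

Lemma scale_x_mem i c : c *: x i \in C -> c = 0.
Proof.
move=> cx; apply/eqP/negPn/negP => c0; case/negP: (x_notin i).
by rewrite -[x i]scale1r -(mulVf c0) -scalerA memvZ.
Qed.

Lemma mem_C_congr z z' : z - z' \in C -> (z \in C) = (z' \in C).
Proof.
move=> zz'; apply/idP/idP => h.
  by rewrite -[z'](subKr z) memvB.
by rewrite -[z](subrK z') memvD.
Qed.

(** On N_0 / C the operator [p i] is the projection onto the line of [x i], so 1 is its only nonzero
    eigenvalue. *)
Lemma p_eigen i z c : z \in N0 -> p i z - c *: z \in C -> c != 0 ->
  exists2 b, z - b *: x i \in C & (c != 1 -> z \in C).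
Proof.
move=> /N0_gen[a za] zc c0; have pz := p_gen i za.
have z_x : z - (a i / c) *: x i \in C.
  have -> : z - (a i / c) *: x i = c^-1 *: ((p i z - a i *: x i) - (p i z - c *: z)).
    apply: (scalerI c0); rewrite !(scalerA, scalerBr) mulfV // !scale1r mulrCA mulfV // mulr1.
    by lincomb.
  by rewrite memvZ // memvB.
exists (a i / c) => // c1; rewrite (mem_C_congr z_x).
have := der_C (p_der i) z_x; rewrite linearB /= [p i (_ *: _)]linearZ /= p_x eqxx scale1r => pzx.
suff /scale_x_mem : (a i - a i / c) *: x i \in C.
  have -> : a i - a i / c = (a i / c) * (c - 1) by field.
  by move/eqP; rewrite mulf_eq0 subr_eq0 (negPf c1) orbF => /eqP->; rewrite scale0r mem0v.
have -> : (a i - a i / c) *: x i = (p i z - (a i / c) *: x i) - (p i z - a i *: x i) by lincomb.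
exact: memvB.
Qed.

(* The derivations inducing zero on [N0 / C]; they turn out to form a
   nilpotent Lie algebra of nilpotent operators. *)
Definition inner_part d := derivation d /\ forall z, z \in N0 -> d z \in C.

Lemma inner_part_submod : submod inner_part.
Proof.
split=> [|b d e [dd dC] [de eC]]; split.
- by case: (derivation_submod N).
- by move=> z _; rewrite zero_lfunE mem0v.
- by case: (derivation_submod N) => _; apply.
- by move=> z z0; rewrite add_lfunE scale_lfunE memvD ?memvZ ?dC ?eC.
Qed.

Lemma inner_part_bracket d e : derivation d -> inner_part e ->
  inner_part ((d \o e) - (e \o d))%VF.
Proof.
move=> dd [de eC]; split=> [|z z0]; first exact: derivation_bracket.
rewrite add_lfunE opp_lfunE !comp_lfunE.
by apply: memvB; [apply: der_C dd (eC _ z0) | apply: eC (der_even dd z0)].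
Qed.

Lemma inner_part_bracket_r d e : inner_part d -> derivation e ->
  inner_part ((d \o e) - (e \o d))%VF.
Proof.
move=> di de; have -> : ((d \o e) - (e \o d))%VF = - ((e \o d) - (d \o e))%VF by rewrite opprB.
exact: (submodN inner_part_submod (inner_part_bracket de di)).
Qed.

Lemma automorphism_C phi psi z : automorphism phi psi -> z \in C -> phi z \in C.
Proof.
move=> [_ _ fbr fh _]; have: (C <= phi @^-1: C)%VS.
  apply/bracket_spaceP=> u w u0 w0; rewrite -memv_preim fbr.
  by rewrite mem_bracket_space ?fh.
by move=> /subvP H /H; rewrite -memv_preim.
Qed.

(** Truncating at [n.+2] displays the terms of degree 0 and 1 for every [n]; this is why nilpotency
    bounds are raised by 2 below. *)
Lemma exp_opSS n d z :
  exp_op n.+2 d z = z + d z + \sum_(k < n) divpow d k.+2 z.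
Proof.
rewrite exp_opE !big_ord_recl addrA /divpow fact0 invr1 scale1r; congr (_ + _ + _).
by rewrite scale1r.
Qed.

Lemma exp_op_mod_C n d z : derivation d -> d (d z) \in C ->
  exp_op n.+2 d z - (z + d z) \in C.
Proof.
move=> dd ddz; rewrite exp_opSS addrC addKr memv_suml // => k _; rewrite memvZ //.
by elim: (k : nat) => //= i; apply: der_C.
Qed.

(** The conjugating map is the exponential of a derivation [e] of weight -1 under ad (p j). Modulo C
    such an [e] moves [x j] only, into the other generators, and has square zero on the generators.
    Hence exp e fixes the other [x i] modulo C, and the eigenvectors already obtained are kept. *)
Lemma diagonalize_step d (j : 'I_r) (J : pred 'I_r) : derivation d -> semisimple d ->
  (forall i, J i -> exists b, d (x i) - b *: x i \in C) ->
  exists phi psi, [/\ automorphism phi psi &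
    forall i, J i || (i == j) ->
      exists b, conj_op phi psi d (x i) - b *: x i \in C].
Proof.
move=> dd ssd dJ.
pose D e := derivation e /\ ad_op (p j) e = (-1) *: e.
pose U z := exists b e c, [/\ D e, c \in C & z = b *: x j + e (x j) + c].
have sD : submod D.
  split=> [|b e f [de Ee] [df Ef]]; split.
  - by case: (derivation_submod N).
  - by rewrite linear0 scaler0.
  - by case: (derivation_submod N) => _; apply.
  - by rewrite linearP /= Ee Ef scalerDr !scalerA mulrC.
have sU : submod U.
  split; first by exists 0, 0, 0; rewrite mem0v zero_lfunE scale0r !addr0; split=> //; case: sD.
  move=> b _ _ [b1 [e1 [c1 [D1 C1 ->]]]] [b2 [e2 [c2 [D2 C2 ->]]]].
  exists (b * b1 + b2), (b *: e1 + e2), (b *: c1 + c2); split.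
  - by case: sD => _; apply.
  - by rewrite memvD ?memvZ.
  - by rewrite add_lfunE scale_lfunE; lincomb.
have De z e : D e -> p j (e z) = e (p j z) - e z.
  by case=> _ /ad_op_eigen ->; rewrite scaleN1r.
have Dpx e : D e -> p j (e (x j)) = 0.
  by move=> eD; rewrite De // p_x eqxx scale1r subrr.
have Dxi e i : D e -> i != j -> e (x i) \in C.
  move=> eD ij; have [|||b _] := @p_eigen j (e (x i)) (-1).
  - by apply: der_even (x_even i); case: eD.
  - by rewrite De // p_x eq_sym (negPf ij) scale0r linear0 scaleN1r sub0r subrr mem0v.
  - by rewrite oppr_eq0 oner_eq0.
  by apply; rewrite -subr_eq0 -opprD oppr_eq0 -[1]/(1%:R) -natrD pnatr_eq0.
have DD e f : D e -> D f -> f (e (x j)) \in C.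
  move=> eD fD; have [|||b _] := @p_eigen j (f (e (x j))) (-1).
  - by apply: der_even; [case: fD | apply: der_even (x_even j); case: eD].
  - by rewrite De // Dpx // linear0 scaleN1r sub0r subrr mem0v.
  - by rewrite oppr_eq0 oner_eq0.
  by apply; rewrite -subr_eq0 -opprD oppr_eq0 -[1]/(1%:R) -natrD pnatr_eq0.
have xU : U (x j).
  exists 1, 0, 0; split; [by case: sD | exact: mem0v|].
  by rewrite zero_lfunE scale1r !addr0.
have UC c : c \in C -> U c.
  move=> cC; exists 0, 0, c; split=> //; first by case: sD.
  by rewrite zero_lfunE scale0r !add0r.
(* Decompose [e] by its weights under ad (p j). Weight -1 is in [D]; for another weight c, e (x j)
   has eigenvalue c + 1 != 0 under [p j], hence is a multiple of [x j] modulo C. *)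
have derU e : derivation e -> U (e (x j)).
  move=> de; have [|s [v [_ -> vP]]] :=
    semisimple_stable (ad_op_semisimple (p_ss j)) (derivation_submod N) _ de.
    by move=> f df; rewrite /ad_op lfunE; apply: derivation_bracket.
  rewrite sum_lfunE; apply: submod_sum => // c _; have [dv vc] := vP c.
  case: (eqVneq c (-1)) => [cE|c1].
    exists 0, (v c), 0; split; [by split=> //; rewrite vc cE | exact: mem0v |].
    by rewrite scale0r add0r addr0.
  have [|||b h _] := @p_eigen j (v c (x j)) (c + 1).
  - exact: der_even.
  - have /ad_op_eigen -> := vc; rewrite p_x eqxx scale1r scalerDl scale1r.
    by rewrite [_ *: _ + _]addrC subrr mem0v.
  - by rewrite addr_eq0.
  rewrite -[v c _](subrK (b *: x j)); apply: submodD => //; first exact: UC.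
  exact: submodZ.
have dU z : U z -> U (d z).
  case=> b [e [c [eD cC ->]]]; rewrite !linearD linearZ /=; have [de _] := eD.
  apply: (submodD sU); last exact: UC _ (der_C dd cC).
  apply: (submodD sU); first by apply: (submodZ _ sU); apply: derU.
  have -> : d (e (x j)) = ((d \o e) - (e \o d))%VF (x j) + e (d (x j)).
    by rewrite add_lfunE opp_lfunE !comp_lfunE subrK.
  apply: (submodD sU); first exact: derU _ (derivation_bracket dd de).
  have [b' [e' [c' [e'D c'C ->]]]] := derU d dd.
  rewrite !linearD linearZ /=; apply: (submodD sU); last exact: UC _ (der_C de c'C).
  apply: (submodD sU); last exact: UC _ (DD _ _ e'D eD).
  by apply: (submodZ _ sU); apply: derU.
have [s [v [_ xE vP]]] := semisimple_stable ssd sU dU xU.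
(* As [U] is stable under [d], the vector [x j] is a sum of eigenvectors of [d] in [U]. One of them
   has a nonzero [x j] coefficient, since otherwise [p j] would map [x j] into C. Once normalized,
   it is exp e (x j) modulo C. *)
have [lam [v0 [e [c [eD cC v0E dv]]]]] : exists lam v0 e c,
    [/\ D e, c \in C, v0 = x j + e (x j) + c & d v0 = lam *: v0].
  apply: contrapT => nov.
  have vC l : exists e c, [/\ D e, c \in C & v l = e (x j) + c].
    have [[b [e [c [eD cC vE]]]] dv] := vP l.
    case: (eqVneq b 0) vE => [->|b0] vE; first by exists e, c; rewrite vE scale0r add0r.
    case: nov; exists l, (b^-1 *: v l), (b^-1 *: e), (b^-1 *: c); split.
    - exact: submodZ.
    - exact: memvZ.
    - by rewrite vE !scalerDr scalerA mulVf // scale1r scale_lfunE.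
    - by rewrite linearZ /= dv !scalerA mulrC.
  have : p j (x j) \in C.
    rewrite xE linear_sum memv_suml // => l _; have [e [c [eD cC ->]]] := vC l.
    by rewrite linearD /= Dpx // add0r der_C.
  by rewrite p_x eqxx scale1r (negPf (x_notin j)).
have [de Ee] := eD.
have [n en] : exists n, forall z, iter n e z = 0.
  by apply: (ad_eigen_nilpotent (p_ss j) _ Ee); rewrite oppr_eq0 oner_eq0.
have nn z : iter n (- e) z = 0 by rewrite iter_opp en scaler0.
have en2 z : iter n.+2 e z = 0 by rewrite !iterS en !linear0.
pose phi := exp_op n.+2 (- e); pose psi := exp_op n.+2 e.
have au : automorphism phi psi.
  apply: automorphism_inv; rewrite /phi /psi; exact: exp_automorphism.
have dNe : derivation (- e) by apply: submodN de; apply: derivation_submod.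
have phiC c' : c' \in C -> phi c' \in C by apply: automorphism_C au.
have psiC c' : c' \in C -> psi c' \in C by apply: automorphism_C (automorphism_inv au).
exists phi, psi; split=> // i Jij.
case: (eqVneq i j) Jij => [-> _|ij]; last rewrite orbF => Ji.
  have phi_v0 : phi v0 - x j \in C.
    have h1 := @exp_op_mod_C n _ _ dNe; have eex := DD _ _ eD eD.
    have : phi (x j) - (x j + (- e) (x j)) \in C by apply: h1; rewrite !opp_lfunE linearN opprK.
    have : phi (e (x j)) - (e (x j) + (- e) (e (x j))) \in C.
      by apply: h1; rewrite !opp_lfunE linearN opprK der_C.
    rewrite !opp_lfunE => h2 h3.
    have -> : phi v0 - x j = (phi (x j) - (x j - e (x j))) +
        (phi (e (x j)) - (e (x j) - e (e (x j)))) + phi c - e (e (x j)).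
      by rewrite v0E !linearD /=; lincomb.
    by rewrite memvB // memvD ?phiC // memvD.
  exists lam; have [phiK psiK _ _ _] := au; rewrite conj_opE.
  have -> : psi (x j) = v0 - psi (phi v0 - x j) by rewrite linearB /= phiK subKr.
  set c' := phi v0 - x j in phi_v0 *; rewrite linearB /= dv linearB linearZ /=.
  have -> : phi v0 = x j + c' by rewrite addrC subrK.
  have -> : lam *: (x j + c') - phi (d (psi c')) - lam *: x j =
      lam *: c' - phi (d (psi c')) by lincomb.
  by rewrite memvB ?memvZ // phiC // der_C // psiC.
have [b db] := dJ i Ji; exists b.
have exC : e (x i) \in C by apply: Dxi.
have psix : psi (x i) - x i \in C.
  have -> : psi (x i) - x i = (psi (x i) - (x i + e (x i))) + e (x i) by lincomb.
  by rewrite memvD // exp_op_mod_C // der_C.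
have phix : phi (x i) - x i \in C.
  have -> : phi (x i) - x i = (phi (x i) - (x i + (- e) (x i))) - e (x i).
    by rewrite opp_lfunE; lincomb.
  by rewrite memvB // exp_op_mod_C // der_C // opp_lfunE memvN.
rewrite conj_opE.
have -> : phi (d (psi (x i))) - b *: x i =
    phi (d (psi (x i) - x i)) + phi (d (x i) - b *: x i) + b *: (phi (x i) - x i).
  by rewrite !linearB /= [phi (b *: _)]linearZ /=; lincomb.
by rewrite !memvD // ?memvZ // phiC // der_C.
Qed.

Lemma diagonalize d : derivation d -> semisimple d ->
  exists phi psi, automorphism phi psi /\
    forall i, exists b, conj_op phi psi d (x i) - b *: x i \in C.
Proof.
move=> dd ssd.
suff [phi [psi [au H]]] : exists phi psi, automorphism phi psi /\
    forall i, i \in enum 'I_r -> exists b, conj_op phi psi d (x i) - b *: x i \in C.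
  by exists phi, psi; split=> // i; apply: H; rewrite mem_enum.
elim: (enum 'I_r) => [|j s [phi [psi [au H]]]].
  by exists \1%VF, \1%VF; split=> //; apply: automorphism_id.
have [phi' [psi' [au' H']]] :=
  @diagonalize_step _ j (fun i => i \in s) (conj_op_derivation au dd)
    (conj_op_semisimple au ssd) H.
exists (phi' \o phi)%VF, (psi \o psi')%VF; split; first exact: automorphism_comp.
by move=> i; rewrite inE orbC conj_op_comp => /H'.
Qed.

Definition p_comb a : 'End(N) := \sum_i a i *: p i.

Lemma p_combE a z : p_comb a z = \sum_i a i *: p i z.
Proof. by rewrite sum_lfunE; apply: eq_bigr => i _; rewrite scale_lfunE. Qed.

Lemma p_comb_x a i : p_comb a (x i) = a i *: x i.
Proof.
rewrite p_combE (bigD1 i) //= big1 => [|j ji]; rewrite p_x.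
  by rewrite eqxx scale1r addr0.
by rewrite (negPf ji) scale0r scaler0.
Qed.

Lemma p_comb_derivation a : derivation (p_comb a).
Proof.
have sD := derivation_submod N.
by apply: (submod_sum _ sD) => i _; apply: (submodZ _ sD).
Qed.

Lemma commute_p_comb d a : (forall i, commute_op (p i) d) -> commute_op d (p_comb a).
Proof.
move=> pd z; rewrite !p_combE linear_sum; apply: eq_bigr => i _.
by rewrite linearZ /= pd.
Qed.

Lemma p_comb_commute a b : commute_op (p_comb a) (p_comb b).
Proof.
apply: commute_p_comb => i z; have: commute_op (p i) (p_comb a).
  by apply: commute_p_comb.
by move/(_ z).
Qed.

Lemma p_comb_semisimple a : semisimple (p_comb a).
Proof.
rewrite /p_comb; elim: (index_enum _) => [|i s IH]; first by rewrite big_nil; apply: semisimple0.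
rewrite big_cons; apply: semisimpleD => //; first exact: semisimple_scale.
move=> z; rewrite !scale_lfunE !sum_lfunE linear_sum scaler_sumr.
by apply: eq_bigr => j _; rewrite !scale_lfunE !linearZ /= p_comm scalerA mulrC -scalerA.
Qed.

Lemma p_span_comb f : f \in <<[tuple p i | i < r]>>%VS -> exists a, f = p_comb a.
Proof.
move=> /coord_span ->; exists (fun i => coord [tuple p i | i < r] i f).
by apply: eq_bigr => i _; rewrite -tnth_nth tnth_mktuple.
Qed.

Lemma inner_part_nilpotent : exists m, forall z, flag inner_part m z.
Proof.
(* With [h] generic, weight 0 under ad h already means commuting with every [p i]. *)
have [||h /p_span_comb[b hE] hgen] := @generic_element _ _ <<[tuple p i | i < r]>>%VS.
- by move=> f /p_span_comb[a ->]; apply: p_comb_semisimple.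
- by move=> f e /p_span_comb[a ->] /p_span_comb[a' ->]; apply: p_comb_commute.
have hcomm e i : commute_op e h -> commute_op e (p i).
  apply: hgen; apply/memv_span; apply/tnthP; exists i; by rewrite tnth_mktuple.
have hss : semisimple h by rewrite hE; apply: p_comb_semisimple.
have hder : derivation h by rewrite hE; apply: p_comb_derivation.
pose S d := inner_part d /\ exists c, ad_op h d = c *: d.
have [|d [di [c hd]]|H [SH [m fm]]] := @engel_jacobson _ _ S.
- move=> d e [di [c hd]] [ei [c' he]]; split; first by apply: inner_part_bracket => //; case: di.
  exists (c + c'); move/ad_op_eigen: hd => hd; move/ad_op_eigen: he => he.
  apply/ad_op_eigen => z; rewrite !add_lfunE !opp_lfunE !comp_lfunE linearB /=.
  by rewrite !(hd, he) !linearD /= [d (_ *: _)]linearZ [e (_ *: _)]linearZ /=; lincomb.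
(* A nonzero weight gives nilpotency by shifting eigenvalues. In weight 0 the semisimple part [g] of
   [d] commutes with all [p i], hence is a combination of them, and it remains to see that g = 0. *)
- case: (eqVneq c 0) hd => [->|c0] hd; last exact: ad_eigen_nilpotent hss c0 hd.
  have dh : commute_op d h.
    by move: hd; rewrite scale0r => /ad_op_commute hd z; rewrite hd.
  have [g [gder gss [n gn] gcomm _]] := semisimple_part_derivation di.1.
  have [|a gE] := p_max gder gss.
    by move=> i; apply: gcomm => z; rewrite hcomm.
  suff g0 : g = 0 by exists n => z; rewrite -[d]subr0 -g0.
  have dg z : z \in C -> (d - g) z \in C.
    by move=> zC; rewrite add_lfunE opp_lfunE memvB ?der_C //; case: di.
  rewrite gE big1 // => i _; suff -> : a i = 0 by rewrite scale0r.
  have gx : g (x i) = a i *: x i by rewrite gE p_comb_x.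
  (* Modulo C, [d] vanishes and d - g multiplies [x i] by - a i; as d - g is nilpotent, a i = 0. *)
  have it k : iter k (d - g) (x i) - (- a i) ^+ k *: x i \in C.
    elim: k => [|k IH]; first by rewrite scale1r subrr mem0v.
    have := dg _ IH; rewrite linearB linearZ /= => h1.
    have h2 : d (x i) \in C by apply: di.2.
    have -> : (d - g) (iter k (d - g) (x i)) - (- a i) ^+ k.+1 *: x i =
       ((d - g) (iter k (d - g) (x i)) - (- a i) ^+ k *: (d - g) (x i)) +
       (- a i) ^+ k *: d (x i).
      by rewrite [(d - g) (x i)]add_lfunE opp_lfunE gx exprS; lincomb.
    by rewrite memvD // memvZ.
  have := it n; rewrite gn sub0r memvN => /scale_x_mem/eqP.
  by rewrite expf_eq0 oppr_eq0 => /andP[_ /eqP].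
exists m => z; apply: flag_anti (fm z) => d di.
have [|s [v [_ -> vP]]] :=
  semisimple_stable (ad_op_semisimple hss) inner_part_submod _ di.
  by move=> e ei; rewrite /ad_op lfunE; apply: inner_part_bracket.
by apply: memv_suml => c _; apply: SH; have [? ?] := vP c; split=> //; exists c.
Qed.

Lemma inner_part_iter d m : inner_part d -> (forall z, flag inner_part m z) ->
  forall z, iter m d z = 0.
Proof.
move=> di fm z; move: (fm z) => {fm}; elim: m z => [|m IH] z //= fz.
by rewrite -iterS iterSr; apply: IH; apply: fz.
Qed.

Lemma exp_op_inner m d z : inner_part d -> z \in N0 -> exp_op m.+2 d z - z \in C.
Proof.
move=> [dd dC] z0; have -> : exp_op m.+2 d z - z = (exp_op m.+2 d z - (z + d z)) + d z by lincomb.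
by rewrite memvD ?dC // exp_op_mod_C // der_C // dC.
Qed.

(* Conjugating by [exp u] kills the part of [e] that does not commute with [q],
   up to terms that lower the flag by one more step. *)
Lemma conj_exp_step q e0 e i : derivation q -> semisimple q -> inner_part e0 ->
  inner_part e -> (0 < i)%N -> lowers inner_part i e ->
  exists phi psi w e', [/\ automorphism phi psi,
    commute_op q w, inner_part w, inner_part e' &
    lowers inner_part i.+1 e' /\ conj_op phi psi (q + e0 + e) = q + (e0 + w) + e'].
Proof.
move=> qd qss e0i ei i0 ie.
pose U d := inner_part d /\ lowers inner_part i d.
have qlow : lowers inner_part 0 q.
  move=> a v; rewrite addn0; apply: flag_normal; first by case: inner_part_submod.
  by move=> h hi; apply: inner_part_bracket_r.
have adlow d : lowers inner_part i d -> lowers inner_part i (ad_op q d).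
  move=> dl a v va; rewrite ad_opE.
  have h1 := lowers_comp qlow dl; have h2 := lowers_comp dl qlow.
  by rewrite add0n in h1; rewrite addn0 in h2; apply: (lowersB h1 h2).
have sU : submod U.
  split=> [|b d f [di dl] [fi fl]]; split.
  - by case: inner_part_submod.
  - by move=> a v _; rewrite zero_lfunE; case: (flag_submod inner_part a).
  - by case: inner_part_submod => _; apply.
  - by move=> a v va; rewrite add_lfunE scale_lfunE;
      case: (flag_submod inner_part a) => _; apply; [apply: dl | apply: fl].
(* Write e = [q, u] + w with [q, w] = 0 and [u] lowering the flag by i as [e] does. To first order
   exp u adds [u, q] = - [q, u], which leaves w. *)
have [|u [ui ul] uq] := semisimple_solve_mod_ker (ad_op_semisimple qss) sU _ (conj ei ie).
  move=> d [di dl]; split; last exact: adlow.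
  by rewrite /ad_op lfunE; apply: inner_part_bracket.
pose w := e - ad_op q u.
have [m fm] := inner_part_nilpotent.
have um := inner_part_iter ui fm.
have um2 z : iter m.+2 u z = 0 by rewrite !iterS um !linear0.
pose phi := exp_op m.+2 u; pose psi := exp_op m.+2 (- u).
have au : automorphism phi psi by apply: exp_automorphism => //; case: ui.
pose d1 := q + e0 + e.
have d1d : derivation d1.
  have sD := derivation_submod N.
  by apply: (submodD sD); [apply: (submodD sD) => //; case: e0i | case: ei].
have [d1E d1def] : (forall z, d1 z = q z + e0 z + e z) /\ q + e0 + e = d1.
  by split=> // z; rewrite !add_lfunE.
have wE z : w z = e z - ad_op q u z by rewrite add_lfunE opp_lfunE.
pose e' := conj_op phi psi d1 - (q + (e0 + w)).
have [e'E e'def] : (forall z, e' z = phi (d1 (psi z)) - (q z + (e0 z + w z))) /\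
    conj_op phi psi d1 = q + (e0 + w) + e'.
  by split=> [z|]; rewrite ?[e' z]add_lfunE ?opp_lfunE ?conj_opE ?add_lfunE // addrC subrK.
have wi : inner_part w.
  apply: (submodB inner_part_submod) => //.
  by rewrite /ad_op lfunE; apply: inner_part_bracket => //; case: ui.
have e'i : inner_part e'.
  split.
    have sD := derivation_submod N.
    apply: (submodB sD); first exact: conj_op_derivation.
    by apply: (submodD sD) => //; apply: (submodD sD); [case: e0i | case: wi].
  move=> z z0; have Nui : inner_part (- u) by apply: submodN ui; apply: inner_part_submod.
  have psiz := exp_op_inner m Nui z0; rewrite -/psi in psiz.
  have psi0 : psi z \in N0 by case: au => _ _ _ _; apply.
  have phiy := exp_op_inner m ui (der_even d1d psi0); rewrite -/phi in phiy.
  have -> : e' z = (phi (d1 (psi z)) - d1 (psi z)) + d1 (psi z - z) + (e z - w z).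
    by rewrite e'E [d1 (_ - _)]linearB /= [d1 z]d1E; lincomb.
  have [_ eC] := ei; have [_ wC] := wi.
  by rewrite memvD ?memvB ?eC ?wC // memvD // der_C.
exists phi, psi, w, e'; split=> //; first by apply/ad_op_commute.
rewrite d1def; split=> //.
pose A z := \sum_(k < m) divpow u k.+2 z.
have phiE z : phi z = z + u z + A z by rewrite /phi exp_opSS.
have ii : (i.+1 <= i + i)%N by lia.
have Al : lowers inner_part i.+1 A.
  apply: (@lowers_sum _ _ _ _ _ (fun k => divpow u k.+2)) => k; apply: lowersZ.
  apply: (lowersW ii); rewrite -[(i + i)%N]add0n.
  have := lowers_comp (lowers_iter k ul) (lowers_comp ul ul).
  by move=> H a v va; rewrite !iterSr; apply: H.
have e0l := lowers_mem e0i; have el := lowers_mem ei.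
have d1l : lowers inner_part 0 d1.
  move=> a v va; rewrite d1E.
  have va1 : flag inner_part (a + 1) v by apply: flag_mono va; rewrite addn0 leq_addr.
  apply: submodD; first exact: flag_submod.
    by apply: submodD; [exact: flag_submod | apply: qlow | apply: e0l].
  exact: el.
(* Expanding phi d1 - (q + e0 + w) phi with phi = 1 + u + A, the terms of first order [u, q] and
   [q, u] cancel. What remains is [u, e0 + e] + [A, d1] + [q, u] (u + A). Each summand lowers by i +
   1, since e0 + e lowers by 1, A by 2i, and i > 0. *)
pose G z := (u (e0 z + e z) - (e0 (u z) + e (u z))) + (A (d1 z) - d1 (A z)) +
  ad_op q u (u z + A z).
have Gl : lowers inner_part i.+1 G.
  have e01 := lowersD e0l el.
  apply: lowersD; [apply: lowersD; apply: lowersB|].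
  - by have := lowers_comp ul e01; rewrite addn1.
  - by have := lowers_comp e01 ul; rewrite add1n.
  - by have := lowers_comp Al d1l; rewrite addn0.
  - by have := lowers_comp d1l Al; rewrite add0n.
  - have h := lowersD ul (lowersW (leqnSn i) Al).
    by apply: (lowersW ii); apply: lowers_comp (adlow _ ul) h.
have GE z : e' (phi z) = G z.
  have [phiK _ _ _ _] := au; rewrite e'E phiK wE /G !phiE.
  rewrite !d1E !linearD /= !ad_opE !linearD /= ; lincomb.
have psil : lowers inner_part 0 psi.
  move=> a v va; rewrite /psi exp_opE; apply: submod_sum => [|k _]; first exact: flag_submod.
  apply: submodZ; first exact: flag_submod.
  rewrite iter_opp; apply: submodZ; first exact: flag_submod.
  exact: (lowers_iter k ul).
move=> a v va; have [_ psiK _ _ _] := au; rewrite -[v]psiK GE.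
by apply: Gl; apply: psil; rewrite addn0.
Qed.

(** Throughout, the conjugate of [d] is q + e0 + e' with e0 commuting with q, and e' descends one
    more level at each step until it is 0. Then q and the conjugate are commuting semisimple
    operators with nilpotent difference e0, hence equal. *)
Lemma conjugacy d : derivation d -> semisimple d ->
  exists phi psi a, automorphism phi psi /\ conj_op phi psi d = p_comb a.
Proof.
move=> dd ssd; have [phi0 [psi0 [au0 /choice[a aP]]]] := diagonalize dd ssd.
set d0 := conj_op phi0 psi0 d in aP.
pose q := p_comb a.
have d0d : derivation d0 by apply: conj_op_derivation.
have d0s : semisimple d0 by apply: conj_op_semisimple.
have qd : derivation q by apply: p_comb_derivation.
have qs : semisimple q by apply: p_comb_semisimple.
have ki : inner_part (d0 - q).
  have kd : derivation (d0 - q) by apply: submodB => //; apply: derivation_submod.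
  split=> // z /N0_gen[b zb].
  rewrite -[z](subrK (\sum_i b i *: x i)) linearD /=.
  apply: memvD; first exact: der_C kd zb.
  rewrite linear_sum; apply: memv_suml => i _; rewrite linearZ memvZ //=.
  rewrite add_lfunE opp_lfunE p_comb_x.
  exact: aP.
have [m fm] := inner_part_nilpotent.
suff [phi [psi [e0 [e' [au qe0 e0i e'i [e'l eq]]]]]] : exists phi psi e0 e',
    [/\ automorphism phi psi, commute_op q e0, inner_part e0, inner_part e' &
    lowers inner_part m.+1 e' /\ conj_op phi psi d = q + e0 + e'].
  exists phi, psi, a; split=> //.
  have e'0 : e' = 0.
    apply/lfunP=> z; rewrite zero_lfunE; apply: (e'l 0%N z).
    by apply: (@flag_mono _ _ _ m) (fm z); rewrite add0n.
  have eqd : conj_op phi psi d = q + e0 by rewrite eq e'0 addr0.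
  apply: (semisimple_unique (k := m)) => //; first exact: conj_op_semisimple.
    by move=> z; rewrite eqd !add_lfunE linearD /= qe0.
  by move=> z; rewrite eqd addrC addKr; apply: inner_part_iter.
elim: m {fm} => [|i [phi [psi [e0 [e' [au qe0 e0i e'i [e'l eq]]]]]]].
  exists phi0, psi0, 0, (d0 - q); split=> //.
  - by move=> z; rewrite !zero_lfunE linear0.
  - by case: inner_part_submod.
  - by split; [apply: lowers_mem | rewrite addr0 addrC subrK].
have [phi' [psi' [w [e1 [au' qw wi e1i [e1l eq1]]]]]] :=
  conj_exp_step qd qs e0i e'i (ltn0Sn i) e'l.
exists (phi' \o phi)%VF, (psi \o psi')%VF, (e0 + w), e1; split=> //.
- exact: automorphism_comp.
- by move=> z; rewrite !add_lfunE linearD /= qe0 qw.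
- by apply: submodD => //; apply: inner_part_submod.
- by split=> //; rewrite conj_op_comp eq eq1.
Qed.

End Conjugacy.

(** * Extensions by a torus *)

Section Series.
Variables (K : fieldType) (N : lieSuper K).
Implicit Types (U W E I J : {vspace N}) (d : 'End(N)).

Lemma bracket_spaceS U U' W W' : (U <= U')%VS -> (W <= W')%VS ->
  (bracket_space U W <= bracket_space U' W')%VS.
Proof.
move=> sU sW; apply/bracket_spaceP=> x y xU yW.
by rewrite mem_bracket_space ?(subvP sU) ?(subvP sW).
Qed.

Lemma lower_centralS I k : lower_central I k.+1 = bracket_space (lower_central I k) I.
Proof. by []. Qed.

Lemma lower_central_mono I J k : (I <= J)%VS -> (lower_central I k <= lower_central J k)%VS.
Proof. by move=> sIJ; elim: k => //= k IH; apply: bracket_spaceS. Qed.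

Lemma lower_central_decr k :
  (lower_central (fullv : {vspace N}) k.+1 <= lower_central fullv k)%VS.
Proof. by elim: k => [|k IH]; [exact: subvf | apply: bracket_spaceS]. Qed.

Lemma derivation_lower_central d k x : derivation d ->
  x \in lower_central fullv k -> d x \in lower_central fullv k.
Proof.
move=> dd; elim: k x => [|k IH] x xk; first exact: memvf.
by apply: derivation_stable xk => // y _; apply: memvf.
Qed.

Lemma br_even_r x u : u \in even_part N -> br x u = - br u x.
Proof.
move=> u0; elim/hpart_ind: x => [x y xu yu|i x xi]; first by rewrite brDl brDr xu yu opprD.
by rewrite (br_skew xi u0) andbF scale1r.
Qed.

(** By induction [d] maps [U] into [...[U, E], ..., E] with k factors E, a space inside the lower
    central series, because a vector killed by [d] may be subtracted before the Leibniz rule is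
    used. The last hypothesis isolates the terms [br u (d w)]: skew symmetry gives it when E = U,
    and it is trivial when [d] kills [E]. *)
Lemma derivation_vanish d U E : is_nilpotent N ->
  (forall x y, d (br x y) = br (d x) y + br x (d y)) ->
  (forall u, u \in U -> d u \in U) ->
  (forall u, u \in U -> exists2 g, d g = 0 & u - g \in bracket_space U E) ->
  (forall W, (forall u, u \in U -> d u \in W) ->
     forall u w, u \in U -> w \in E -> br u (d w) \in bracket_space W E) ->
  forall u, u \in U -> d u = 0.
Proof.
move=> [n n0] dbr dU gen dE u uU; pose M k := iter k (fun J => bracket_space J E) U.
have MN k : (M k <= lower_central fullv k)%VS.
  by elim: k => [|k IH]; [exact: subvf | apply: bracket_spaceS; rewrite ?subvf].
suff dM k : forall v, v \in U -> d v \in M k.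
  by have := subvP (MN n) _ (dM n u uU); rewrite n0 memv0 => /eqP.
elim: k => // k IH v vU; have [g dg vg] := gen v vU.
have -> : d v = d (v - g) by rewrite linearB /= dg subr0.
suff: (bracket_space U E <= d @^-1: M k.+1)%VS by move/subvP/(_ _ vg); rewrite -memv_preim.
apply/bracket_spaceP=> x y xU yE; rewrite -memv_preim dbr.
by rewrite memvD ?dE // mem_bracket_space ?IH.
Qed.

End Series.

Section Morphisms.
Variables (K : fieldType) (L M : lieSuper K) (f : 'Hom(L, M)).
Hypothesis fbr : forall x y, f (br x y) = br (f x) (f y).

Lemma bracket_space_img (U W : {vspace L}) :
  (f @: bracket_space U W)%VS = bracket_space (f @: U) (f @: W).
Proof.
apply/eqP; rewrite eqEsubv; apply/andP; split.
  apply/subvP=> _ /memv_imgP[x + ->].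
  suff: (bracket_space U W <= f @^-1: bracket_space (f @: U) (f @: W))%VS.
    by move/subvP=> H /H; rewrite -memv_preim.
  apply/bracket_spaceP=> u w uU wW; rewrite -memv_preim fbr.
  by rewrite mem_bracket_space ?memv_img.
apply/bracket_spaceP=> _ _ /memv_imgP[x xU ->] /memv_imgP[y yW ->].
by rewrite -fbr memv_img ?mem_bracket_space.
Qed.

Lemma lower_central_img (I : {vspace L}) k :
  (f @: lower_central I k)%VS = lower_central (f @: I)%VS k.
Proof. by elim: k => //= k IH; rewrite bracket_space_img IH. Qed.

Lemma nilpotent_img (I : {vspace L}) : nilpotent_space I -> nilpotent_space (f @: I)%VS.
Proof. by move=> [k k0]; exists k; rewrite -lower_central_img k0 limg0. Qed.

Lemma nilpotent_preim (I : {vspace L}) : injective f ->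
  nilpotent_space (f @: I)%VS -> nilpotent_space I.
Proof.
move=> /lker0P f0 [k]; rewrite -lower_central_img => /eqP.
by rewrite -(limg0 f) eq_limg_ker0 // => /eqP; exists k.
Qed.

End Morphisms.

Section SemidirectExtension.
Variables (K : fieldType) (N : lieSuper K) (T : {vspace 'End(N)}) (torT : is_torus T).
Let S := semidirect torT.

Definition semi_inl : 'Hom(N, S) := linfun (fun x : N => ((x, 0) : S)).

Lemma semi_inlE x : semi_inl x = (x, 0).
Proof.
by apply: linear_lfunE x => a y z; congr pair; rewrite /= scaler0 addr0.
Qed.

Lemma semi_inl_inj : injective semi_inl.
Proof. by move=> x y; rewrite !semi_inlE => -[]. Qed.

Lemma mem_semi_inl (u : S) : (u \in limg semi_inl) = (u.2 == 0).
Proof.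
apply/memv_imgP/eqP => [[x _ ->]|]; first by rewrite semi_inlE.
by case: u => x d /= ->; exists x; rewrite ?memvf // semi_inlE.
Qed.

Lemma semi_brE (u v : S) :
  br u v = (br u.1 v.1 + vsval v.2 u.1 - vsval u.2 v.1, 0) :> S.
Proof. by []. Qed.

Lemma semi_inl_morphism : is_morphism semi_inl.
Proof.
split=> [i|x y]; last first.
  by rewrite !semi_inlE semi_brE /= ?linear0 !zero_lfunE addr0 subr0.
apply/subvP=> _ /memv_imgP[x xi ->]; rewrite semi_inlE mem_semi_hpart /= xi eqxx.
by rewrite implybT.
Qed.

Lemma semi_bracket_sub : (bracket_space (fullv : {vspace S}) fullv <= limg semi_inl)%VS.
Proof. by apply/bracket_spaceP=> u v _ _; rewrite mem_semi_inl. Qed.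

Lemma semi_inl_ideal : is_ideal (limg semi_inl).
Proof.
split; last by apply: subv_trans semi_bracket_sub; apply: bracket_spaceS; rewrite subvf.
apply/eqP; rewrite eqEsubv subv_add !capvSl; apply/subvP=> _ /memv_imgP[x _ ->].
have [x0 [x1 [x0P x1P ->]]] := hpart_decomposition x.
have [sh _] := semi_inl_morphism.
rewrite linearD; apply: memv_add; rewrite memv_cap memv_img ?memvf //.
  exact: (subvP (sh false) _ (memv_img _ x0P)).
exact: (subvP (sh true) _ (memv_img _ x1P)).
Qed.

Lemma torus_semisimple d : d \in T -> semisimple d.
Proof. by move=> /(proj1 torT)[_ [b bb bd]]; apply: semisimple_basis bb bd. Qed.

(** If a nilpotent ideal contains the even element (x, d), then E = [-, x] + d is nilpotent on N.
    Modulo the next term of the lower central series E acts as d, so an eigenvector of d with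
    nonzero eigenvalue would lie in every term and vanish; hence d = 0. *)
Lemma semi_nilradical : is_nilpotent N -> is_nilradical (limg semi_inl).
Proof.
move=> nN; have [_ sbr] := semi_inl_morphism.
split; [exact: semi_inl_ideal | exact: (nilpotent_img sbr nN)|].
move=> J [Jgr Jid] [m Jm]; apply/subvP=> -[x' d]; rewrite -{1}Jgr mem_semi_inl /=.
(* Gradedness of [J] splits off the odd component, whose torus part is 0; the even component keeps
   the torus part in question. *)
case/memv_addP=> [[x d0]]; rewrite memv_cap mem_semi_hpart /= andbT => /andP[xdJ xe].
case=> [[x1 d1]]; rewrite memv_cap mem_semi_hpart /= => /andP[_ /andP[_ /eqP->]].
case=> _ ->; rewrite addr0 => {x' d x1 d1}; move: d0 xdJ => d xdJ.
pose E (z : N) := br z x + vsval d z.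
have EJ k z : ((iter k.+1 E z, 0) : S) \in lower_central J k.
  have brE y : br ((y, 0) : S) (x, d) = (E y, 0).
    by rewrite semi_brE /= ?linear0 zero_lfunE subr0.
  elim: k => [|k IH]; rewrite iterS -brE; last exact: mem_bracket_space.
  rewrite br_even_r ?mem_semi_hpart /= ?xe // memvN.
  by apply: (subvP Jid); rewrite mem_bracket_space ?memvf.
have E0 z : iter m.+1 E z = 0.
  by have := EJ m z; rewrite Jm memv0 => /eqP[].
have [dd _] := proj1 torT _ (subvsP d).
have dL k z : z \in lower_central fullv k -> vsval d z \in lower_central fullv k.
  exact: derivation_lower_central.
have lam0 c z : vsval d z = c *: z -> c *: z = 0.
  move=> dz; case: (eqVneq c 0) => [->|c0]; first by rewrite scale0r.
  have [n Nn] := nN; suff: z \in lower_central fullv n.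
    by rewrite Nn memv0 => /eqP->; rewrite scaler0.
  elim: n {Nn} => [|k zk]; first exact: memvf.
  have brk y : y \in lower_central fullv k -> br y x \in lower_central fullv k.+1.
    by move=> yk; rewrite mem_bracket_space ?memvf.
  have it j : iter j E z - c ^+ j *: z \in lower_central fullv k.+1.
    elim: j => [|j IH]; first by rewrite scale1r subrr mem0v.
    have itk : iter j E z \in lower_central fullv k.
      rewrite -(subrK (c ^+ j *: z) (iter j E z)).
      apply: memvD; last exact: memvZ.
      by move: IH; apply: subvP; apply: lower_central_decr.
    have -> : iter j.+1 E z - c ^+ j.+1 *: z =
        br (iter j E z) x + vsval d (iter j E z - c ^+ j *: z).
      rewrite iterS {1}/E linearB /= [vsval d (_ *: _)]linearZ /= dz exprSr -scalerA.
      by lincomb.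
    by rewrite memvD ?brk // dL.
  have := it m.+1; rewrite E0 sub0r memvN => /(memvZ (c ^+ m.+1)^-1).
  by rewrite scalerA mulVf ?expf_neq0 // scale1r.
apply/eqP/val_inj/lfunP => z; rewrite /= zero_lfunE.
have /eigsum_group[s [v [_ -> dv]]] := torus_semisimple (subvsP d) z.
by rewrite linear_sum big1 // => c _; rewrite /= dv (lam0 _ _ (dv c)).
Qed.

Lemma semi_solvable : is_nilpotent N -> is_solvable S.
Proof.
move=> nN; have [_ sbr] := semi_inl_morphism.
have [n Nn] := nilpotent_img sbr nN; exists n.+1; apply/eqP; rewrite -subv0 -Nn.
elim: n {Nn} => [|n IH]; first exact: semi_bracket_sub.
rewrite [derived_series _ _.+1]/=; apply: bracket_spaceS => //.
by apply: subv_trans semi_bracket_sub; apply: bracket_spaceS; rewrite subvf.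
Qed.

Lemma semi_solvable_extension : is_nilpotent N -> is_solvable_extension semi_inl.
Proof.
move=> nN; split; first exact: semi_solvable.
split; [exact: semi_inl_morphism | exact: semi_inl_inj | exact: semi_nilradical].
Qed.

Lemma semi_codim : extension_codim semi_inl = \dim T.
Proof.
rewrite /extension_codim limg_dim_eq.
  by rewrite !dimvf (_ : dim S = (dim N + \dim T)%N) ?addKn.
by have /lker0P/eqP-> := semi_inl_inj; rewrite capv0.
Qed.

(** The hypothesis places N_0 inside [S_0, S_0], because d x = [x, d]. Odd elements of S have no
    torus part, so their brackets lie in N_0. *)
Lemma semi_admissible : (forall z, z \in even_part N -> exists2 c,
    c \in bracket_space (even_part N) (even_part N) &
    exists (I : finType) (x : I -> N) (d : I -> subvs_of T),
    (forall i, x i \in even_part N) /\ z = c + \sum_i vsval (d i) (x i)) ->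
  is_admissible semi_inl.
Proof.
move=> gen; split; first exact: semi_bracket_sub.
have [_ sbr] := semi_inl_morphism.
apply/bracket_spaceP=> -[x d] [y e]; rewrite !mem_semi_hpart.
move=> /andP[x1 d0] /andP[y1 e0].
have -> : d = 0 by apply/eqP.
have -> : e = 0 by apply/eqP.
rewrite (_ : br _ _ = semi_inl (br x y)); last by rewrite sbr !semi_inlE.
have /gen[c cC [I [u [f [u0 ->]]]]] : br x y \in even_part N by apply: br_hpart x1 y1.
rewrite linearD linear_sum /=; apply: memvD.
  have: semi_inl c \in (semi_inl @: bracket_space (even_part N) (even_part N))%VS.
    by rewrite memv_img.
  rewrite (bracket_space_img sbr); apply: (subvP _); have [sh _] := semi_inl_morphism.
  exact: bracket_spaceS (sh false) (sh false).
apply: memv_suml => i _.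
have -> : semi_inl (vsval (f i) (u i)) = br ((u i, 0) : S) (0, f i).
  by rewrite semi_inlE semi_brE /= br0r !(linear0, zero_lfunE, add0r, subr0, addr0).
by apply: (@mem_bracket_space K S (even_part S) (even_part S) (u i, 0) (0, f i));
  rewrite mem_semi_hpart /= ?u0 ?mem0v.
Qed.

End SemidirectExtension.

(** * Odd elements lie in the nilradical *)

Section OddPart.
Variables (K : numFieldType) (R : lieSuper K).
Implicit Types (U W I J : {vspace R}) (x y z : R).

Definition graded_elements W := forall z, z \in W -> exists z0 z1,
  [/\ z0 \in W, z0 \in even_part R, z1 \in W & z1 \in odd_part R] /\ z = z0 + z1.

Lemma gradedP W : graded W -> graded_elements W.
Proof.
move=> gW z; rewrite -{1}gW => /memv_addP[z0 + [z1 + ->]].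
by rewrite !memv_cap => /andP[? ?] /andP[? ?]; exists z0, z1.
Qed.

Lemma graded_elementsP W : graded_elements W -> graded W.
Proof.
move=> gW; apply/eqP; rewrite eqEsubv subv_add !capvSl; apply/subvP=> z.
by move=> /gW[z0 [z1 [[? ? ? ?] ->]]]; rewrite memv_add // memv_cap; apply/andP.
Qed.

Lemma graded_bracket U W : graded U -> graded W -> graded (bracket_space U W).
Proof.
move=> /gradedP gU /gradedP gW; apply/eqP; rewrite eqEsubv subv_add !capvSl /=.
apply/bracket_spaceP=> _ _ /gU[u0 [u1 [[? ? ? ?] ->]]] /gW[w0 [w1 [[? ? ? ?] ->]]].
rewrite brDl !brDr addrACA [X in _ + X]addrC.
have h i j u w : u \in U -> w \in W -> u \in hpart R i -> w \in hpart R j ->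
    br u w \in (bracket_space U W :&: hpart R (i (+) j))%VS.
  by move=> ? ? ui wj; rewrite memv_cap mem_bracket_space //; apply: br_hpart.
have -> : br u0 w0 + br u1 w0 + (br u1 w1 + br u0 w1) =
   (br u0 w0 + br u1 w1) + (br u1 w0 + br u0 w1) by lincomb.
by apply: memv_add; apply: memvD; [apply: (h false false)|apply: (h true true)|
  apply: (h true false)|apply: (h false true)].
Qed.

Lemma br_swap W W' y j : graded W -> y \in hpart R j ->
  (forall z, z \in W -> br y z \in W') -> forall z, z \in W -> br z y \in W'.
Proof.
move=> /gradedP gW yj yW z /gW[z0 [z1 [[? z0e ? z1o] ->]]]; rewrite brDl.
rewrite (br_skew z0e yj) (br_skew z1o yj).
by rewrite memvD // memvN memvZ // yW.
Qed.

Lemma br_swap_r W W' y j : graded W -> y \in hpart R j ->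
  (forall z, z \in W -> br z y \in W') -> forall z, z \in W -> br y z \in W'.
Proof.
move=> /gradedP gW yj yW z /gW[z0 [z1 [[? z0e ? z1o] ->]]]; rewrite brDr.
rewrite (br_skew yj z0e) (br_skew yj z1o).
by rewrite memvD // memvN memvZ // yW.
Qed.

Section Ideal.
Variable I : {vspace R}.
Hypothesis I_ideal : is_ideal I.
Let L k := lower_central I k.

Lemma graded_lower_central k : graded (L k).
Proof. by case: I_ideal => gI _; elim: k => //= k IH; apply: graded_bracket. Qed.

Lemma ideal_br x y : x \in I -> br x y \in I.
Proof. by case: I_ideal => _ /subvP H xI; rewrite H // mem_bracket_space ?memvf. Qed.

Lemma ideal_br_r x y : x \in I -> br y x \in I.
Proof.
have [gI _] := I_ideal; elim/hpart_ind: y => [y z yI zI xI|j y yj].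
  by rewrite brDl memvD ?yI ?zI.
by move: x; apply: (br_swap_r gI yj) => z zI; apply: ideal_br.
Qed.

Lemma lower_central_ideal k j y z : y \in hpart R j -> z \in L k -> br y z \in L k.
Proof.
move=> yj; elim: k z => [|k IH] z; first exact: ideal_br_r.
suff: (L k.+1 <= lbr y @^-1: L k.+1)%VS by move/subvP => H /H; rewrite -memv_preim lbrE.
apply/bracket_spaceP=> u w uL wI; rewrite -memv_preim lbrE.
have [gI _] := I_ideal.
have [u0 [u1 [[u0L u0e u1L u1o] ->]]] := gradedP (graded_lower_central k) uL.
have [w0 [w1 [[w0I w0e w1I w1o] ->]]] := gradedP gI wI.
have h i i' v t : v \in L k -> t \in I -> v \in hpart R i -> t \in hpart R i' ->
    br y (br v t) \in L k.+1.
  move=> vL tI vi ti'; rewrite (br_jacobi yj vi ti').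
  apply: memvD; last apply: memvZ; apply: mem_bracket_space => //; first exact: IH.
  exact: ideal_br_r.
rewrite !brDl !brDr !memvD //; first [by apply: (h false false)
  | by apply: (h true false) | by apply: (h false true) | by apply: (h true true)].
Qed.

Lemma lower_central_ideal_decr k : (L k.+1 <= L k)%VS.
Proof.
elim: k => [|k IH]; last exact: bracket_spaceS.
by apply/bracket_spaceP=> x y xI _; apply: ideal_br.
Qed.

End Ideal.

(** In the Jacobi identity for x, x, z the term [x, [x, z]] comes back with sign -1. *)
Lemma br_odd_sq x z : x \in odd_part R -> 2%:R *: br x (br x z) = br (br x x) z.
Proof.
move=> xo; elim/hpart_ind: z => [z t zP tP|k z zk]; first by rewrite !brDr scalerDr zP tP.
by rewrite scaler_nat mulr2n {1}(br_jacobi xo xo zk) expr1 scaleN1r addrNK.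
Qed.

Lemma odd_in_nilradical I : is_nilradical I ->
  (bracket_space (fullv : {vspace R}) fullv <= I)%VS -> (odd_part R <= I)%VS.
Proof.
move=> [Iid [n In] Imax] RI; apply/subvP=> x xo; have [gI _] := Iid.
pose J := (I + <[x]>)%VS; suff: (J <= I)%VS.
  by move/subvP; apply; rewrite -[x]add0r memv_add ?mem0v ?memv_line.
pose L k := lower_central I k.
have JP y : y \in J -> exists i c, i \in I /\ y = i + c *: x.
  by move=> /memv_addP[i iI [_ /vlineP[c ->] ->]]; exists i, c.
apply: Imax.
  split; last first.
    apply: subv_trans (addvSl _ _); apply: subv_trans RI.
    by apply: bracket_spaceS; rewrite subvf.
  apply: graded_elementsP => y /JP[i [c [iI ->]]].
  have [i0 [i1 [[? ? ? ?] ->]]] := gradedP gI iI.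
  exists i0, (i1 + c *: x); split; last by rewrite addrA.
  by split=> //; rewrite ?memv_add ?memvZ ?memv_line // ?memvD ?memvZ // (subvP (addvSl _ _)).
have Lx k z : z \in L k -> br z x \in L k.
  move: z; apply: (br_swap (graded_lower_central Iid k) xo) => z.
  exact: lower_central_ideal xo.
have sq_l k z : z \in L k -> br x (br x z) \in L k.+1.
  move=> zL; have two : (2%:R : K) != 0 by rewrite pnatr_eq0.
  rewrite -[br x (br x z)]scale1r -(mulVf two) -scalerA memvZ // br_odd_sq //.
  have xxe : br x x \in even_part R := br_hpart xo xo.
  rewrite -[br _ _]opprK -br_even_r // memvN mem_bracket_space //.
  by rewrite (subvP RI) // mem_bracket_space ?memvf.
have sq_r k z : z \in L k -> br (br z x) x \in L k.+1.
  move=> /(gradedP (graded_lower_central Iid k))[z0 [z1 [[z0L z0e z1L z1o] ->]]].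
  rewrite !brDl (br_skew z0e xo) (br_skew z1o xo) !brNl !brZl.
  rewrite (br_skew (br_hpart xo z0e) xo) (br_skew (br_hpart xo z1o) xo).
  by rewrite memvD // !(memvN, memvZ) // sq_l.
(* [Q k] is an intermediate step between [L k] and [L k.+1]: two brackets with [J] descend one term
   of the lower central series of [I], since bracketing twice with [x] amounts to bracketing with
   [x, x] in [I]. *)
pose Q k := (L k.+1 + rbr x @: L k)%VS.
have LJ k : (bracket_space (L k) J <= Q k)%VS.
  apply/bracket_spaceP=> z _ zL /JP[i [c [iI ->]]]; rewrite brDr brZr.
  by rewrite memv_add // ?mem_bracket_space // memvZ // -rbrE memv_img.
have QJ k : (bracket_space (Q k) J <= L k.+1)%VS.
  apply/bracket_spaceP=> _ _ /memv_addP[a aL [_ /memv_imgP[z zL ->] ->]] /JP[i [c [iI ->]]].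
  rewrite rbrE brDl !brDr !brZr !memvD ?memvZ //.
  - by apply: (subvP (lower_central_ideal_decr Iid k.+1)); apply: mem_bracket_space.
  - exact: Lx.
  - by apply: mem_bracket_space => //; apply: Lx.
  - exact: sq_r.
suff [M ML] : exists M, (lower_central J M <= L n)%VS.
  by exists M; apply/eqP; rewrite -subv0 -In.
elim: (n) => [|k [M ML]].
  exists 1%N; apply: subv_trans RI; by apply: bracket_spaceS; rewrite subvf.
exists M.+2; rewrite !lower_centralS; apply: subv_trans (QJ k).
apply: bracket_spaceS => //; apply: subv_trans (LJ k); exact: bracket_spaceS.
Qed.

End OddPart.

(** * Nilpotent Lie algebras of maximal rank *)

Section MaximalRank.
Variables (K : numFieldType) (n : lieSuper K) (t : {vspace 'End(n)}).

(** A double centralizer argument: for a basis eigenvector with a nonzero coordinate in [v], hence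
    of the same eigenvalue, the operator sending x to that coordinate times [v] commutes with [h].
    So it commutes with [e], which forces e v to be a multiple of v. *)
Lemma generic_eigenvector (V : vectType K) (h e : 'End(V)) c v : semisimple h ->
  (forall f, commute_op f h -> commute_op f e) -> h v = c *: v ->
  exists c', e v = c' *: v.
Proof.
move=> ssh hgen hv; case: (eqVneq v 0) => [->|v0]; first by exists 0; rewrite linear0 scaler0.
have [b bb hb] := eigen_basis ssh; pose T := in_tuple b.
have vE := coord_basis (X := T) bb (memvf v).
have [i vi] : exists i, coord T i v != 0.
  apply: contrapT => /forallNP ni; case/negP: v0; rewrite vE big1 // => i _.
  by have /negP := ni i; rewrite negbK => /eqP->; rewrite scale0r.
have [|a ha] := hb b`_i; first by rewrite mem_nth.
have ac : a = c.
  apply: (mulIf vi); rewrite -(coord_eigenbasis v bb hb ha) hv linearZ //.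
pose el : 'End(V) := linfun (fun x => coord T i x *: v).
have elE x : el x = coord T i x *: v.
  by apply: linear_lfunE => a' y z; rewrite linearP scalerDl scalerA.
have elh : commute_op el h.
  by move=> x; rewrite !elE linearZ /= hv (coord_eigenbasis x bb hb ha) ac scalerA mulrC.
have := hgen el elh v; rewrite !elE linearZ /= => ev.
exists ((coord T i v)^-1 * coord T i (e v)).
by rewrite -scalerA ev scalerA mulVf // scale1r.
Qed.

Hypothesis nil : is_nilpotent n.
Hypothesis odd0 : odd_part n = 0%VS.
Hypothesis torT : is_torus t.
Let D := bracket_space (fullv : {vspace n}) fullv.
Hypothesis rank_t : \dim t = (\dim {:n} - \dim D)%N.

Lemma all_even (z : n) : z \in even_part n.
Proof. by have := memvf z; rewrite -(hpart_add n) odd0 addv0. Qed.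

(** Generators are taken in an eigenbasis of a generic element, so that all of [t] is diagonal on
    them. The weight map [lam] from [t] to K^(dim t) is injective, because a derivation killing
    generators of a nilpotent algebra is 0; equal dimensions make it bijective, and the [p i] are
    the preimages of the unit vectors. *)
Lemma maximal_rank_basis : exists (x : 'I_(\dim t) -> n) (p : 'I_(\dim t) -> subvs_of t),
  [/\ forall i j, (vsval (p i) : 'End(n)) (x j) = (i == j)%:R *: x j,
      forall i, x i \notin D,
      forall z, exists a : 'I_(\dim t) -> K, z - \sum_i a i *: x i \in D
    & forall e, exists a : 'I_(\dim t) -> K, e = \sum_i a i *: p i].
Proof.
have comT f g : f \in t -> g \in t -> commute_op f g.
  by move=> ft gt z; have /lfunP/(_ z) := proj2 torT _ _ ft gt; rewrite !comp_lfunE.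
have [h ht hgen] := generic_element (torus_semisimple torT) comT.
have [b bb hb] := eigen_basis (torus_semisimple torT ht).
have [X [sX eX dX]] := extract_complement b D.
have bf : (<<b>> + D)%VS = fullv.
  by rewrite (span_basis bb); apply/eqP; rewrite eqEsubv subvf addvSl.
rewrite bf in eX dX.
have szX : size X == \dim t by rewrite rank_t dX addnK.
pose Y := Tuple szX.
have bY : basis_of fullv (X ++ vbasis D).
  rewrite basisEdim span_cat (span_basis (vbasisP D)) eX subvv /=.
  by rewrite size_cat size_tuple -dX.
have := basis_free bY; rewrite cat_free => /and3P[fX _ dXD].
have eigY i (e : subvs_of t) : exists c, (vsval e : 'End(n)) Y`_i = c *: Y`_i.
  case: (ltnP i (size X)) => iX; last by exists 0; rewrite nth_default // linear0 scaler0.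
  have [c hc] : exists c, h Y`_i = c *: Y`_i by apply: hb; apply: sX; apply: mem_nth.
  apply: (generic_eigenvector (torus_semisimple torT ht) _ hc) => f.
  by apply: hgen; apply: subvsP.
pose lam_fun (e : subvs_of t) : 'rV[K]_(\dim t) := \row_i coord Y i ((vsval e : 'End(n)) Y`_i).
have lam_lin : linear lam_fun.
  by move=> a e f; apply/rowP=> i; rewrite !mxE linearP add_lfunE scale_lfunE linearP.
pose lam : 'Hom(subvs_of t, 'rV[K]_(\dim t)) := linfun lam_fun.
have lam_funE e : lam e = lam_fun e by apply: linear_lfunE.
have fY : free Y by [].
have lamE e (i : 'I_(\dim t)) : (vsval e : 'End(n)) Y`_i = lam e 0 i *: Y`_i.
  rewrite lam_funE mxE; have [c ->] := eigY i e.
  by rewrite linearZ /= (coord_free i i fY) eqxx mulr1.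
have decomp z : exists a : 'I_(\dim t) -> K, z - \sum_i a i *: Y`_i \in D.
  have := memvf z; rewrite -eX => /memv_addP[u uX [w wD ->]].
  exists (fun i => coord Y i u); move: uX => /(coord_span (X := Y)) {1}->.
  by rewrite addrC addKr.
have lam_inj : injective lam.
  suff lam0 e : lam e = 0 -> e = 0.
    by move=> e f /eqP; rewrite -subr_eq0 -linearB => /eqP/lam0/eqP; rewrite subr_eq0 => /eqP.
  move=> e0; apply/val_inj/lfunP=> z; rewrite /= zero_lfunE.
  have [[_ ebr] _] := proj1 torT _ (subvsP e).
  apply: (derivation_vanish (U := fullv) (E := fullv) nil ebr); last exact: memvf.
  - by move=> u _; apply: memvf.
  - move=> u _; have [a ua] := decomp u; exists (\sum_i a i *: Y`_i) => //.
    rewrite linear_sum big1 // => i _; rewrite linearZ /= lamE e0 mxE scale0r.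
    exact: scaler0.
  - move=> W eW u w _ _; rewrite br_even_r ?all_even // memvN.
    by rewrite mem_bracket_space ?eW ?memvf.
have lam_full : limg lam = fullv.
  apply/eqP; rewrite eqEdim subvf /= limg_dim_eq; last first.
    by have /lker0P/eqP-> := lam_inj; rewrite capv0.
  by rewrite !dimvf dim_matrix mul1r.
exists (fun i => Y`_i), (fun i => (lam^-1)%VF (delta_mx 0 i)); split.
- by move=> i j; rewrite lamE limg_lfunVK ?lam_full ?memvf // mxE eqxx eq_sym.
- move=> i; apply/negP => iD; have : Y`_i \in (<<X>> :&: D)%VS.
    by rewrite memv_cap iD memv_span // mem_nth // (eqP szX).
  move/directv_addP: dXD; rewrite (span_basis (vbasisP D)) => ->; rewrite memv0.
  by apply/negP; apply: (free_not0 fX); rewrite mem_nth // (eqP szX).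
- exact: decomp.
move=> e; exists (fun i => lam e 0 i); apply: lam_inj; rewrite linear_sum.
apply/rowP=> j; rewrite summxE (bigD1 j) //= big1 => [|i ij]; rewrite linearZ /= mxE.
  by rewrite limg_lfunVK ?lam_full ?memvf // mxE !eqxx mulr1 addr0.
by rewrite limg_lfunVK ?lam_full ?memvf // mxE eqxx eq_sym (negPf ij) mulr0.
Qed.

End MaximalRank.

(** * The structure of the extension *)

Lemma bij_lfun (K : fieldType) (U V : vectType K) (f : 'Hom(U, V)) : bijective f ->
  lker f = 0%VS /\ limg f = fullv.
Proof.
move=> [g fK gK]; split; first by apply/eqP/lker0P; apply: can_inj fK.
by apply/eqP; rewrite eqEsubv subvf; apply/subvP=> v _; rewrite -[v]gK memv_img ?memvf.
Qed.

(* The extension is split by the elements [sigma i], acting on [N] through the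
   derivations [D i], which are diagonal on the generators [x i] of [N_0]. *)
Record split_by (K : fieldType) (N R : lieSuper K) (iota : 'Hom(N, R)) (r : nat)
    (x : 'I_r -> N) (D : 'I_r -> 'End(N)) (sigma : 'I_r -> R) : Prop := SplitBy {
  gen_even : forall i, x i \in even_part N;
  gen_notin : forall i, x i \notin bracket_space (even_part N) (even_part N);
  gen_span : forall z, z \in even_part N -> exists a : 'I_r -> K,
    z - \sum_i a i *: x i \in bracket_space (even_part N) (even_part N);
  act_derivation : forall i, derivation (D i);
  act_commute : forall i j, commute_op (D i) (D j);
  act_gen : forall i j, D i (x j) = (i == j)%:R *: x j;
  sigma_even : forall i, sigma i \in even_part R;
  sigma_act : forall i z, br (iota z) (sigma i) = iota (D i z);
  sigma_br : forall i j, br (sigma i) (sigma j) = 0;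
  sigma_span : forall u, exists z (a : 'I_r -> K), u = iota z + \sum_i a i *: sigma i;
  sigma_free : forall a : 'I_r -> K,
    \sum_i a i *: sigma i \in limg iota -> forall i, a i = 0;
  sigma_codim : extension_codim iota = r
}.

Section Structure.
Variables (K : numFieldType) (N R : lieSuper K) (iota : 'Hom(N, R)).
Hypothesis iota_nilradical : is_nilradical_embedding iota.
Hypothesis iota_admissible : is_admissible iota.
Hypothesis R0_maxrank : solvable_of_maximal_rank (even_algebra R).

Let iota_inj : injective iota. Proof. by case: iota_nilradical. Qed.
Let iota_br x y : iota (br x y) = br (iota x) (iota y).
Proof. by case: iota_nilradical => -[]. Qed.
Let iota_hpart i x : x \in hpart N i -> iota x \in hpart R i.
Proof. by case: iota_nilradical => -[H _] _ _ xi; apply: subvP (H i) _ (memv_img _ xi). Qed.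

Let br_in x y : br x y \in limg iota.
Proof. by case: iota_admissible => /subvP H _; rewrite H // mem_bracket_space ?memvf. Qed.

Let iota_homogeneous i x : iota x \in hpart R i -> x \in hpart N i.
Proof.
have [x0 [x1 [x0e x1o ->]]] := hpart_decomposition x; rewrite linearD /= => ie.
case: i ie => ie.
  suff -> : x0 = 0 by rewrite add0r.
  apply: iota_inj; rewrite linear0; apply: hpart_disjoint; first exact: iota_hpart.
  by rewrite -[iota x0](addrK (iota x1)) memvB // iota_hpart.
suff -> : x1 = 0 by rewrite addr0.
apply: iota_inj; rewrite linear0; apply: hpart_disjoint; last exact: iota_hpart.
by rewrite -[iota x1](addKr (iota x0)) memvD ?memvN // iota_hpart.
Qed.

Lemma jacobi_even (L : lieSuper K) (s u v : L) : s \in even_part L ->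
  br s (br u v) = br (br s u) v + br u (br s v).
Proof.
move=> se; elim/hpart_ind: u => [u u' IH IH'|i u ui].
  by rewrite !(brDl, brDr) IH IH'; lincomb.
elim/hpart_ind: v => [v v' IH IH'|j v vj]; first by rewrite !(brDl, brDr) IH IH'; lincomb.
by rewrite (br_jacobi se ui vj) scale1r.
Qed.

Lemma br_even_derivation (L : lieSuper K) (s u v : L) : s \in even_part L ->
  br (br u v) s = br (br u s) v + br u (br v s).
Proof.
move=> se; rewrite !(br_even_r _ se) jacobi_even // brNl brNr; lincomb.
Qed.

Let E := even_algebra R.
Let val : 'Hom(E, R) := linfun (vsval : subvs_of (even_part R) -> R).
Let valE (e : E) : val e = vsval (e : subvs_of (even_part R)).
Proof. exact: (lfunE (vsval : {linear _ -> _})). Qed.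
Let val_br (e e' : E) : val (br e e') = br (val e) (val e').
Proof. by rewrite !valE even_brE. Qed.
Let val_inj : injective val.
Proof. by move=> e e'; rewrite !valE => /subvs_inj. Qed.
Let val_even e : val e \in even_part R.
Proof. by rewrite valE subvsP. Qed.
Let valP u : u \in even_part R -> exists e, u = val e.
Proof. by move=> ue; exists (vsproj (even_part R) u : E); rewrite valE vsprojK. Qed.

Lemma even_extension_data : exists r x D sigma, @split_by K N R iota r x D sigma.
Proof.
have [_ _ [n [iota0 [t [tmax [[[i0h i0br] i0inj nilrad0] dim_t]]]]]] := R0_maxrank.
case=> f [[fh fbr] fbij].
have [fker fimg] := bij_lfun fbij.
pose torT := maximal_torusW tmax.
have nil_n : is_nilpotent n.
  by case: nilrad0 => _ nl _; apply: nilpotent_preim i0br _ i0inj nl.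
have odd0 : odd_part n = 0%VS.
  apply/eqP; rewrite -subv0; apply/subvP => z zo; rewrite memv0; apply/eqP/i0inj.
  have := subvP (i0h true) _ (memv_img iota0 zo).
  by rewrite /= memv0 linear0 => /eqP.
have [x [p [px x_notin x_span p_span]]] := maximal_rank_basis nil_n odd0 torT dim_t.
pose r := \dim t.
pose g : 'Hom(semidirect torT, E) := (f^-1)%VF.
have gK v : f (g v) = v by rewrite limg_lfunVK // fimg memvf.
have fK e : g (f e) = e by rewrite lker0_lfunK // fker.
have gbr u v : g (br u v) = br (g u) (g v).
  by rewrite -[RHS]fK fbr !gK.
pose vg : 'Hom(semidirect torT, R) := (val \o g)%VF.
have vgE u : vg u = val (g u) by rewrite comp_lfunE.
have vgbr u v : vg (br u v) = br (vg u) (vg v) by rewrite !vgE gbr val_br.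
have vg_inj u v : vg u = vg v -> u = v.
  by rewrite !vgE => /val_inj e; rewrite -[u]gK e gK.
have vg_even u : vg u \in even_part R by rewrite vgE val_even.
have val_vg e : val e = vg (f e) by rewrite vgE fK.
clearbody vg.
pose H : 'Hom(n, R) := (vg \o semi_inl torT)%VF.
have HE z : H z = vg (z, 0) by rewrite comp_lfunE semi_inlE.
have Hbr z z' : H (br z z') = br (H z) (H z').
  have [_ sbr] := semi_inl_morphism torT.
  by rewrite !comp_lfunE sbr vgbr.
clearbody H.
pose sg c : R := vg ((0, c) : semidirect torT).
have H_sg z (c : subvs_of t) : br (H z) (sg c) = H ((vsval c : 'End(n)) z).
  rewrite !HE -vgbr semi_brE /= br0r.
  by rewrite !(linear0, zero_lfunE, add0r, subr0, addr0).
have sg_sg c c' : br (sg c) (sg c') = 0.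
  rewrite -vgbr; apply: etrans (linear0 vg); congr (vg _); rewrite semi_brE /= br0r.
  by congr pair; rewrite !(linear0, zero_lfunE, add0r, subr0, addr0, oppr0).
(* Every element of [n] is a combination of brackets: the generators satisfy x_i = [x_i, p_i], and
   [R, R] lies in N. *)
have HI z : H z \in limg iota.
  have [a az] := x_span z; rewrite -[z](subrK (\sum_i a i *: x i)) linearD /=.
  apply: memvD; last first.
    rewrite linear_sum; apply: memv_suml => i _; rewrite linearZ memvZ //=.
    have -> : H (x i) = H ((vsval (p i) : 'End(n)) (x i)) by rewrite px eqxx scale1r.
    by rewrite -H_sg br_in.
  move: az; have /subvP HD : (bracket_space (fullv : {vspace n}) fullv <= H @^-1: limg iota)%VS.
    by apply/bracket_spaceP=> u v _ _; rewrite -memv_preim Hbr br_in.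
  by move/HD; rewrite -memv_preim.
pose h : 'Hom(n, N) := (iota^-1 \o H)%VF.
have hE z : iota (h z) = H z by rewrite comp_lfunE limg_lfunVK.
have h_inj : injective h.
  move=> z z' /(congr1 iota); rewrite !hE !HE => /vg_inj; by case.
have h_br z z' : h (br z z') = br (h z) (h z').
  by apply: iota_inj; rewrite iota_br !hE Hbr.
have h_even z : h z \in even_part N by apply: iota_homogeneous; rewrite hE HE.
(* The isomorphism with the semidirect sum need not match [iota0], so dimensions are compared. The
   elements of R_0 lying in N form a nilpotent ideal of R_0, whence dim N_0 <= dim n. *)
have h_full : limg h = even_part N.
  apply/eqP; rewrite eqEdim; apply/andP; split.
    by apply/subvP=> _ /memv_imgP[z _ ->].
  rewrite limg_dim_eq; last by have /lker0P/eqP-> := h_inj; rewrite capv0.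
  have <- : \dim (limg iota0) = \dim {:n}.
    by rewrite limg_dim_eq //; have /lker0P/eqP-> := i0inj; rewrite capv0.
  pose J := (val @^-1: limg iota)%VS.
  have JI : (J <= limg iota0)%VS.
    case: nilrad0 => _ _; apply.
      split; first by rewrite /graded /= capvf capv0 addv0.
      by apply/bracket_spaceP => e e' _ _; rewrite -memv_preim val_br br_in.
    apply: (nilpotent_preim val_br val_inj).
    have [_ _ [_ [k Ik] _]] := iota_nilradical; exists k; apply/eqP; rewrite -subv0 -Ik.
    apply: lower_central_mono; apply/subvP=> _ /memv_imgP[e eJ ->].
    by move: eJ; rewrite -memv_preim.
  apply: leq_trans (dimvS JI).
  pose ev : 'Hom(N, E) := (linfun (vsproj (even_part R)) \o iota)%VF.
  have evE z : z \in even_part N -> val (ev z) = iota z.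
    by move=> ze; rewrite valE comp_lfunE lfunE /= vsprojK ?iota_hpart.
  have <- : \dim (ev @: even_part N) = \dim (even_part N).
    apply: limg_dim_eq; apply/eqP; rewrite -subv0; apply/subvP=> z.
    rewrite memv_cap memv_ker memv0 => /andP[ze /eqP z0].
    by apply/eqP/iota_inj; rewrite -evE // z0 !linear0.
  apply: dimvS; apply/subvP=> _ /memv_imgP[z ze ->].
  by rewrite -memv_preim evE // memv_img ?memvf.
have hP z : z \in even_part N -> exists z', z = h z'.
  by rewrite -h_full => /memv_imgP[z' _ ->]; exists z'.
have h_C : (h @: bracket_space fullv fullv)%VS =
    bracket_space (even_part N) (even_part N).
  by rewrite (bracket_space_img h_br) h_full.
have sg_even c : sg c \in even_part R by apply: vg_even.
pose act c : 'End(N) := (iota^-1 \o rbr (sg c) \o iota)%VF.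
have actE c z : iota (act c z) = br (iota z) (sg c).
  by rewrite !comp_lfunE rbrE limg_lfunVK ?br_in.
have act_h c z : act c (h z) = h ((vsval c : 'End(n)) z).
  by apply: iota_inj; rewrite actE !hE H_sg.
have sg_sum (a : 'I_r -> K) : \sum_i a i *: sg (p i) = sg (\sum_i a i *: p i).
  elim/big_rec2: _ => [|i c _ _ ->]; first by rewrite /sg -[LHS](linear0 vg).
  rewrite /sg -linearP; congr (vg _); congr pair.
  by rewrite /= scaler0 addr0.
have x0 i : x i != 0 by apply: contraNneq (x_notin i) => ->; rewrite mem0v.
have sg_free (a : 'I_r -> K) : \sum_i a i *: sg (p i) \in limg iota -> forall i, a i = 0.
  rewrite sg_sum => /memv_imgP[y _ sgy] i.
  have [z yz] : exists z, y = h z by apply/hP/iota_homogeneous; rewrite -sgy.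
  have : sg (\sum_i a i *: p i) = H z by rewrite sgy yz hE.
  rewrite HE => /vg_inj[_] /(congr1 (fun c : subvs_of t => (vsval c : 'End(n)) (x i))).
  rewrite linear_sum /= sum_lfunE zero_lfunE (bigD1 i) //= big1 => [|j ji].
    rewrite scale_lfunE px eqxx scale1r addr0 => /eqP.
    by rewrite scaler_eq0 (negPf (x0 i)) orbF => /eqP.
  by rewrite scale_lfunE px (negPf ji) scale0r scaler0.
have sg_span u : exists z (a : 'I_r -> K), u = iota z + \sum_i a i *: sg (p i).
  have [u0 [u1 [u0e u1o ->]]] := hpart_decomposition u.
  have [_ _ nilrad] := iota_nilradical; have [RI _] := iota_admissible.
  have /memv_imgP[z1 _ ->] := subvP (odd_in_nilradical nilrad RI) _ u1o.
  have [e ->] := valP u0e; rewrite val_vg; case: (f e) => z c.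
  have [a ->] := p_span c; exists (h z + z1), a.
  rewrite sg_sum [iota (_ + _)]linearD /= hE HE addrAC -linearD.
  by congr (vg _ + _); congr pair; rewrite /= ?addr0 ?add0r.
exists r, (fun i => h (x i)), (fun i => act (p i)), (fun i => sg (p i)); split.
- by [].
- move=> i; rewrite -h_C; apply/negP => /memv_imgP[z zD /h_inj xz].
  by case/negP: (x_notin i); rewrite xz.
- move=> _ /hP[z ->]; have [a az] := x_span z; exists a; rewrite -h_C.
  have -> : h z - \sum_i a i *: h (x i) = h (z - \sum_i a i *: x i).
    rewrite linearB; congr (_ - _); rewrite linear_sum.
    by apply: eq_bigr => i _; rewrite linearZ.
  exact: memv_img.
- move=> i; apply: derivationP => [j z zj|z z'].
    apply: iota_homogeneous; rewrite actE -[j]addbF; apply: br_hpart => //.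
    exact: iota_hpart.
  by apply: iota_inj; rewrite linearD /= !(iota_br, actE) br_even_derivation.
- move=> i j z; apply: iota_inj; rewrite !actE br_even_derivation //.
  by rewrite sg_sg br0r addr0.
- by move=> i j; rewrite act_h px linearZ.
- by [].
- by move=> i z; rewrite actE.
- by [].
- exact: sg_span.
- exact: sg_free.
have X_sum (a : 'I_r -> K) : \sum_(i < r) a i *: [tuple sg (p i) | i < r]`_i =
    \sum_i a i *: sg (p i).
  by apply: eq_bigr => i _; rewrite -tnth_nth tnth_mktuple.
pose X := [tuple sg (p i) | i < r].
have fX : free X.
  by apply/freeP=> a; rewrite X_sum => a0; apply: sg_free; rewrite a0 mem0v.
rewrite /extension_codim.
have -> : fullv = (limg iota + <<X>>)%VS.
  apply/esym/eqP; rewrite eqEsubv subvf; apply/subvP=> u _.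
  have [z [a ->]] := sg_span u; rewrite memv_add ?memv_img ?memvf // -X_sum.
  by apply: memv_suml => i _; rewrite memvZ // memv_span // mem_nth // size_tuple.
rewrite dimv_disjoint_sum; first by rewrite addKn (eqP fX) size_tuple.
apply/eqP; rewrite -subv0; apply/subvP=> u; rewrite memv_cap memv0 => /andP[uI].
move=> /(coord_span (X := X)) uE; rewrite uE X_sum in uI.
by rewrite uE big1 // => i _; rewrite (sg_free _ uI) scale0r.
Qed.

End Structure.

(** * Identification with the semidirect sum *)

Lemma isomorphic_sym (K : fieldType) (L M : lieSuper K) (f : 'Hom(L, M)) :
  is_morphism f -> bijective f -> isomorphic M L.
Proof.
move=> [fh fbr] fbij; have [fker fimg] := bij_lfun fbij.
have gK v : f ((f^-1)%VF v) = v by rewrite limg_lfunVK // fimg memvf.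
have fK u : (f^-1)%VF (f u) = u by rewrite lker0_lfunK // fker.
have f_inj := can_inj fK.
have fhi i u : u \in hpart L i -> f u \in hpart M i by move=> ui; rewrite (subvP (fh i)) ?memv_img.
exists (f^-1)%VF; split; last by exists f.
split=> [i|u v]; last by apply: f_inj; rewrite fbr !gK.
apply/subvP=> _ /memv_imgP[v vi ->].
have [u0 [u1 [u0e u1o uE]]] := hpart_decomposition ((f^-1)%VF v).
have vE : v = f u0 + f u1 by rewrite -[LHS]gK uE linearD.
rewrite uE; case: i vi => vi.
  suff -> : u0 = 0 by rewrite add0r.
  apply: f_inj; rewrite linear0; apply: hpart_disjoint; first exact: (fhi false).
  by rewrite -[f u0](addrK (f u1)) -vE memvB // (fhi true).
suff -> : u1 = 0 by rewrite addr0.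
apply: f_inj; rewrite linear0; apply: hpart_disjoint; last exact: (fhi true).
by rewrite -[f u1](addKr (f u0)) -vE memvD ?memvN // (fhi false).
Qed.

Lemma torusP (K : fieldType) (N : lieSuper K) (T : {vspace 'End(N)}) :
  (forall d, d \in T -> derivation d) -> (forall d, d \in T -> semisimple d) ->
  (forall d e, d \in T -> e \in T -> commute_op d e) -> is_torus T.
Proof.
move=> dT ssT comT; split=> [d dinT|d e dinT einT].
  by split; [exact: dT | apply: eigen_basis (ssT d dinT)].
by apply/lfunP=> z; rewrite !comp_lfunE comT.
Qed.

Section Assembly.
Variables (K : numClosedFieldType) (N R : lieSuper K) (iota : 'Hom(N, R)).
Variables (r : nat) (x : 'I_r -> N) (D : 'I_r -> 'End(N)) (sigma : 'I_r -> R).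
Hypothesis N_nilpotent : is_nilpotent N.
Hypothesis R_maxext : is_maximal_solvable_extension iota.
Hypothesis split_R : split_by iota x D sigma.

Let x_even := gen_even split_R.
Let x_notin := gen_notin split_R.
Let N0_gen := gen_span split_R.

Lemma semisimple_parts : exists p : 'I_r -> 'End(N),
  [/\ forall i, derivation (p i) /\ semisimple (p i),
      forall i, exists n, forall z, iter n (D i - p i) z = 0,
      forall i j, commute_op (p i) (p j) /\ commute_op (p i) (D j)
    & forall i j, p i (x j) = (i == j)%:R *: x j].
Proof.
have /choice[p pP] i := semisimple_part_derivation (act_derivation split_R i).
have pD i j : commute_op (p i) (D j).
  have [_ _ _ pcomm _] := pP i; move=> z; apply/esym.
  by move: z; apply: pcomm => z; apply: act_commute split_R _ _ _.
exists p; split=> [i|i|i j|i j].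
- by case: (pP i).
- by case: (pP i).
- by split=> //; have [_ _ _ pcomm _] := pP j; apply: pcomm.
have [_ _ _ _ peig] := pP i; apply: (peig _ _ 1%N).
by rewrite /= shiftE (act_gen split_R) subrr.
Qed.

Section Torus.
Variable p : 'I_r -> 'End(N).
Hypothesis p_der : forall i, derivation (p i).
Hypothesis p_ss : forall i, semisimple (p i).
Hypothesis p_comm : forall i j, commute_op (p i) (p j).
Hypothesis p_x : forall i j, p i (x j) = (i == j)%:R *: x j.

Let T1 : {vspace 'End(N)} := <<[tuple p i | i < r]>>%VS.

Let x_neq0 i : x i != 0.
Proof. by apply: contraNneq (x_notin i) => ->; rewrite mem0v. Qed.

Let p_in i : p i \in T1.
Proof. by apply/memv_span/tnthP; exists i; rewrite tnth_mktuple. Qed.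

Let p_comb_in a : p_comb p a \in T1.
Proof. by apply: memv_suml => i _; rewrite memvZ. Qed.

Let p_tuple_sum (a : 'I_r -> K) :
  \sum_(i < r) a i *: [tuple p i | i < r]`_i = p_comb p a.
Proof. by apply: eq_bigr => i _; rewrite -tnth_nth tnth_mktuple. Qed.

Lemma p_comb_inj a b : p_comb p a = p_comb p b -> a =1 b.
Proof.
move=> /lfunP e i; have := e (x i); rewrite !(p_comb_x p_x) => /eqP.
by rewrite -subr_eq0 -scalerBl scaler_eq0 (negPf (x_neq0 i)) orbF subr_eq0 => /eqP.
Qed.

Lemma p_free : free [tuple p i | i < r].
Proof.
apply/freeP=> a; rewrite p_tuple_sum => a0 i.
apply: (p_comb_inj (b := fun=> 0)); rewrite a0 /p_comb big1 // => j _.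
by rewrite scale0r.
Qed.

Lemma torus_rank (T : {vspace 'End(N)}) : is_torus T -> (T1 <= T)%VS -> (\dim T <= r)%N.
Proof.
move=> torT sT; rewrite -(semi_codim torT) -(sigma_codim split_R).
have [_ Rmax] := R_maxext; apply: Rmax; first exact: semi_solvable_extension.
apply: semi_admissible => z /N0_gen[a za].
exists (z - \sum_i a i *: x i) => //.
(* Containing T_1 is what matters: a_i x_i = p_i (a_i x_i) with p_i in [T]. *)
exists 'I_r, (fun i => a i *: x i), (fun i => vsproj T (p i)).
split=> [i|]; first by rewrite memvZ.
rewrite [X in _ + X](eq_bigr (fun i => a i *: x i)) ?subrK // => i _.
by rewrite vsprojK ?(subvP sT) // linearZ /= p_x eqxx scale1r.
Qed.

Lemma torus_maximal d : derivation d -> semisimple d ->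
  (forall i, commute_op (p i) d) -> exists a : 'I_r -> K, d = p_comb p a.
Proof.
move=> dd ssd dcomm; apply: p_span_comb.
pose T2 := (T1 + <[d]>)%VS.
have T2P e : e \in T2 -> exists a c, e = p_comb p a + c *: d.
  by case/memv_addP=> _ /p_span_comb[a ->] [_ /vlineP[c ->] ->]; exists a, c.
have pd a : commute_op (p_comb p a) d.
  by move=> z; have := commute_p_comb a dcomm z.
have pp a b : commute_op (p_comb p a) (p_comb p b) by apply: p_comb_commute.
have sD := derivation_submod N.
have tor2 : is_torus T2.
  apply: torusP.
  - move=> _ /T2P[a [c ->]]; apply: (submodD sD); first exact: p_comb_derivation.
    exact: submodZ.
  - move=> _ /T2P[a [c ->]]; apply: semisimpleD; first exact: p_comb_semisimple.
      exact: semisimple_scale.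
    by move=> z; rewrite !scale_lfunE linearZ /= pd.
  - move=> _ _ /T2P[a [c ->]] /T2P[b [c' ->]] z.
    rewrite !add_lfunE !scale_lfunE !linearD /= ![p_comb p _ (_ *: _)]linearZ
      ![d (_ *: _)]linearZ /= pp !pd.
    by lincomb.
have : (\dim T2 <= \dim T1)%N.
  by rewrite (eqP p_free) size_tuple; apply: torus_rank tor2 (addvSl _ _).
move=> dimT2; have T12 : T1 = T2 by apply/eqP; rewrite eqEdim addvSl.
rewrite -/T1 T12.
by rewrite -[d]add0r memv_add ?mem0v ?memv_line.
Qed.

Variable T : {vspace 'End(N)}.
Hypothesis T_max : is_maximal_torus T.

(** A generic [d] of [T] is moved into T_1. Each [p i], moved back, commutes with [d], hence with
    [T]; so the conjugate of [T] centralizes T_1 and lies in it. Moving T_1 back gives a torus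
    containing [T], and maximality of [T] makes them equal. *)
Lemma maximal_torus_conjugate : exists phi psi, automorphism phi psi /\
  (forall e, e \in T -> exists a, conj_op phi psi e = p_comb p a) /\
  (forall a, conj_op psi phi (p_comb p a) \in T).
Proof.
have torT := maximal_torusW T_max.
have comT f g : f \in T -> g \in T -> commute_op f g.
  by move=> ft gt z; have /lfunP/(_ z) := proj2 torT _ _ ft gt; rewrite !comp_lfunE.
have [d dT dgen] := generic_element (torus_semisimple torT) comT.
have derT e : e \in T -> derivation e by case/(proj1 torT).
have [phi [psi [a [au da]]]] := conjugacy x_even x_notin p_der p_ss p_comm p_x N0_gen
  torus_maximal (derT d dT) (torus_semisimple torT dT).
have au' := automorphism_inv au.
have toT1 e : e \in T -> exists b, conj_op phi psi e = p_comb p b.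
  move=> eT; apply: torus_maximal.
  - exact: conj_op_derivation au (derT e eT).
  - exact: conj_op_semisimple au (torus_semisimple torT eT).
  move=> i; rewrite -[p i](conj_opK _ au'); apply: (conj_op_commute au).
  apply: dgen eT _; rewrite -[d](conj_opK _ au) da; apply: (conj_op_commute au').
  exact: commute_p_comb.
exists phi, psi; split=> //; split=> // b.
pose cj : 'End('End(N)) := linfun (conj_op psi phi).
have cjE e : cj e = conj_op psi phi e by rewrite /cj lfunE.
have T3P e : e \in (cj @: T1)%VS -> exists c, e = conj_op psi phi (p_comb p c).
  by case/memv_imgP=> _ /p_span_comb[c ->] ->; exists c; rewrite cjE.
have pp c c' : commute_op (p_comb p c) (p_comb p c') by apply: p_comb_commute.
suff <- : (cj @: T1)%VS = T by rewrite -cjE memv_img.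
case: T_max => _; apply.
  apply: torusP.
  - by move=> _ /T3P[c ->]; apply: conj_op_derivation au' (p_comb_derivation p_der c).
  - by move=> _ /T3P[c ->]; apply: conj_op_semisimple au' (p_comb_semisimple p_ss p_comm c).
  - by move=> _ _ /T3P[c ->] /T3P[c' ->]; apply: (conj_op_commute au').
apply/subvP=> e eT; have [c ec] := toT1 e eT.
by rewrite -[e](conj_opK _ au) ec -cjE memv_img.
Qed.

Hypothesis Dp_nil : forall i, exists n, forall z, iter n (D i - p i) z = 0.
Hypothesis pD_comm : forall i j, commute_op (p i) (D j).

Variables (m s : nat) (y : m.-tuple N) (beta : 'I_m -> 'Hom(subvs_of T, K^o)).
Hypothesis y_basis : odd_basis_with_generators s y.
Hypothesis y_root : forall j, has_root (beta j) (tnth y j).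
Hypothesis beta_neq : forall i j : 'I_m, (i < s)%N -> j != i -> beta i <> beta j.

Section Conjugated.
Variables phi psi : 'End(N).
Hypothesis au : automorphism phi psi.
Hypothesis toT1 : forall e, e \in T -> exists a, conj_op phi psi e = p_comb p a.
Hypothesis toT : forall a, conj_op psi phi (p_comb p a) \in T.

Let wt k i : K := beta k (vsproj T (conj_op psi phi (p i))).

Lemma p_conj_in i : conj_op psi phi (p i) \in T.
Proof.
have -> : p i = p_comb p (fun j => (i == j)%:R); last exact: toT.
rewrite /p_comb (bigD1 i) //= eqxx scale1r big1 ?addr0 // => j ji.
by rewrite eq_sym (negPf ji) scale0r.
Qed.

Lemma p_root k i : p i (phi (tnth y k)) = wt k i *: phi (tnth y k).
Proof.
have [_ yk] := y_root k; have := yk (vsproj T (conj_op psi phi (p i))).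
rewrite vsprojK ?p_conj_in // conj_opE => /(congr1 phi).
by have [_ psiK _ _ _] := au; rewrite psiK linearZ.
Qed.

(** The conjugated [p i] span [T], so a root is determined by its values on them. *)
Lemma weights_separate k l : (forall i, wt k i = wt l i) -> beta k = beta l.
Proof.
move=> kl; apply/lfunP=> e; have [a ea] := toT1 (subvsP e).
have -> : e = \sum_i a i *: vsproj T (conj_op psi phi (p i)).
  apply: subvs_inj; rewrite linear_sum -[LHS](conj_opK _ au) ea /p_comb linear_sum.
  by apply: eq_bigr => i _; rewrite !linearZ /= vsprojK ?p_conj_in.
rewrite !linear_sum; apply: eq_bigr => i _; rewrite !linearZ /=.
by congr (_ *: _); apply: kl.
Qed.

(** On N_0 the difference kills the generators [x j]; on N_1 it kills the transported generators
    [phi (tnth y k)], k < s. [derivation_vanish] applies to each part, with brackets taken against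
    N_0. *)
Lemma nilpotent_part_vanishes i : D i = p i.
Proof.
pose q := D i - p i; suff q0 z : q z = 0.
  by apply/eqP; rewrite -subr_eq0; apply/eqP/lfunP=> z; rewrite zero_lfunE q0.
have sD := derivation_submod N.
have qd : derivation q by apply: (submodB sD) (act_derivation split_R i) (p_der i).
have [_ qbr] := qd.
have qcomm j : commute_op (p j) q.
  by move=> u; rewrite !add_lfunE !opp_lfunE linearB /= pD_comm p_comm.
have [n qn] := Dp_nil i; rewrite -/q in qn.
have q_even u : u \in even_part N -> q u = 0.
  apply: (derivation_vanish (E := even_part N) N_nilpotent qbr).
  - by move=> v; apply: derivation_hpart.
  - move=> v /N0_gen[a va]; exists (\sum_j a j *: x j) => //.
    rewrite linear_sum big1 // => j _; rewrite linearZ /= add_lfunE opp_lfunE.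
    by rewrite (act_gen split_R) p_x subrr scaler0.
  - move=> W qW u' w u'e we; rewrite br_even_r ?(derivation_hpart qd) // memvN.
    by rewrite mem_bracket_space ?qW.
have [yb sm [_ [yW _]] _] := y_basis.
have [phiK psiK phibr phih psih] := au.
have fy : free y by apply: basis_free yb.
have phiy_odd k : phi (tnth y k) \in odd_part N.
  by apply: phih; apply: (basis_mem yb); rewrite mem_tnth.
have q_gen (k : 'I_m) : (k < s)%N -> q (phi (tnth y k)) = 0.
  move=> ks; pose u := psi (q (phi (tnth y k))).
  have uo : u \in odd_part N by apply/psih/(derivation_hpart qd).
  have uE := coord_basis yb uo.
  (* [phi u] has the same weights under the [p j] as [phi (tnth y k)]. For l != k some [p j]
     separates the two roots, and comparing the coordinates at y_l gives 0. *)
  have c0 l : l != k -> coord y l u = 0.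
    move=> lk; have [j wj] : exists j, wt k j <> wt l j.
      apply: contrapT => /forallNP nj; apply: (beta_neq ks lk).
      by apply: weights_separate => j; apply: contrapT => /nj.
    have e1 : p j (phi u) = wt k j *: phi u.
      by rewrite psiK -/q qcomm p_root linearZ.
    have e2 : \sum_l (coord y l u * (wt l j - wt k j)) *: y`_l = 0.
      apply: (can_inj phiK); rewrite linear0.
      have -> : \sum_l (coord y l u * (wt l j - wt k j)) *: y`_l =
        \sum_l (coord y l u * wt l j) *: y`_l - wt k j *: u.
        rewrite [X in _ - _ *: X]uE scaler_sumr -sumrB; apply: eq_bigr => l' _.
        by rewrite scalerA mulrBr scalerBl [wt k j * _]mulrC.
      have phi_sum (c : 'I_m -> K) : phi (\sum_l c l *: y`_l) = \sum_l c l *: phi y`_l.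
        by rewrite linear_sum; apply: eq_bigr => l' _; rewrite linearZ.
      rewrite linearB linearZ /= -e1 [X in p j (phi X)]uE !phi_sum [p j _]linear_sum.
      rewrite -sumrB big1 // => l' _.
      by rewrite /= [p j _]linearZ /= -tnth_nth p_root scalerA subrr.
    have /(freeP (X := y))/(_ _ e2 l)/eqP := fy.
    by rewrite mulf_eq0 subr_eq0 => /orP[/eqP//|/eqP e]; case: wj.
  have qk : q (phi (tnth y k)) = coord y k u *: phi (tnth y k).
    rewrite -[LHS]psiK -/u {1}uE (bigD1 k) //= big1 => [|l lk]; last by rewrite c0 ?scale0r.
    by rewrite addr0 linearZ /= -tnth_nth.
  have := iter_eig n qk; rewrite qn => /esym/eqP; rewrite scaler_eq0 expf_eq0.
  case/orP=> [/andP[_ /eqP c00]|/eqP y0]; first by rewrite qk c00 scale0r.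
  by rewrite y0 linear0.
have q_odd u : u \in odd_part N -> q u = 0.
  apply: (derivation_vanish (E := even_part N) N_nilpotent qbr).
  - by move=> v; apply: derivation_hpart.
  - move=> v vo; have: psi v \in (<<take s y>> + bracket_space (odd_part N) (even_part N))%VS.
      by rewrite yW; apply: psih vo.
    case/memv_addP=> g gs [w wW e].
    exists (phi g).
      move: gs => /(coord_span (X := in_tuple (take s y))) ->.
      rewrite !linear_sum big1 // => k _; rewrite !linearZ /=.
      have [km ks] : (k < m)%N /\ (k < s)%N.
        move: (ltn_ord k); move: (nat_of_ord k) => k'.
        by rewrite size_take size_tuple; case: ifP => ?; lia.
      rewrite nth_take // -(tnth_nth _ y (Ordinal km)) q_gen ?scaler0 //.
    have -> : v - phi g = phi w by rewrite -{1}[v]psiK e linearD addrC addKr.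
    suff: (bracket_space (odd_part N) (even_part N) <=
        phi @^-1: bracket_space (odd_part N) (even_part N))%VS.
      by move/subvP/(_ _ wW); rewrite -memv_preim.
    apply/bracket_spaceP=> a b ao be; rewrite -memv_preim phibr.
    by rewrite mem_bracket_space // ?(phih true) ?(phih false).
  - by move=> W _ u' w _ we; rewrite q_even // br0r mem0v.
have [z0 [z1 [z0e z1o ->]]] := hpart_decomposition z.
by rewrite linearD /= q_even // q_odd // addr0.
Qed.

(** The map is built from the semidirect sum to R, where both summands have explicit images, and
    inverted at the end. A torus element c goes to the combination of the [sigma j] whose
    coefficients are the coordinates of phi c psi on the [p j], to match [phi] on N. *)
Lemma semidirect_isomorphic : isomorphic R (semidirect (maximal_torusW T_max)).
Proof.
have [phiK psiK phibr phih psih] := au.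
pose X := [tuple p i | i < r].
pose a (c : subvs_of T) j : K := coord X j (conj_op phi psi (vsval c)).
have aE c : conj_op phi psi (vsval c) = p_comb p (a c).
  have [b bE] := toT1 (subvsP c); rewrite bE; apply: eq_bigr => j _.
  by rewrite /a bE -p_tuple_sum coord_sum_free ?p_free.
have [[ih ibr] i_inj _] := (proj2 (proj1 R_maxext)).
pose S := semidirect (maximal_torusW T_max).
have a_lin b c c' j : a (b *: c + c') j = b * a c j + a c' j.
  rewrite /a.
  have -> : vsval (b *: c + c') = b *: vsval c + vsval c' by [].
  by rewrite linearP /= linearP.
pose sg (b : 'I_r -> K) : R := \sum_j b j *: sigma j.
have sg_even b : sg b \in even_part R.
  by apply: memv_suml => j _; rewrite memvZ // (sigma_even split_R).
have br_sg w b : br (iota w) (sg b) = iota (p_comb p b w).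
  rewrite /sg p_combE linear_sum; elim/big_rec2: _ => [|j u v _ <-]; first exact: br0r.
  by rewrite brDr brZr (sigma_act split_R) nilpotent_part_vanishes linearZ.
have sg_sg b b' : br (sg b) (sg b') = 0.
  rewrite /sg; elim/big_rec: _ => [|j u _ u0]; first exact: br0l.
  rewrite brDl u0 addr0 brZl; elim/big_rec: _ => [|k v _ v0]; first by rewrite br0r scaler0.
  by rewrite brDr brZr (sigma_br split_R) scaler0 add0r.
pose G_fun (u : S) : R := iota (phi u.1) + sg (a u.2).
have G_lin : linear G_fun.
  move=> b u v; rewrite /G_fun /= !linearP scalerDr addrACA; congr (_ + _).
  rewrite /sg scaler_sumr -big_split; apply: eq_bigr => j _.
  by rewrite a_lin scalerDl scalerA.
pose G : 'Hom(S, R) := linfun G_fun.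
have GE z c : G (z, c) = iota (phi z) + sg (a c).
  exact: (linear_lfunE G_lin).
have a0 j : a 0 j = 0 by rewrite /a !linear0.
have sg0 : sg (a 0) = 0 by rewrite /sg big1 // => j _; rewrite a0 scale0r.
have phi_act c z : p_comb p (a c) (phi z) = phi ((vsval c : 'End(N)) z).
  by rewrite -aE conj_opE phiK.
apply: (isomorphic_sym (f := G)).
  split=> [i|[z c] [z' c']].
    apply/subvP=> _ /memv_imgP[[z c] + ->]; rewrite mem_semi_hpart GE => /andP[/= zi].
    case: i zi => [zi /eqP -> | zi _].
      by rewrite sg0 addr0 (subvP (ih true)) // memv_img // (phih true).
    by rewrite memvD // (subvP (ih false)) // memv_img // (phih false).
  rewrite semi_brE !GE sg0 addr0 /= !(brDl, brDr) sg_sg addr0 br_sg phi_act.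
  rewrite -[br (sg _) _]opprK -br_even_r // br_sg phi_act -ibr -phibr.
  rewrite [phi (_ - _)]linearB /= [phi (_ + _)]linearD /=.
  by rewrite [iota (_ - _)]linearB /= [iota (_ + _)]linearD.
have c_inj c : p_comb p (a c) = 0 -> c = 0.
  rewrite -aE => /(congr1 (conj_op psi phi)); rewrite (conj_opK _ au) linear0.
  by move=> c0; apply: subvs_inj; rewrite c0 linear0.
have G_inj : injective G.
  suff G0 u : G u = 0 -> u = 0.
    by move=> u v /eqP; rewrite -subr_eq0 -linearB => /eqP/G0/eqP; rewrite subr_eq0 => /eqP.
  case: u => z c; rewrite GE => e.
  have ac : forall j, a c j = 0.
    apply: (sigma_free split_R); rewrite -/(sg (a c)).
    by rewrite -[sg _](addKr (iota (phi z))) e addr0 memvN memv_img ?memvf.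
  have c0 : c = 0.
    by apply: c_inj; rewrite /p_comb big1 // => j _; rewrite ac scale0r.
  move: e; rewrite c0 sg0 addr0 => /eqP; rewrite -(linear0 iota) (inj_eq i_inj).
  by rewrite -(linear0 phi) (inj_eq (can_inj phiK)) => /eqP->.
have G_surj u : exists v, G v = u.
  have [w [b ->]] := sigma_span split_R u.
  pose c := vsproj T (conj_op psi phi (p_comb p b)).
  exists (psi w, c); rewrite GE psiK; congr (_ + _); apply: eq_bigr => j _.
  congr (_ *: _); rewrite /a /c vsprojK ?toT // (conj_opK _ (automorphism_inv au)).
  by rewrite -p_tuple_sum coord_sum_free ?p_free.
have /choice[H GH] := G_surj.
by exists H => // u; apply: G_inj; rewrite GH.
Qed.

End Conjugated.

End Torus.

End Assembly.

Lemma maximal_extension_semidirect (K : numClosedFieldType) (N R : lieSuper K)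
    (iota : 'Hom(N, R)) (T : {vspace 'End(N)}) (m s : nat) (y : m.-tuple N)
    (beta : 'I_m -> 'Hom(subvs_of T, K^o)) (T_max : is_maximal_torus T) :
  is_nilpotent N -> is_maximal_solvable_extension iota -> is_admissible iota ->
  odd_basis_with_generators s y -> (forall j, has_root (beta j) (tnth y j)) ->
  solvable_of_maximal_rank (even_algebra R) ->
  (forall i j : 'I_m, (i < s)%N -> j != i -> beta i <> beta j) ->
  isomorphic R (semidirect (maximal_torusW T_max)).
Proof.
move=> nilN maxR admR y_basis y_root R0max beta_neq.
have [r [x [D [sigma split_R]]]] := even_extension_data (proj2 (proj1 maxR)) admR R0max.
have [p [p_ds Dp_nil pcomm p_x]] := semisimple_parts split_R.
have p_der i := proj1 (p_ds i); have p_ss i := proj2 (p_ds i).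
have p_comm i j := proj1 (pcomm i j); have pD_comm i j := proj2 (pcomm i j).
have [phi [psi [au [toT1 toT]]]] :=
  maximal_torus_conjugate nilN maxR split_R p_der p_ss p_comm p_x T_max.
exact: (semidirect_isomorphic nilN maxR split_R p_der p_comm p_x T_max Dp_nil
  pD_comm y_basis y_root beta_neq au toT1 toT).
Qed.

Unset Implicit Arguments.
Set Strict Implicit.
Set Printing Implicit Defensive.

(* The complex numbers are [F[i]], for [F] the field of real numbers. *)
Theorem theorem5p3 (F : realType) (N R : lieSuper F[i]) (iota : 'Hom(N, R))
    (T : {vspace 'End(N)}) (m s : nat) (y : m.-tuple N)
    (beta : 'I_m -> 'Hom(subvs_of T, (F[i])^o))
    (N_nilpotent : is_nilpotent N)
    (R_maxext : is_maximal_solvable_extension iota)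
    (R_non_nilpotent : ~ is_nilpotent R)
    (R_admissible : is_admissible iota)
    (T_max : is_maximal_torus T)
    (y_basis : odd_basis_with_generators s y)
    (y_root : forall j : 'I_m, has_root (beta j) (tnth y j))
    (R0_maxrank : solvable_of_maximal_rank (even_algebra R))
    (beta_neq : forall i j : 'I_m, (i < s)%N -> j != i -> beta i <> beta j) :
  isomorphic R (semidirect (maximal_torusW T_max)).
Proof.
exact: (maximal_extension_semidirect T_max N_nilpotent R_maxext R_admissible y_basis
  y_root R0_maxrank beta_neq).
Qed.
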